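(* Let $K$ be a field. Let $\mathcal{Q}$ be the quiver with vertices $1,\dots,17$ and arrows $\alpha_1:1\to2$, $\alpha_2:2\to3$, $\alpha_3:3\to4$, $\alpha_4:4\to5$, $\alpha_5:5\to6$, $\alpha_6:6\to12$, $\alpha_7:1\to7$, $\alpha_8:7\to8$, $\alpha_9:8\to9$, $\alpha_{10}:9\to10$, $\alpha_{11}:10\to11$, $\alpha_{12}:11\to12$, $\alpha_{13}:12\to13$, $\alpha_{14}:13\to14$, $\alpha_{15}:14\to15$, $\alpha_{16}:15\to16$, $\alpha_{17}:16\to17$, $\alpha_{18}:17\to12$, and let $\Lambda=K\mathcal{Q}/I$, where $I$ is generated by $$\alpha_1\alpha_2\alpha_3\alpha_4\alpha_5\alpha_6-\alpha_7\alpha_8\alpha_9\alpha_{10}\alpha_{11}\alpha_{12},\quad \alpha_3\alpha_4\alpha_5\alpha_6\alpha_{13}\alpha_{14},\quad \alpha_5\alpha_6\alpha_{13}\alpha_{14}\alpha_{15}\alpha_{16},\quad \alpha_9\alpha_{10}\alpha_{11}\alpha_{12}\alpha_{13}\alpha_{14},$$ $$\alpha_{11}\alpha_{12}\alpha_{13}\alpha_{14}\alpha_{15}\alpha_{16},\quad \alpha_{13}\alpha_{14}\alpha_{15}\alpha_{16}\alpha_{17}\alpha_{18},\quad \alpha_{15}\alpha_{16}\alpha_{17}\alpha_{18}\alpha_{13}\alpha_{14},\quad \alpha_{17}\alpha_{18}\alpha_{13}\alpha_{14}\alpha_{15}\alpha_{16}$$ ($\Lambda$ is a $(6,2)$-stacked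 algebra). Let $\hat{E}(\Lambda)$ be the Ext algebra of $\Lambda$ with the hat-degree grading. Then $\hat{E}(\Lambda)$ is a Koszul algebra.
   Context: Paths are read left to right. $\Lambda$ has the length grading $\Lambda=\Lambda_0\oplus\Lambda_1\oplus\cdots$, with graded radical $\mathfrak{r}=\Lambda_1\oplus\Lambda_2\oplus\cdots$; $\Lambda_0\cong\Lambda/\mathfrak{r}$ is a graded right $\Lambda$-module, and $E(\Lambda)=\bigoplus_{n\geqslant0}\operatorname{Ext}^n_\Lambda(\Lambda_0,\Lambda_0)$ with the Yoneda product. A finite-dimensional algebra $\Lambda=K\mathcal{Q}/I$ is $(D,A)$-stacked if, for all $0\leqslant n\leqslant\operatorname{gldim}\Lambda$, the $n$th projective in a minimal graded projective resolution of $\Lambda_0$ is generated in degree $\delta(n)$, where $\delta(0)=0$, $\delta(1)=1$, $\delta(n)=\frac n2D$ for $n\geqslant2$ even, and $\delta(n)=\frac{n-1}2D+A$ for $n\geqslant3$ odd. Hat-degree grading: $\hat{E}(\Lambda)=\bigoplus_{n\geqslant0}\hat{E}(\Lambda)_n$ with $\hat{E}(\Lambda)_0=\operatorname{Ext}^0_\Lambda(\Lambda_0,\Lambda_0)$, $\hat{E}(\Lambda)_1=\operatorname{Ext}^1_\Lambda(\Lambda_0,\Lambda_0)\oplus\operatorname{Ext}^2_\Lambda(\Lambda_0,\Lambda_0)\oplus\operatorname{Ext}^3_\Lambda(\Lambda_0,\Lambda_0)$, $\hat{E}(\Lambda)_n=\operatorname{Ext}^{2n}_\Lambda(\Lambda_0,\Lambda_0)\oplus\operatorname{Ext}^{2n+1}_\Lambda(\Lambda_0,\Lambda_0)$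 for $n\geqslant2$; this is an algebra grading on $E(\Lambda)$. A graded algebra $B=\bigoplus_{n\geqslant 0}B_n$ with $B_0$ a finite product of copies of $K$ is Koszul if $B_0$ has a linear resolution, i.e. the $n$th projective in a minimal graded projective resolution of $B_0$ over $B$ is generated in degree $n$ for all $n$. *)

(* Defs.v *)
From HB Require Import structures.
From mathcomp Require Import all_boot all_order all_algebra.
From mathcomp Require Import finmap.
From mathcomp Require Import boolp classical_sets functions.
From mathcomp Require Import generic_quotient ring_quotient monalg.

Set Implicit Arguments.
Unset Strict Implicit.
Unset Printing Implicit Defensive.

Import GRing.Theory.

Local Open Scope classical_set_scope.
Local Open Scope quotient_scope.
Local Open Scope ring_scope.

(* Right modules over [A] are modules over the converse ring [A^c], with      *)
(* [x . a] written [(a : A^c) *: x]; the right regular module is [A^c^o].     *)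

(* [K]-algebras as rings with a central ring morphism from [K], the zero ring *)
(* included: [algType K] requires [1 != 0], which is not available for a      *)
(* quotient by arbitrary relations.                                           *)
HB.mixin Record isCentralAlgebra (K : fieldType) A of GRing.PzRing A := {
  scal : {rmorphism K -> A};
  scalC : forall (a : K) (x : A), scal a * x = x * scal a
}.

#[short(type="pzAlgType")]
HB.structure Definition PzAlgebra (K : fieldType) :=
  {A of GRing.PzRing A & isCentralAlgebra K A}.

Section Quotients.

Definition submodule (R : pzRingType) (V : lmodType R) (U : set V) : Prop :=
  U 0 /\ forall a x y, U x -> U y -> U (a *: x + y).

Definition gen_submod (R : pzRingType) (V : lmodType R) (S : set V) : set V :=
  [set x | forall U, submodule U -> S `<=` U -> U x].

Definition two_sided (A : pzRingType) (U : set A) : Prop :=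
  [/\ U 0, forall x y, U x -> U y -> U (x + y) & forall a b x, U x -> U (a * x * b)].

Definition ideal_gen (A : pzRingType) (S : set A) : set A :=
  [set x | forall U, two_sided U -> S `<=` U -> U x].

Section QuotientModule.
Variables (R : pzRingType) (V : lmodType R) (S : set V).

Lemma sub_span : S `<=` gen_submod S.
Proof. by move=> x Sx U _; apply. Qed.

Lemma submodule_span : submodule (gen_submod S).
Proof.
split=> [U [U0 _] _ //|a x y Sx Sy U mU SU].
by apply: mU.2; [apply: Sx|apply: Sy].
Qed.

Definition span_pred : {pred V} := fun x => `[< gen_submod S x >].

Lemma span_predP x : reflect (gen_submod S x) (x \in span_pred).
Proof. exact: asboolP. Qed.

Lemma span_zmod_closed : zmod_closed span_pred.
Proof.
split=> [|x y /span_predP Sx /span_predP Sy]; apply/span_predP.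
  exact: submodule_span.1.
by rewrite addrC -scaleN1r; apply: submodule_span.2.
Qed.

HB.instance Definition _ :=
  GRing.isZmodClosed.Build V span_pred span_zmod_closed.

Definition span_closed : zmodClosed V := span_pred.
Definition quotmod : Type := Quotient.quot span_closed.
HB.instance Definition _ := GRing.Zmodule.on quotmod.

Definition qproj (x : V) : quotmod := \pi_(Quotient.quot span_closed) x.

Lemma qproj_surj (y : quotmod) : exists x, qproj x = y.
Proof. by exists (repr (y : Quotient.quot span_closed)); apply: reprK. Qed.

Lemma qproj_eqP x y : qproj x = qproj y <-> gen_submod S (x - y).
Proof.
split=> [/eqP|xy]; last apply/eqP;
  rewrite /qproj -(Quotient.idealrBE span_closed); first by move/span_predP.
exact/span_predP.
Qed.

Lemma qprojB x y : qproj (x - y) = qproj x - qproj y.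
Proof. exact: (raddfB (\pi_(Quotient.quot span_closed))). Qed.

Lemma qprojD x y : qproj (x + y) = qproj x + qproj y.
Proof. exact: (raddfD (\pi_(Quotient.quot span_closed))). Qed.

Definition qrepr (y : quotmod) : V := repr (y : Quotient.quot span_closed).

Lemma qreprK y : qproj (qrepr y) = y.
Proof. exact: reprK. Qed.

Definition qscale a (y : quotmod) : quotmod := qproj (a *: qrepr y).

Lemma qscaleE a x : qscale a (qproj x) = qproj (a *: x).
Proof.
apply/qproj_eqP; rewrite -scalerBr -[_ *: _]addr0.
apply: submodule_span.2; last exact: submodule_span.1.
by apply/qproj_eqP; rewrite qreprK.
Qed.

Lemma qscaleA a b y : qscale a (qscale b y) = qscale (a * b) y.
Proof. by have [x <-] := qproj_surj y; rewrite !qscaleE scalerA. Qed.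

Lemma qscale1 : left_id 1 qscale.
Proof. by move=> y; have [x <-] := qproj_surj y; rewrite qscaleE scale1r. Qed.

Lemma qscaleDr : right_distributive qscale +%R.
Proof.
move=> a y z; have [x <-] := qproj_surj y; have [t <-] := qproj_surj z.
by rewrite -qprojD !qscaleE scalerDr qprojD.
Qed.

Lemma qscaleDl y : {morph qscale^~ y : a b / a + b}.
Proof.
by move=> a b; have [x <-] := qproj_surj y; rewrite !qscaleE scalerDl qprojD.
Qed.

HB.instance Definition _ := GRing.Zmodule_isLmodule.Build R quotmod
  qscaleA qscale1 qscaleDr qscaleDl.

Lemma qproj_linear : linear qproj.
Proof. by move=> a x y; rewrite qprojD -qscaleE. Qed.

HB.instance Definition _ :=
  GRing.isLinear.Build R V quotmod *:%R qproj qproj_linear.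

End QuotientModule.

Section QuotientAlgebra.
Variables (K : fieldType) (A : pzAlgType K) (S : set A).

Lemma sub_ideal_gen : S `<=` ideal_gen S.
Proof. by move=> x Sx U _; apply. Qed.

Lemma two_sided_ideal_gen : two_sided (ideal_gen S).
Proof.
split=> [U [U0 _ _]//|x y Sx Sy U iU SU|a b x Sx U iU SU]; have [_ UD UM] := iU.
  by apply: UD; [apply: Sx|apply: Sy].
by apply: UM; apply: Sx.
Qed.

Lemma span_ideal_gen x : @gen_submod A A^o (ideal_gen S) x <-> ideal_gen S x.
Proof.
split; last exact: sub_span.
apply=> //; have [I0 ID IM] := two_sided_ideal_gen; split=> // a y z Iy Iz.
by apply: ID => //; rewrite -[_ *: _]mulr1; apply: IM.
Qed.

Definition quotalg : Type := @quotmod A A^o (ideal_gen S).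
HB.instance Definition _ := GRing.Zmodule.on quotalg.

Definition aproj : A -> quotalg := @qproj A A^o (ideal_gen S).

Lemma aprojD : {morph aproj : x y / x + y}.
Proof. exact: (@qprojD A A^o). Qed.

Lemma aproj_surj (y : quotalg) : exists x, aproj x = y.
Proof. exact: (@qproj_surj A A^o). Qed.

Lemma aproj_eqP x y : aproj x = aproj y <-> ideal_gen S (x - y).
Proof. by rewrite -span_ideal_gen; apply: (@qproj_eqP A A^o). Qed.

Definition arepr (y : quotalg) : A := @qrepr A A^o (ideal_gen S) y.

Lemma areprK y : aproj (arepr y) = y.
Proof. exact: (@qreprK A A^o). Qed.

Definition amul (y z : quotalg) : quotalg := aproj (arepr y * arepr z).

Lemma amulE x y : amul (aproj x) (aproj y) = aproj (x * y).
Proof.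
apply/aproj_eqP; set x' := arepr _; set y' := arepr _.
have Ix : ideal_gen S (x' - x) by apply/aproj_eqP; rewrite areprK.
have Iy : ideal_gen S (y' - y) by apply/aproj_eqP; rewrite areprK.
have [_ ID IM] := two_sided_ideal_gen.
rewrite (_ : _ - _ = 1 * (x' - x) * y' + x * (y' - y) * 1).
  by apply: ID; apply: IM.
by rewrite mul1r mulr1 mulrBl mulrBr addrA subrK.
Qed.

Lemma amulA : associative amul.
Proof.
move=> x y z; rewrite -(areprK x) -(areprK y) -(areprK z).
by rewrite !amulE mulrA.
Qed.

Lemma amul1r : left_id (aproj 1) amul.
Proof. by move=> x; rewrite -(areprK x) amulE mul1r. Qed.

Lemma amulr1 : right_id (aproj 1) amul.
Proof. by move=> x; rewrite -(areprK x) amulE mulr1. Qed.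

Lemma amulDl : left_distributive amul +%R.
Proof.
move=> x y z; rewrite -(areprK x) -(areprK y) -(areprK z) !amulE.
by rewrite -!aprojD amulE mulrDl.
Qed.

Lemma amulDr : right_distributive amul +%R.
Proof.
move=> x y z; rewrite -(areprK x) -(areprK y) -(areprK z) !amulE.
by rewrite -!aprojD amulE mulrDr.
Qed.

HB.instance Definition _ := GRing.Zmodule_isPzRing.Build quotalg
  amulA amul1r amulr1 amulDl amulDr.

Lemma aproj_zmod_morphism : zmod_morphism aproj.
Proof. exact: (@qprojB A A^o). Qed.

Lemma aproj_monoid_morphism : monoid_morphism aproj.
Proof. by split=> // x y; rewrite -amulE. Qed.

HB.instance Definition _ :=
  GRing.isZmodMorphism.Build A quotalg aproj aproj_zmod_morphism.
HB.instance Definition _ :=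
  GRing.isMonoidMorphism.Build A quotalg aproj aproj_monoid_morphism.

Definition qscal : {rmorphism K -> quotalg} := aproj \o (scal : {rmorphism K -> A}).

Lemma qscalC a x : qscal a * x = x * qscal a.
Proof. by rewrite -(areprK x) /= -!rmorphM scalC. Qed.

HB.instance Definition _ := isCentralAlgebra.Build K quotalg qscalC.

End QuotientAlgebra.

End Quotients.

Section PathAlgebra.

Record quiver := Quiver {
  vert : finType;
  arr : finType;
  src : arr -> vert;
  tgt : arr -> vert
}.

Variable Q : quiver.

Fixpoint walk (v : vert Q) (s : seq (arr Q)) : bool :=
  if s is a :: s' then (src a == v) && walk (tgt a) s' else true.

(* A path is its starting vertex with its arrows, read from left to right. *)
Record qpath := QPath {
  qval : vert Q * seq (arr Q);
  _ : walk qval.1 qval.2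
}.

HB.instance Definition _ := [isSub for qval].
HB.instance Definition _ := [Choice of qpath by <:].

Definition qstart (p : qpath) : vert Q := (qval p).1.
Definition qarrows (p : qpath) : seq (arr Q) := (qval p).2.
Definition qend (p : qpath) : vert Q := last (qstart p) (map (@tgt Q) (qarrows p)).

Definition triv (v : vert Q) : qpath := @QPath (v, [::]) isT.

Lemma walk_arrow (a : arr Q) : walk (src a) [:: a].
Proof. by rewrite /= eqxx. Qed.

Definition arrow (a : arr Q) : qpath := @QPath (src a, [:: a]) (walk_arrow a).

Definition pcat (p q : qpath) : option qpath :=
  if qend p == qstart q then insub (qstart p, qarrows p ++ qarrows q) else None.

Lemma walk_cat v s t :
  walk v (s ++ t) = walk v s && walk (last v (map (@tgt Q) s)) t.
Proof. by elim: s v => //= a s IHs v; rewrite IHs andbA. Qed.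

Lemma pcat_some p q : qend p = qstart q ->
  exists2 r, pcat p q = Some r & qval r = (qstart p, qarrows p ++ qarrows q).
Proof.
move=> pq; rewrite /pcat pq eqxx; case: insubP => [r _ <-|]; first by exists r.
rewrite walk_cat -/(qend p) pq.
by case: p q {pq} => [[v s] vs] [[w t] wt]; rewrite /= vs wt.
Qed.

Lemma pcat_none p q : qend p != qstart q -> pcat p q = None.
Proof. by rewrite /pcat => /negPf ->. Qed.

Lemma pcatA p q r :
  obind (fun s => pcat s r) (pcat p q) = obind (pcat p) (pcat q r).
Proof.
have [pq|pq] := eqVneq (qend p) (qstart q); last first.
  rewrite (pcat_none pq) /=; have [qr|qr] := eqVneq (qend q) (qstart r).
    have [t -> tE] := pcat_some qr; rewrite /= pcat_none //.
    by rewrite [qstart t]/qstart tE.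
  by rewrite pcat_none.
have [s -> sE] := pcat_some pq.
have se : qend s = qend q.
  by rewrite /qend [qstart s]/qstart [qarrows s]/qarrows sE /=
             map_cat last_cat -/(qend p) pq.
have [qr|qr] := eqVneq (qend q) (qstart r); last first.
  by rewrite /= (pcat_none qr) pcat_none ?se.
have [t -> tE] := pcat_some qr.
have [|u /= -> uE] := @pcat_some s r; first by rewrite se.
have [|w -> wE] := @pcat_some p t; first by rewrite pq [RHS]/qstart tE.
congr Some; apply: val_inj; rewrite [val u]uE [val w]wE.
by rewrite /qarrows /qstart sE tE /= catA.
Qed.


Lemma pcat_trivl p : pcat (triv (qstart p)) p = Some p.
Proof.
have [//|r -> rE] := @pcat_some (triv (qstart p)) p.
by congr Some; apply: val_inj; rewrite [val r]rE /qstart /qarrows /= -surjective_pairing.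
Qed.

Lemma pcat_trivr p : pcat p (triv (qend p)) = Some p.
Proof.
have [//|r -> rE] := @pcat_some p (triv (qend p)).
congr Some; apply: val_inj.
by rewrite [val r]rE /qstart /qarrows /= cats0 -surjective_pairing.
Qed.

Variable K : fieldType.

Definition pathalg : Type := {malg K[qpath]}.
HB.instance Definition _ := GRing.Lmodule.on pathalg.

Definition pbasis (r : option qpath) : pathalg := if r is Some p then << p >> else 0.

Definition pmul (x y : pathalg) : pathalg :=
  \sum_(p <- msupp x) \sum_(q <- msupp y) (x@_p * y@_q) *: pbasis (pcat p q).

Definition pone : pathalg := \sum_(v : vert Q) << triv v >>.

Lemma malgUZ (c : K) (p : qpath) : << c *g p >> = c *: (<< p >> : pathalg).
Proof.
by apply/malgP => q; rewrite mcoeffZ !mcoeffU mulr_natr.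
Qed.

Lemma pathalg_sum (x : pathalg) :
  exists (s : seq qpath) (c : qpath -> K),
    x = \sum_(p <- s) c p *: (<< p >> : pathalg).
Proof.
exists (msupp x), (mcoeff^~ x).
by rewrite {1}[x]monalgE; apply: eq_bigr => p _; rewrite malgUZ.
Qed.

Lemma pmulw (d e : {fset qpath}) (x y : pathalg) :
  (msupp x `<=` d)%fset -> (msupp y `<=` e)%fset ->
  pmul x y = \sum_(p <- d) \sum_(q <- e) (x@_p * y@_q) *: pbasis (pcat p q).
Proof.
move=> xd ye; rewrite /pmul (big_fset_incl _ xd) /=; last first.
  move=> p _ /mcoeff_outdom xp; rewrite big1 // => q _.
  by rewrite xp mul0r scale0r.
apply: eq_bigr => p _; apply: big_fset_incl => // q _ /mcoeff_outdom ->.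
by rewrite mulr0 scale0r.
Qed.

Lemma pmulDl : left_distributive pmul +%R.
Proof.
move=> x y z; rewrite (pmulw (msuppD_le x y) (fsubset_refl _)).
rewrite (pmulw (fsubsetUl _ (msupp y)) (fsubset_refl (msupp z))).
rewrite (pmulw (fsubsetUr (msupp x) _) (fsubset_refl (msupp z))).
rewrite -big_split; apply: eq_bigr => p _; rewrite -big_split.
by apply: eq_bigr => q _; rewrite mcoeffD mulrDl scalerDl.
Qed.

Lemma pmulDr : right_distributive pmul +%R.
Proof.
move=> z x y; rewrite (pmulw (fsubset_refl _) (msuppD_le x y)).
rewrite (pmulw (fsubset_refl (msupp z)) (fsubsetUl _ (msupp y))).
rewrite (pmulw (fsubset_refl (msupp z)) (fsubsetUr (msupp x) _)).
rewrite -big_split; apply: eq_bigr => p _; rewrite -big_split.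
by apply: eq_bigr => q _; rewrite mcoeffD mulrDr scalerDl.
Qed.

Lemma pmulZl c x y : pmul (c *: x) y = c *: pmul x y.
Proof.
rewrite (pmulw (msuppZ_le c x) (fsubset_refl _)) scaler_sumr.
apply: eq_bigr => p _; rewrite scaler_sumr; apply: eq_bigr => q _.
by rewrite mcoeffZ scalerA mulrA.
Qed.

Lemma pmulZr c x y : pmul x (c *: y) = c *: pmul x y.
Proof.
rewrite (pmulw (fsubset_refl _) (msuppZ_le c y)) scaler_sumr.
apply: eq_bigr => p _; rewrite scaler_sumr; apply: eq_bigr => q _.
by rewrite mcoeffZ scalerA mulrCA.
Qed.

Lemma pmulUU p q : pmul << p >> << q >> = pbasis (pcat p q).
Proof.
by rewrite (pmulw msuppU_le msuppU_le) !big_seq_fset1 !mcoeffUU mulr1 scale1r.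
Qed.

Lemma pmul0l : left_zero 0 pmul.
Proof. by move=> x; rewrite /pmul msupp0 big_seq_fset0. Qed.

Lemma pmul0r : right_zero 0 pmul.
Proof.
by move=> x; rewrite /pmul big1 // => p _; rewrite msupp0 big_seq_fset0.
Qed.

Lemma pmul_suml I (r : seq I) F y :
  pmul (\sum_(i <- r) F i) y = \sum_(i <- r) pmul (F i) y.
Proof. exact: (big_morph (pmul^~ y) (fun u v => pmulDl u v y) (pmul0l y)). Qed.

Lemma pmul_sumr I (r : seq I) F x :
  pmul x (\sum_(i <- r) F i) = \sum_(i <- r) pmul x (F i).
Proof. exact: (big_morph (pmul x) (pmulDr x) (pmul0r x)). Qed.

Lemma pmulA : associative pmul.
Proof.
move=> x y z; have [s [c ->]] := pathalg_sum x; have [t [d ->]] := pathalg_sum y.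
have [u [e ->]] := pathalg_sum z; set y' := \sum_(q <- t) _.
set z' := \sum_(r <- u) _.
rewrite (pmul_suml s _ y') (pmul_suml s _ (pmul y' z')) (pmul_suml s _ z').
apply: eq_bigr => p _; rewrite !pmulZl; congr (_ *: _); rewrite /y'.
rewrite (pmul_suml t _ z') !(pmul_sumr t _ << p >>) (pmul_suml t _ z').
apply: eq_bigr => q _.
rewrite pmulZl !pmulZr pmulZl; congr (_ *: _).
rewrite /z' (pmul_sumr u _ << q >>) !(pmul_sumr u); apply: eq_bigr => r _.
rewrite !pmulZr; congr (_ *: _); rewrite !pmulUU.
have := pcatA p q r; case: (pcat p q) (pcat q r) => [v|] [w|] //=.
- by rewrite !pmulUU => ->.
- by rewrite pmulUU pmul0r => ->.
- by rewrite pmulUU pmul0l => <-.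
- by rewrite pmul0r pmul0l.
Qed.

Lemma pmul1l : left_id pone pmul.
Proof.
move=> x; have [s [c ->]] := pathalg_sum x; rewrite (pmul_sumr s).
apply: eq_bigr => p _; rewrite pmulZr; congr (_ *: _).
rewrite (pmul_suml _ _ << p >>) (bigD1 (qstart p)) //= pmulUU pcat_trivl.
by rewrite big1 ?addr0 // => v vp; rewrite pmulUU pcat_none.
Qed.

Lemma pmul1r : right_id pone pmul.
Proof.
move=> x; have [s [c ->]] := pathalg_sum x; rewrite (pmul_suml s).
apply: eq_bigr => p _; rewrite pmulZl; congr (_ *: _).
rewrite (pmul_sumr _ _ << p >>) (bigD1 (qend p)) //= pmulUU pcat_trivr.
by rewrite big1 ?addr0 // => v vp; rewrite pmulUU pcat_none // eq_sym.
Qed.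

HB.instance Definition _ :=
  GRing.Zmodule_isPzRing.Build pathalg pmulA pmul1l pmul1r pmulDl pmulDr.

Definition pscal (a : K) : pathalg := a *: pone.

Lemma pscal_zmod_morphism : zmod_morphism pscal.
Proof. by move=> a b; rewrite /pscal scalerBl. Qed.

Lemma pscal_monoid_morphism : monoid_morphism pscal.
Proof.
split=> [|a b]; first exact: scale1r.
by rewrite [RHS]pmulZl (pmulZr b pone) pmul1l scalerA.
Qed.

HB.instance Definition _ :=
  GRing.isZmodMorphism.Build K pathalg pscal pscal_zmod_morphism.
HB.instance Definition _ :=
  GRing.isMonoidMorphism.Build K pathalg pscal pscal_monoid_morphism.

Lemma pscalC a (x : pathalg) : pscal a * x = x * pscal a.
Proof. by rewrite [LHS]pmulZl [RHS]pmulZr pmul1l pmul1r. Qed.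

HB.instance Definition _ := isCentralAlgebra.Build K pathalg pscalC.

Definition path_length (n : nat) : set pathalg :=
  [set x | forall p, p \in msupp x -> size (qarrows p) = n].

End PathAlgebra.

Section Graded.
Variables (K : fieldType) (A : pzAlgType K).

Definition direct_decomposition (V : zmodType) (g : nat -> set V) : Prop :=
  (forall x, exists n (c : nat -> V),
     (forall k, g k (c k)) /\ x = \sum_(k < n) c k) /\
  (forall n (c : nat -> V), (forall k, g k (c k)) ->
     \sum_(k < n) c k = 0 -> forall k, (k < n)%N -> c k = 0).

Definition graded_algebra (gr : nat -> set A) : Prop :=
  [/\ forall n, gr n 0 /\
        (forall a x y, gr n x -> gr n y -> gr n (scal a * x + y)),
      direct_decomposition gr,
      gr 0%N 1
    & forall m n x y, gr m x -> gr n y -> gr (m + n)%N (x * y)].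

Definition graded_module (gr : nat -> set A) (M : lmodType A^c)
    (g : nat -> set M) : Prop :=
  [/\ forall n, g n 0 /\ (forall x y, g n x -> g n y -> g n (x - y)),
      direct_decomposition g
    & forall m n x a, g m x -> gr n a -> g (m + n)%N ((a : A^c) *: x)].

(* [A_0 = A / (A_1 + A_2 + ...)] as a right [A]-module, and the grading that  *)
(* it inherits from [A].                                                      *)
Definition deg0 (gr : nat -> set A) : Type :=
  @quotmod A^c A^c^o (\bigcup_n gr n.+1).
HB.instance Definition _ gr := GRing.Lmodule.on (deg0 gr).

Definition deg0_grading (gr : nat -> set A) (n : nat) : set (deg0 gr) :=
  @qproj A^c A^c^o (\bigcup_n gr n.+1) @` gr n.

(* [M (A_1 + A_2 + ...)] *)
Definition radical (gr : nat -> set A) (M : lmodType A^c) : set M :=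
  gen_submod [set z | exists n a x, gr n.+1 a /\ z = (a : A^c) *: x].

End Graded.

Arguments deg0_grading {K A} gr n.
Arguments radical {K A} gr {M}.

Section Resolutions.

Definition projective (R : pzRingType) (P : lmodType R) : Prop :=
  forall (M N : lmodType R) (g : {linear M -> N}) (f : {linear P -> N}),
    (forall y, exists x, g x = y) ->
    exists h : {linear P -> M}, forall x, g (h x) = f x.

Record resolution (R : pzRingType) (M : lmodType R) := Resolution {
  res_mod :> nat -> lmodType R;
  res_diff : forall n, {linear res_mod n.+1 -> res_mod n};
  res_aug : {linear res_mod 0 -> M};
  res_proj : forall n, projective (res_mod n);
  res_surj : forall y, exists x, res_aug x = y;
  res_exact0 : forall x, res_aug x = 0 <-> exists y, res_diff 0 y = x;
  res_exact : forall n x, res_diff n x = 0 <-> exists y, res_diff n.+1 y = x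
}.

(* [A_0] has a minimal graded projective resolution whose [n]th term is       *)
(* generated in degree [delta n]; minimality says that each syzygy lies in    *)
(* the radical of the term of the resolution that contains it.                *)
Definition resolution_generated_in (K : fieldType) (A : pzAlgType K)
    (gr : nat -> set A) (delta : nat -> nat) : Prop :=
  exists (P : @resolution A^c (deg0 gr)) (g : forall n, nat -> set (P n)),
    [/\ forall n, graded_module gr (g n),
        (forall k x, g 0%N k x -> deg0_grading gr k (res_aug P x)) /\
        (forall n k x, g n.+1 k x -> g n k (res_diff P n x)),
        (forall x, res_aug P x = 0 -> radical gr x) /\
        (forall n x, res_diff P n x = 0 -> radical gr x)
      & forall n x, gen_submod (g n (delta n)) x].

End Resolutions.

Section Ext.
Variables (K : fieldType) (A : pzAlgType K) (M : lmodType A^c).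
Variable P : @resolution A^c M.

(* A finite sum of chain maps [P_(k + n) -> P_k], [n >= 0], as the matrix of  *)
(* its components [P_i -> P_j], [j <= i].                                     *)
Definition chain_endo (f : forall i j, P i -> P j) : Prop :=
  [/\ forall i j, linear (f i j),
      forall i j x, (i < j)%N -> f i j x = 0,
      exists n, forall i j x, (j + n < i)%N -> f i j x = 0
    & forall i j x, res_diff P j (f i.+1 j.+1 x) = f i j (res_diff P i x)].

Record cendo := CEndo {
  cmap :> forall i j, P i -> P j;
  cmapP : chain_endo cmap
}.

HB.instance Definition _ := gen_eqMixin cendo.
HB.instance Definition _ := gen_choiceMixin cendo.

Lemma cendo_eq (f g : cendo) : (forall i j x, f i j x = g i j x) -> f = g.
Proof.
case: f g => [f fP] [g gP] /= fg; have fgE : f = g.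
  by do 3![apply: functional_extensionality_dep => ?].
by rewrite -fgE in gP *; rewrite (Prop_irrelevance fP gP).
Qed.

Section CendoTheory.
Variable f : cendo.

Lemma clinear i j : linear (f i j).
Proof. by case: (cmapP f). Qed.
Arguments clinear i j : clear implicits.

Lemma cmapD i j x y : f i j (x + y) = f i j x + f i j y.
Proof. by have := clinear i j 1 x y; rewrite !scale1r. Qed.

Lemma cmap0 i j : f i j 0 = 0.
Proof. by apply: (addIr (f i j 0)); rewrite -cmapD !add0r. Qed.

Lemma cmapZ i j a x : f i j (a *: x) = a *: f i j x.
Proof. by have := clinear i j a x 0; rewrite cmap0 !addr0. Qed.

Lemma cmap_sum i j (I : Type) (r : seq I) (F : I -> P i) :
  f i j (\sum_(k <- r) F k) = \sum_(k <- r) f i j (F k).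
Proof. exact: (big_morph (f i j) (@cmapD i j) (@cmap0 i j)). Qed.

Lemma cmap_lt i j x : (i < j)%N -> f i j x = 0.
Proof. by case: (cmapP f) => _ + _ _; apply. Qed.

Lemma cmap_diff i j x :
  res_diff P j (f i.+1 j.+1 x) = f i j (res_diff P i x).
Proof. by case: (cmapP f). Qed.

End CendoTheory.

Fact czero_subproof : chain_endo (fun i j _ => 0).
Proof.
split=> [i j a x y||//|i j x]; rewrite ?scaler0 ?addr0 ?linear0 //.
by exists 0%N.
Qed.
Definition czero := CEndo czero_subproof.

Fact copp_subproof (f : cendo) : chain_endo (fun i j x => - f i j x).
Proof.
have [fL f_lt [n fn] fd] := cmapP f.
split=> [i j a x y|i j x ij||i j x].
- by rewrite fL opprD scalerN.
- by rewrite f_lt ?oppr0.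
- by exists n => i j x ij; rewrite fn ?oppr0.
- by rewrite linearN fd.
Qed.
Definition copp f := CEndo (copp_subproof f).

Fact cadd_subproof (f g : cendo) : chain_endo (fun i j x => f i j x + g i j x).
Proof.
have [fL f_lt [m fm] fd] := cmapP f; have [gL g_lt [n gn] gd] := cmapP g.
split=> [i j a x y|i j x ij||i j x].
- by rewrite fL gL scalerDr addrACA.
- by rewrite f_lt ?g_lt ?addr0.
- exists (m + n)%N => i j x ij; rewrite fm ?gn ?addr0 //.
    by apply: leq_ltn_trans ij; rewrite leq_add2l leq_addl.
  by apply: leq_ltn_trans ij; rewrite leq_add2l leq_addr.
- by rewrite linearD fd gd.
Qed.
Definition cadd f g := CEndo (cadd_subproof f g).

Lemma caddA : associative cadd.
Proof. by move=> f g h; apply: cendo_eq => i j x /=; rewrite addrA. Qed.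

Lemma caddC : commutative cadd.
Proof. by move=> f g; apply: cendo_eq => i j x /=; rewrite addrC. Qed.

Lemma cadd0 : left_id czero cadd.
Proof. by move=> f; apply: cendo_eq => i j x /=; rewrite add0r. Qed.

Lemma caddN : left_inverse czero copp cadd.
Proof. by move=> f; apply: cendo_eq => i j x /=; rewrite addNr. Qed.

HB.instance Definition _ :=
  GRing.isZmodule.Build cendo caddA caddC cadd0 caddN.

Lemma ccomp_widen (f g : cendo) n i k (x : P i) : (i < n)%N ->
  \sum_(j < i.+1) f j k (g i j x) = \sum_(j < n) f j k (g i j x).
Proof.
move=> lt_in; rewrite (big_ord_widen n (fun j => f j k (g i j x))) //.
rewrite big_mkcond; apply: eq_bigr => j _; case: ifP => // /negbT.
by rewrite -leqNgt => ij; rewrite (@cmap_lt g) ?cmap0.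
Qed.

Fact ccomp_subproof (f g : cendo) :
  chain_endo (fun i k x => \sum_(j < i.+1) f j k (g i j x)).
Proof.
have [_ _ [m fm] _] := cmapP f; have [_ _ [n gn] _] := cmapP g.
split=> [i k a x y|i k x ik||i k x].
- rewrite scaler_sumr -big_split; apply: eq_bigr => j _ /=.
  by rewrite !clinear.
- rewrite big1 // => j _; rewrite (@cmap_lt f) //.
  by apply: leq_ltn_trans ik; rewrite -ltnS.
- exists (m + n)%N => i k x ki; rewrite big1 // => j _.
  have [ji|ij] := ltnP (j + n) i; first by rewrite gn ?cmap0.
  by rewrite fm // -(ltn_add2r n) -addnA; apply: leq_trans ki ij.
- rewrite big_ord_recl cmap_lt // add0r linear_sum; apply: eq_bigr => j _ /=.
  by rewrite !cmap_diff.
Qed.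
Definition ccomp f g := CEndo (ccomp_subproof f g).

Definition cid_map i j (x : P i) : P j :=
  if @eqP _ i j is ReflectT ij then ecast k (P k) ij x else 0.

Lemma cid_mapE i x : @cid_map i i x = x.
Proof. by rewrite /cid_map; case: eqP => // e; rewrite (eq_axiomK e). Qed.

Lemma cid_map_neq i j x : i != j -> @cid_map i j x = 0.
Proof. by rewrite /cid_map; case: eqP. Qed.

(* [x |-> x . a] for a scalar [a]. *)
Fact cscal_subproof (a : K) :
  chain_endo (fun i j x => (scal a : A^c) *: @cid_map i j x).
Proof.
split=> [i j b x y|i j x ij||i j x].
- have [<-|ij] := eqVneq i j; last by rewrite !cid_map_neq // !scaler0 addr0.
  rewrite !cid_mapE scalerDr !scalerA; congr (_ *: _ + _).
  by rewrite /GRing.mul /= scalC.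
- by rewrite cid_map_neq ?scaler0 // ltn_eqF.
- by exists 0%N => i j x; rewrite addn0 => ji; rewrite cid_map_neq ?scaler0 // gtn_eqF.
- have [<-|ij] := eqVneq i j; first by rewrite !cid_mapE linearZ.
  by rewrite !cid_map_neq // !scaler0 linear0.
Qed.
Definition cscal a := CEndo (cscal_subproof a).

Lemma cscal_compl a f i k x : ccomp (cscal a) f i k x = (scal a : A^c) *: f i k x.
Proof.
have ik : (i < k.+1 + i)%N by rewrite addSn ltnS leq_addl.
rewrite [LHS](@ccomp_widen (cscal a) f _ i k x ik).
rewrite (bigD1 (Ordinal (leq_addr i k.+1))) //= cid_mapE big1 ?addr0 // => j jk.
by rewrite cid_map_neq ?scaler0.
Qed.

Lemma cscal_compr a f i k x : ccomp f (cscal a) i k x = (scal a : A^c) *: f i k x.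
Proof.
rewrite /= big_ord_recr /= cid_mapE cmapZ big1 ?add0r // => j _.
by rewrite cid_map_neq ?scaler0 ?cmap0 // gtn_eqF.
Qed.

Lemma ccompA : associative ccomp.
Proof.
move=> f g h; apply: cendo_eq => i l x /=.
under eq_bigr do rewrite cmap_sum; rewrite exchange_big /=.
apply: eq_bigr => j _.
by rewrite -(@ccomp_widen f g i.+1 j l).
Qed.

Definition cone := cscal 1.

Lemma ccomp1l : left_id cone ccomp.
Proof.
by move=> f; apply: cendo_eq => i k x; rewrite cscal_compl rmorph1 scale1r.
Qed.

Lemma ccomp1r : right_id cone ccomp.
Proof.
by move=> f; apply: cendo_eq => i k x; rewrite cscal_compr rmorph1 scale1r.
Qed.

Lemma ccompDl : left_distributive ccomp +%R.
Proof.
by move=> f g h; apply: cendo_eq => i k x /=; rewrite -big_split.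
Qed.

Lemma ccompDr : right_distributive ccomp +%R.
Proof.
move=> f g h; apply: cendo_eq => i k x /=; rewrite -big_split.
by apply: eq_bigr => j _; rewrite cmapD.
Qed.

HB.instance Definition _ :=
  GRing.Zmodule_isPzRing.Build cendo ccompA ccomp1l ccomp1r ccompDl ccompDr.

Lemma cscal_zmod_morphism : zmod_morphism cscal.
Proof.
by move=> a b; apply: cendo_eq => i j x /=; rewrite rmorphB scalerBl.
Qed.

Lemma cscal_monoid_morphism : monoid_morphism cscal.
Proof.
split=> // a b; apply: cendo_eq => i j x.
by rewrite cscal_compl /= scalerA mulrC rmorphM.
Qed.

HB.instance Definition _ :=
  GRing.isZmodMorphism.Build K cendo cscal cscal_zmod_morphism.
HB.instance Definition _ :=
  GRing.isMonoidMorphism.Build K cendo cscal cscal_monoid_morphism.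

Lemma cscalC a (f : cendo) : cscal a * f = f * cscal a.
Proof. by apply: cendo_eq => i j x; rewrite cscal_compl cscal_compr. Qed.

HB.instance Definition _ := isCentralAlgebra.Build K cendo cscalC.

Definition null_homotopic : set cendo :=
  [set f | exists s : forall i j, {linear P i -> P j}, forall i j (x : P i),
     f i j x = res_diff P j (s i j.+1 x) +
               (if i is i'.+1 then fun x => s i' j (res_diff P i' x)
                else fun=> 0) x].

(* The Ext algebra [E = (+)_n Ext^n(M, M)]: by the comparison theorem         *)
(* [f |-> res_aug P \o f n 0] identifies homotopy classes of chain maps of    *)
(* degree [n] with [H^n(Hom(P, M)) = Ext^n(M, M)], and composition of chain   *)
(* maps with the Yoneda product. Null-homotopic maps already form an ideal.   *)
Definition Ext : Type := quotalg null_homotopic.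
HB.instance Definition _ := PzAlgebra.on Ext.

Definition Ext_deg (n : nat) : set Ext :=
  @aproj K cendo null_homotopic @`
    [set f : cendo | forall i j x, i != (j + n)%N -> f i j x = 0].

End Ext.

Section Koszul.
Variables (K : fieldType) (A : pzAlgType K) (gr : nat -> set A).

Definition deg0_split : Prop :=
  exists (r : nat) (phi : {ffun 'I_r -> K} -> A),
    [/\ injective phi,
        {morph phi : x y / x + y},
        monoid_morphism phi,
        forall a, phi [ffun=> a] = scal a
      & range phi = gr 0%N].

Definition koszul : Prop :=
  [/\ graded_algebra gr, deg0_split & resolution_generated_in gr id].

Definition finite_dim : Prop :=
  exists (n : nat) (b : 'I_n -> A),
    forall x, exists c : 'I_n -> K, x = \sum_(i < n) scal (c i) * b i.

Definition stacked_degree (D a n : nat) : nat :=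
  (if n == 0 then 0 else if n == 1 then 1
   else if odd n then n./2 * D + a else n./2 * D)%N.

(* Beyond the global dimension the terms of a minimal resolution vanish, and  *)
(* the condition on their generators is empty.                                *)
Definition stacked (D a : nat) : Prop :=
  [/\ graded_algebra gr, finite_dim
    & resolution_generated_in gr (stacked_degree D a)].

Definition sumset (U V : set A) : set A := [set x + y | x in U & y in V].

Definition hat (n : nat) : set A :=
  match n with
  | 0 => gr 0%N
  | 1 => sumset (gr 1%N) (sumset (gr 2%N) (gr 3%N))
  | _ => sumset (gr n.*2) (gr n.*2.+1)
  end.

End Koszul.

Section Example.

(* The vertices [1, ..., 17] and the arrows [alpha_1, ..., alpha_18] are      *)
(* numbered from 0 in ['I_17] and ['I_18].                                    *)
Definition src_tab : seq nat :=
  [:: 1; 2; 3; 4; 5; 6; 1; 7; 8; 9; 10; 11; 12; 13; 14; 15; 16; 17]%N.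
Definition tgt_tab : seq nat :=
  [:: 2; 3; 4; 5; 6; 12; 7; 8; 9; 10; 11; 12; 13; 14; 15; 16; 17; 12]%N.

Definition exQ : quiver :=
  @Quiver 'I_17 'I_18 (fun a => inord (nth 0%N src_tab a).-1)
                      (fun a => inord (nth 0%N tgt_tab a).-1).

Variable K : fieldType.

Definition alpha (k : nat) : pathalg exQ K := << @arrow exQ (inord k.-1) >>.

Definition word (s : seq nat) : pathalg exQ K := \prod_(k <- s) alpha k.

Definition ex_relations : set (pathalg exQ K) :=
  [set` [:: word [:: 1; 2; 3; 4; 5; 6]%N - word [:: 7; 8; 9; 10; 11; 12]%N;
            word [:: 3; 4; 5; 6; 13; 14]%N;
            word [:: 5; 6; 13; 14; 15; 16]%N;
            word [:: 9; 10; 11; 12; 13; 14]%N;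
            word [:: 11; 12; 13; 14; 15; 16]%N;
            word [:: 13; 14; 15; 16; 17; 18]%N;
            word [:: 15; 16; 17; 18; 13; 14]%N;
            word [:: 17; 18; 13; 14; 15; 16]%N]].

Definition Lambda : Type := quotalg ex_relations.
HB.instance Definition _ := PzAlgebra.on Lambda.

Definition Lambda_length (n : nat) : set Lambda :=
  @aproj K (pathalg exQ K) ex_relations @` path_length n.

End Example.

(* Main.v *)
(* Lambda has a basis of path classes that is multiplicative up to zero, and  *)
(* its minimal resolution is explicit: degrees 0 and 1 are indexed by the     *)
(* vertices and the arrows, and from each of the 8 relations on there starts  *)
(* a chain of overlaps that ends up circling around 12, 14, 16, with          *)
(* coefficients paths of length alternately 2 and 4. Exactness is shown by an *)
(* explicit contracting homotopy. The cocycles dual to the generators lift to *)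
(* explicit chain maps, so that E(Lambda) has a basis of elements [Hi i n] of *)
(* degree n + 2, besides vertices and arrows, with product [Hi j m * Hi i n = *)
(* Hi i (m + n + 2)] when the endpoints match and m, n are not both odd, and  *)
(* 0 otherwise. In the hat grading this algebra is generated in degree 1 with *)
(* a quadratic Groebner basis, and the resulting linear resolution, indexed   *)
(* by words in the letters of hat-degree 1, has again an explicit homotopy.   *)

From HB Require Import structures.
Require Import Defs.
From mathcomp Require Import all_boot all_order all_algebra.
From mathcomp Require Import boolp classical_sets.
From mathcomp Require Import finmap monalg zify.

Set Implicit Arguments.
Unset Strict Implicit.
Unset Printing Implicit Defensive.

Import GRing.Theory.
Local Open Scope ring_scope.

(** * Combinations of basis elements *)

(** Over [Lambda] every overlap of relations continues in exactly one way. From degree 2 on, the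
    minimal resolution of [Lambda_0] therefore falls into eight chains, one for each relation. The
    generators of a chain are joined by single paths of length alternately 2 and 4, and these
    lengths give the generating degrees of a (6,2)-stacked algebra. Exactness is proved by a
    K-linear contracting homotopy ([lhomP]), and [cellular_generated] turns such data into a minimal
    graded projective resolution.

    Because the differential lands in the radical, a class in Ext is determined by the values of its
    cocycle on the generators: [kappa_null] and [kappa_inj] give a dual basis, and [comparison] with
    [transport] carries it to an arbitrary resolution. Yoneda products are read off from chain maps
    that lift the dual cocycles ([lift_bd], [lift_id], [kappaM]). The lift of the class [Hi i n]
    sends the generator [Hi i (m + n + 2)] to a generator times a path of length 0, except when m
    and n are both odd: then the degrees force a path of length 2, and the product vanishes.

    In the hat grading, put x_i = [Hi i 0] and y_i = [Hi i 1]. Arrows, x's and y's generate the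
    positive part, and every higher class is a unique product of x's whose rightmost factor alone
    may be a y. All other composable pairs of letters multiply to 0, apart from y x = x y (with the
    matching indices). These quadratic relations form a Groebner basis. The complex on words all of
    whose neighbouring pairs are leading monomials has a differential with coefficients of
    hat-degree 1; [wbdK] and [whomP] show that it is a resolution, which is then linear. This is
    [ext_koszul]. *)

Section FreeSpaces.
Variable K : fieldType.

Section Lin.
Variables (I : choiceType) (V : lmodType K).
Implicit Types (x y : {malg K[I]}) (f : I -> V).

Definition lin f x : V := \sum_(i <- msupp x) x@_i *: f i.

Lemma linw f x (d : {fset I}) :
  (msupp x `<=` d)%fset -> lin f x = \sum_(i <- d) x@_i *: f i.
Proof.
move=> xd; rewrite /lin (big_fset_incl _ xd) // => i _ /mcoeff_outdom ->.
by rewrite scale0r.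
Qed.

Lemma lin_is_linear f : linear (lin f).
Proof.
move=> a x y; pose d := (msupp x `|` msupp y)%fset.
have xd : (msupp x `<=` d)%fset by apply: fsubsetUl.
have yd : (msupp y `<=` d)%fset by apply: fsubsetUr.
have zd : (msupp (a *: x + y) `<=` d)%fset.
  apply: fsubset_trans (msuppD_le _ _) _.
  by apply: fsetSU; apply: msuppZ_le.
rewrite (linw f xd) (linw f yd) (linw f zd) scaler_sumr -big_split /=.
by apply: eq_bigr => i _; rewrite mcoeffD mcoeffZ scalerDl scalerA.
Qed.

HB.instance Definition _ f :=
  GRing.isLinear.Build K {malg K[I]} V *:%R (lin f) (lin_is_linear f).

Lemma linU f i : lin f << i >> = f i.
Proof. by rewrite (linw f msuppU_le) big_seq_fset1 mcoeffUU scale1r. Qed.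

End Lin.

Lemma malg_sum (I : choiceType) (x : {malg K[I]}) :
  x = \sum_(i <- msupp x) x@_i *: (<< i >> : {malg K[I]}).
Proof.
by rewrite {1}[x]monalgE; apply: eq_bigr => i _; apply/malgP => j;
  rewrite mcoeffZ !mcoeffU mulr_natr.
Qed.

(** In the case of a basis element it is known to lie in the support of [x], so identities that hold
    only on the span of certain basis elements can be proved this way. *)
Lemma malg_ind (I : choiceType) (P : {malg K[I]} -> Prop) (x : {malg K[I]}) :
  P 0 -> (forall a u v, P u -> P v -> P (a *: u + v)) ->
  {in msupp x, forall i, P << i >>} -> P x.
Proof.
move=> P0 PL Px; rewrite [x]malg_sum big_seq.
by elim/big_rec: _ => [//|i y /Px Pi Py]; apply: PL.
Qed.

Lemma malg_elim (I : choiceType) (P : {malg K[I]} -> Prop) :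
  P 0 -> (forall a u v, P u -> P v -> P (a *: u + v)) ->
  (forall i, P << i >>) -> forall x, P x.
Proof. by move=> P0 PL PU x; apply: malg_ind => // i _; apply: PU. Qed.

Definition supp_in (I : choiceType) (S : I -> Prop) (x : {malg K[I]}) : Prop :=
  forall i, i \in msupp x -> S i.

Section SuppIn.
Variables (I : choiceType) (S : I -> Prop).

Lemma supp_in0 : supp_in S 0.
Proof. by move=> i; rewrite msupp0. Qed.

Lemma supp_inP a u v : supp_in S u -> supp_in S v -> supp_in S (a *: u + v).
Proof.
move=> Su Sv i /(fsubsetP (msuppD_le _ _)) /fsetUP [|/Sv//].
by move/(fsubsetP (msuppZ_le _ _))/Su.
Qed.

Lemma supp_inU i : S i -> supp_in S << i >>.
Proof. by move=> Si j /(fsubsetP msuppU_le) /fset1P ->. Qed.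

Lemma supp_inD u v : supp_in S u -> supp_in S v -> supp_in S (u + v).
Proof. by move=> Su Sv; rewrite -[u]scale1r; apply: supp_inP. Qed.

Lemma supp_inZ a u : supp_in S u -> supp_in S (a *: u).
Proof. by move=> Su; rewrite -[_ *: _]addr0; apply/supp_inP/supp_in0. Qed.

Lemma supp_inB u v : supp_in S u -> supp_in S v -> supp_in S (u - v).
Proof. by move=> Su Sv; rewrite addrC -scaleN1r; apply: supp_inP. Qed.

Lemma supp_in_lin (J : choiceType) (f : J -> {malg K[I]}) y :
  {in msupp y, forall j, supp_in S (f j)} -> supp_in S (lin f y).
Proof.
move=> Sf; rewrite /lin big_seq; elim/big_rec: _ => [|j u yj Su].
  exact: supp_in0.
by apply: supp_inP => //; apply: Sf.
Qed.

Lemma supp_in_coef x : supp_in S x <-> forall i, ~ S i -> x@_i = 0.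
Proof.
split=> Sx i; first by move=> Si; apply: mcoeff_outdom; apply/negP => /Sx.
by move=> xi; apply: contrapT => /Sx /eqP; rewrite mcoeff_eq0 xi.
Qed.

End SuppIn.

Definition opb (I : choiceType) (r : option I) : {malg K[I]} :=
  if r is Some i then << i >> else 0.

Lemma supp_in_opb (I : choiceType) (S : I -> Prop) (r : option I) :
  (forall i, r = Some i -> S i) -> supp_in S (opb r).
Proof.
case: r => [i|] Sr; last exact: supp_in0.
by apply: supp_inU; apply: Sr.
Qed.

Definition bil (I J L : choiceType) (op : I -> J -> option L)
    (x : {malg K[I]}) (y : {malg K[J]}) : {malg K[L]} :=
  lin (fun i => lin (fun j => opb (op i j)) y) x.

Section Bil.
Variables (I J L : choiceType) (op : I -> J -> option L).
Implicit Types (x : {malg K[I]}) (y : {malg K[J]}).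

Lemma bil_linear_l y : linear (bil op ^~ y).
Proof. by move=> a u v; rewrite /bil linearP. Qed.

Lemma bil_linear_r x : linear (bil op x).
Proof.
move=> a u v; rewrite /bil /lin scaler_sumr -big_split /=.
apply: eq_bigr => i _; rewrite -!/(lin _ _) linearP scalerDr !scalerA.
by rewrite mulrC.
Qed.

HB.instance Definition _ x :=
  GRing.isLinear.Build K {malg K[J]} {malg K[L]} *:%R (bil op x) (bil_linear_r x).

Lemma bilUU i j : bil op << i >> << j >> = opb (op i j).
Proof. by rewrite /bil !linU. Qed.

Lemma bilDl u v y : bil op (u + v) y = bil op u y + bil op v y.
Proof. by rewrite /bil linearD. Qed.

Lemma bilZl a u y : bil op (a *: u) y = a *: bil op u y.
Proof. by rewrite /bil linearZ. Qed.

Lemma bilPl a u v y : bil op (a *: u + v) y = a *: bil op u y + bil op v y.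
Proof. exact: bil_linear_l. Qed.

Lemma bilPr a x u v : bil op x (a *: u + v) = a *: bil op x u + bil op x v.
Proof. exact: bil_linear_r. Qed.

Lemma bil0r x : bil op x 0 = 0.
Proof. exact: linear0. Qed.

Lemma bil0l y : bil op 0 y = 0.
Proof. by rewrite /bil linear0. Qed.

Lemma bil_suml (Z : Type) (r : seq Z) F y :
  bil op (\sum_(z <- r) F z) y = \sum_(z <- r) bil op (F z) y.
Proof. exact: (big_morph (fun u => bil op u y) (fun u v => bilDl u v y) (bil0l y)). Qed.

Lemma supp_in_bil (S : L -> Prop) x y :
  (forall i j l, i \in msupp x -> j \in msupp y -> op i j = Some l -> S l) ->
  supp_in S (bil op x y).
Proof.
move=> Sop; apply: supp_in_lin => i xi; apply: supp_in_lin => j yj.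
by apply: supp_in_opb => l; apply: Sop.
Qed.

End Bil.

(** Four operations are kept apart so that the law also covers an algebra acting on a module. *)
Lemma bilA (I J L M N O : choiceType) (op1 : I -> J -> option L)
    (op2 : L -> M -> option N) (op3 : J -> M -> option O) (op4 : I -> O -> option N)
    x y z :
  (forall i j m, i \in msupp x ->
     obind (op2^~ m) (op1 i j) = obind (op4 i) (op3 j m)) ->
  bil op2 (bil op1 x y) z = bil op4 x (bil op3 y z).
Proof.
move=> opA; apply: (malg_ind (P := fun x =>
  bil op2 (bil op1 x y) z = bil op4 x (bil op3 y z))) => [|a u v IHu IHv|i xi].
- by rewrite !bil0l.
- by rewrite !bilPl IHu IHv.
elim/malg_elim: y => [|a u v IHu IHv|j].
- by rewrite bil0l !bil0r bil0l.
- by rewrite bilPr !bilPl IHu IHv bilPr.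
elim/malg_elim: z => [|a u v IHu IHv|m]; first by rewrite !bil0r.
  by rewrite !bilPr IHu IHv.
rewrite !bilUU; have := opA i j m xi.
case: (op1 i j) (op3 j m) => [l|] [o|] /=.
- by rewrite !bilUU => ->.
- by rewrite bilUU bil0r => ->.
- by rewrite bilUU bil0l => <-.
- by rewrite bil0l bil0r.
Qed.

End FreeSpaces.

Arguments opb {K I} r.

(** * Restriction of scalars, and submodules as modules *)

Section ScalarRestriction.
Variables (K : fieldType) (A : pzAlgType K) (M : lmodType A^c).

Definition kmod : Type := M.
HB.instance Definition _ := GRing.Zmodule.on kmod.

Definition kscale (a : K) (x : kmod) : kmod := (scal a : A^c) *: (x : M).

Fact kscaleA a b x : kscale a (kscale b x) = kscale (a * b) x.
Proof. by rewrite /kscale scalerA mulrC rmorphM. Qed.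

Fact kscale1 : left_id 1 kscale.
Proof. by move=> x; rewrite /kscale rmorph1 scale1r. Qed.

Fact kscaleDr : right_distributive kscale +%R.
Proof. by move=> a x y; rewrite /kscale scalerDr. Qed.

Fact kscaleDl x : {morph kscale^~ x : a b / a + b}.
Proof. by move=> a b; rewrite /kscale rmorphD scalerDl. Qed.

HB.instance Definition _ :=
  GRing.Zmodule_isLmodule.Build K kmod kscaleA kscale1 kscaleDr kscaleDl.

End ScalarRestriction.

Section Submodules.
Variables (R : pzRingType) (V : lmodType R).

(** Bundling the closure proof makes a submodule an [lmodType] of its own. The terms of the
    resolutions and the image in [projective_lift] are obtained in this way. *)
Record submod := Submod { submod_set :> V -> Prop; submodP : submodule (submod_set : set V) }.

Variable U : submod.

Definition submod_pred : {pred V} := fun x => `[< U x >].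

Fact submod_pred_closed : submod_closed submod_pred.
Proof.
have [U0 UL] := submodP U; split=> [|a x y Ux Uy]; first exact/asboolP.
by apply/asboolP; apply: UL; apply/asboolP.
Qed.

HB.instance Definition _ :=
  GRing.isSubmodClosed.Build R V submod_pred submod_pred_closed.

Record submod_type := SubmodType { submod_val : V; _ : submod_val \in submod_pred }.

HB.instance Definition _ := [isSub for submod_val].
HB.instance Definition _ := [Choice of submod_type by <:].
HB.instance Definition _ := [SubChoice_isSubLmodule of submod_type by <:].

Lemma submod_val_inj : injective submod_val.
Proof. exact: val_inj. Qed.

Lemma submod_valP (x : submod_type) : U (submod_val x).
Proof. exact/asboolP/(valP x). Qed.

Definition insubmod (x : V) (Ux : U x) : submod_type := SubmodType (asboolT Ux).

Fact submod_val_linear : linear submod_val.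
Proof. by []. Qed.

HB.instance Definition _ :=
  GRing.isLinear.Build R submod_type V *:%R submod_val submod_val_linear.

End Submodules.

(** * Algebras with a multiplicative basis *)

Section Decomposition.
Variables (K : fieldType) (I : choiceType) (d : I -> nat).
Implicit Type x : {malg K[I]}.

Definition piece k x : {malg K[I]} := lin (fun i => if d i == k then << i >> else 0) x.
HB.instance Definition _ k := GRing.Linear.copy (piece k) (piece k).

Lemma piece_coef k x i : (piece k x)@_i = if d i == k then x@_i else 0.
Proof.
elim/malg_elim: x => [|a u v IHu IHv|j].
- by rewrite linear0 mcoeff0 if_same.
- by rewrite linearP /= !mcoeffD !mcoeffZ IHu IHv; case: ifP; rewrite ?mulr0 ?addr0.
rewrite /piece linU; have [<-|ji] := eqVneq j i; first by case: ifP; rewrite ?mcoeff0.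
by case: ifP; rewrite ?mcoeff0 ?mcoeffU (negPf ji) if_same.
Qed.

Lemma piece_supp k (S : I -> Prop) x :
  supp_in S x -> supp_in (fun i => S i /\ d i = k) (piece k x).
Proof.
move=> /supp_in_coef Sx; apply/supp_in_coef => i Si; rewrite piece_coef.
by case: eqP => // ik; apply: Sx => Si'; apply: Si.
Qed.

Lemma piece_deg k x : supp_in (fun i => d i = k) (piece k x).
Proof. by apply/supp_in_coef => i ik; rewrite piece_coef; case: eqP. Qed.

Lemma piece_id k x : supp_in (fun i => d i = k) x -> piece k x = x.
Proof.
move=> /supp_in_coef xk; apply/malgP => i; rewrite piece_coef.
by case: eqP => // ik; rewrite xk.
Qed.

Lemma piece_neq j k x : supp_in (fun i => d i = j) x -> j != k -> piece k x = 0.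
Proof.
move=> /supp_in_coef xk jk; apply/malgP => i; rewrite piece_coef mcoeff0.
by case: eqP => // ik; rewrite xk // ik => /esym/eqP; apply/negP.
Qed.

Lemma sum_piece x : exists n, x = \sum_(k < n) piece k x.
Proof.
exists (\max_(i <- msupp x) d i).+1; apply/malgP => i; rewrite raddf_sum /=.
have [xi|/mcoeff_outdom xi] := boolP (i \in msupp x); last first.
  by rewrite xi big1 // => k _; rewrite piece_coef xi if_same.
have lt_i : (d i < (\max_(j <- msupp x) d j).+1)%N by rewrite ltnS leq_bigmax_seq.
rewrite (bigD1 (Ordinal lt_i)) //= big1 ?addr0 => [|k ik].
  by rewrite piece_coef eqxx.
rewrite piece_coef; case: eqP => // ki; case/eqP: ik.
by apply: val_inj; rewrite /= ki.
Qed.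

(** The image of [c] may be a proper subspace, as long as it contains the homogeneous components of
    its elements. This serves the algebras as well as the terms of the resolutions. *)
Lemma decomposition (V : zmodType) (c : V -> {malg K[I]}) (g : nat -> set V) :
  injective c -> zmod_morphism c ->
  (forall k (x : V), exists y, c y = piece k (c x)) ->
  (forall n (x : V), g n x <-> supp_in (fun i => d i = n) (c x)) ->
  direct_decomposition g.
Proof.
move=> cI cB cP gP.
pose C : {additive V -> {malg K[I]}} :=
  HB.pack c (GRing.isZmodMorphism.Build V {malg K[I]} c cB).
have cD (J : Type) (r : seq J) F : c (\sum_(k <- r) F k) = \sum_(k <- r) c (F k).
  exact: (raddf_sum C).
have c0 : c 0 = 0 by apply: (raddf0 C).
split=> [x|n y gy y0 k lt_kn].
  have [n xE] := sum_piece (c x); have [y yE] := choice (fun k => cP k x).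
  exists n, y; split=> [k|]; first by apply/gP; rewrite yE; apply: piece_deg.
  by apply: cI; rewrite cD {1}xE; apply: eq_bigr => k _; rewrite yE.
apply: cI; rewrite c0; have := congr1 (piece k \o c) y0.
rewrite /= c0 linear0 cD raddf_sum (bigD1 (Ordinal lt_kn)) //= big1 ?addr0.
  by rewrite piece_id //; apply/gP.
by move=> j jk; rewrite (@piece_neq j) //; apply/gP.
Qed.

End Decomposition.

(* An algebra with a [K]-basis of homogeneous elements of a graded path       *)
(* category, such that a product of basis elements is a basis element or 0.   *)
Record based (K : fieldType) (A : pzAlgType K) := Based {
  bV : finType;
  bI : choiceType;
  bsrc : bI -> bV;
  btgt : bI -> bV;
  bid : bV -> bI;
  bmul : bI -> bI -> option bI;
  bdeg : bI -> nat;
  bcoord : A -> {malg K[bI]};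
  belt : {malg K[bI]} -> A;
  bcoordK : cancel bcoord belt;
  beltK : cancel belt bcoord;
  bcoordP : forall a x y, bcoord (scal a * x + y) = a *: bcoord x + bcoord y;
  bcoordM : forall x y, bcoord (x * y) = bil bmul (bcoord x) (bcoord y);
  bcoord1 : bcoord 1 = \sum_v << bid v >>;
  bmulA : forall i j k, obind (bmul^~ k) (bmul i j) = obind (bmul i) (bmul j k);
  bmul_idl : forall v i, bmul (bid v) i = if bsrc i == v then Some i else None;
  bmul_idr : forall v i, bmul i (bid v) = if btgt i == v then Some i else None;
  bmulP : forall i j k, bmul i j = Some k ->
    [/\ bsrc k = bsrc i, btgt k = btgt j, btgt i = bsrc j
      & bdeg k = (bdeg i + bdeg j)%N];
  bsrc_id : forall v, bsrc (bid v) = v;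
  btgt_id : forall v, btgt (bid v) = v;
  bdeg_id : forall v, bdeg (bid v) = 0%N;
  bdeg0 : forall i, bdeg i = 0%N -> i = bid (bsrc i)
}.

Section BasedAlgebra.
Variables (K : fieldType) (A : pzAlgType K) (B : based A).
Implicit Types (x y : A) (i j : bI B).

Definition bas i : A := belt << i >>.
Definition idem (v : bV B) : A := bas (bid v).

Lemma bcoord_inj : injective (bcoord B).
Proof. exact: can_inj (@bcoordK _ _ B). Qed.

Definition kcoord : kmod A^c^o -> {malg K[bI B]} := bcoord B.

Fact kcoord_linear : linear kcoord.
Proof.
move=> a x y; rewrite /kcoord -bcoordP; congr (bcoord B (_ + _)).
by rewrite scalC.
Qed.

HB.instance Definition _ := GRing.isLinear.Build K (kmod A^c^o) {malg K[bI B]}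
  *:%R kcoord kcoord_linear.

Lemma bcoord0 : bcoord B 0 = 0.
Proof. exact: (raddf0 kcoord). Qed.

Lemma bcoordD x y : bcoord B (x + y) = bcoord B x + bcoord B y.
Proof. exact: (raddfD kcoord). Qed.

Lemma bcoordB x y : bcoord B (x - y) = bcoord B x - bcoord B y.
Proof. exact: (raddfB kcoord). Qed.

Lemma belt0 : belt (0 : {malg K[bI B]}) = 0.
Proof. by apply: bcoord_inj; rewrite bcoord0 beltK. Qed.

Lemma beltP a (u v : {malg K[bI B]}) :
  belt (a *: u + v) = scal a * belt u + belt v.
Proof. by apply: bcoord_inj; rewrite bcoordP !beltK. Qed.

Lemma beltPr a (u v : {malg K[bI B]}) :
  belt (a *: u + v) = belt u * scal a + belt v.
Proof. by rewrite beltP scalC. Qed.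

Lemma bcoord_bas i : bcoord B (bas i) = << i >>.
Proof. exact: beltK. Qed.

Variable gr : nat -> set A.
Hypothesis grE : forall n (x : A), gr n x <-> supp_in (fun i => bdeg i = n) (bcoord B x).

Lemma gr_bas i : gr (bdeg i) (bas i).
Proof. by apply/grE; rewrite bcoord_bas; apply: supp_inU. Qed.

Lemma based_graded : graded_algebra gr.
Proof.
split=> [n|||m n x y].
- split=> [|a x y /grE xn /grE yn]; apply/grE.
    by rewrite bcoord0; apply: supp_in0.
  by rewrite bcoordP; apply: supp_inP.
- apply: (decomposition bcoord_inj) grE => [x y|k x]; first exact: bcoordB.
  by exists (belt (piece (@bdeg _ _ B) k (bcoord B x))); rewrite beltK.
- rewrite grE; rewrite bcoord1; elim/big_rec: _ => [|v x _ xP].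
    exact: supp_in0.
  by apply: supp_inD xP; apply: supp_inU; apply: bdeg_id.
move=> /grE xm /grE yn; apply/grE; rewrite bcoordM; apply: supp_in_bil.
by move=> i j k /xm <- /yn <- /bmulP[].
Qed.

(** The vertex idempotents are orthogonal with sum 1, and by [bdeg0] they span the degree 0 part. *)
Lemma based_split : deg0_split gr.
Proof.
pose r := #|bV B|; pose e (k : 'I_r) : bV B := enum_val k.
pose c (f : {ffun 'I_r -> K}) : {malg K[bI B]} := \sum_k f k *: << bid (e k) >>.
have cE f k : (c f)@_(bid (e k)) = f k.
  rewrite raddf_sum (bigD1 k) //= mcoeffZ mcoeffUU mulr1 big1 ?addr0 // => l lk.
  rewrite mcoeffZ mcoeffU; case: eqP => [lkE|]; last by rewrite mulr0.
  case/eqP: lk; apply: enum_val_inj.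
  by rewrite -(bsrc_id (enum_val l)) lkE bsrc_id.
have sumV (F : bV B -> {malg K[bI B]}) : \sum_v F v = \sum_k F (e k).
  rewrite (reindex e) //; exists enum_rank => v _; first exact: enum_valK.
  exact: enum_rankK.
have bc f : bcoord B (belt (c f)) = c f by rewrite beltK.
have cK a : c [ffun=> a] = bcoord B (scal a).
  rewrite -[scal a]addr0 -[scal a]mulr1 bcoordP bcoord0 addr0 bcoord1 sumV.
  by rewrite scaler_sumr; apply: eq_bigr => k _; rewrite ffunE.
have cX f k : bil (@bmul _ _ B) (c f) << bid (e k) >> = f k *: << bid (e k) >>.
  rewrite bil_suml (bigD1 k) //= big1 ?addr0 => [|l lk].
    by rewrite bilZl bilUU bmul_idl bsrc_id eqxx.
  rewrite bilZl bilUU bmul_idl bsrc_id; case: eqP => [kl|_]; last by rewrite scaler0.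
  by case/eqP: lk; apply: enum_val_inj.
exists r, (fun f => belt (c f)); split.
- move=> f g /(congr1 (bcoord B)); rewrite !bc => fg.
  by apply/ffunP => k; rewrite -!cE fg.
- move=> f g; apply: bcoord_inj.
  rewrite bcoordD !bc.
  by rewrite -big_split; apply: eq_bigr => k _; rewrite ffunE scalerDl.
- split; first by apply: bcoord_inj; rewrite bc cK rmorph1.
  move=> f g; apply: bcoord_inj; rewrite bcoordM !bc {3}/c linear_sum.
  by apply: eq_bigr => k _; rewrite linearZ /= cX ffunE scalerA mulrC.
- by move=> a; apply: bcoord_inj; rewrite bc cK.
apply/seteqP; split=> x.
  case=> f _ <-; apply/grE; rewrite bc /c; elim/big_rec: _ => [|k u _].
    exact: supp_in0.
  by apply: supp_inP; apply: supp_inU; apply: bdeg_id.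
move=> /grE x0; exists [ffun k => (bcoord B x)@_(bid (e k))] => //.
apply: bcoord_inj; rewrite bc; apply/malgP => i.
have [/bdeg0 ->|i0] := eqVneq (bdeg i) 0%N.
  by rewrite -(enum_rankK (bsrc i)) cE ffunE.
rewrite [RHS]mcoeff_outdom; last by apply: contra i0 => /x0/eqP.
rewrite /c raddf_sum /= big1 // => k _; rewrite mcoeffZ mcoeffU.
case: eqP => [ki|]; last by rewrite mulr0.
by move: i0; rewrite -ki bdeg_id eqxx.
Qed.

Lemma based_finite (s : seq (bI B)) : (forall i, i \in s) -> finite_dim A.
Proof.
move=> sP; exists (size (undup s)), (fun k => bas (tnth (in_tuple (undup s)) k)) => x.
exists (fun k => (bcoord B x)@_(tnth (in_tuple (undup s)) k)).
rewrite -(big_tnth _ _ (undup s) xpredT (fun i => scal ((bcoord B x)@_i) * bas i)).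
apply: bcoord_inj.
have -> : bcoord B (\sum_(i <- undup s) scal ((bcoord B x)@_i) * bas i) =
    \sum_(i <- undup s) (bcoord B x)@_i *: << i >>.
  elim: (undup s) => [|i l IHl]; first by rewrite !big_nil bcoord0.
  by rewrite !big_cons bcoordP IHl bcoord_bas.
apply/malgP => i; rewrite raddf_sum (bigD1_seq i) ?undup_uniq ?mem_undup //=.
rewrite mcoeffZ mcoeffUU mulr1 big1 ?addr0 // => j ji.
by rewrite mcoeffZ mcoeffU (negPf ji) mulr0.
Qed.

(** The span of the basis elements of positive degree is already a right ideal, so passing to the
    generated submodule adds only sums. *)
Lemma deg0_ker x :
  gen_submod (\bigcup_n gr n.+1 : set A^c^o) x <->
  supp_in (fun i => (0 < bdeg i)%N) (bcoord B x).
Proof.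
split=> [xP|xP].
  apply: (xP (fun x => supp_in (fun i => (0 < bdeg i)%N) (bcoord B x))).
    split=> [|a y z yP zP]; first by rewrite /= bcoord0; apply: supp_in0.
    have -> : a *: y + z = z + (y : A) * a by rewrite addrC.
    rewrite /= bcoordD.
    apply: supp_inD => //=; rewrite bcoordM; apply: supp_in_bil => i j k.
    by move=> /yP i0 _ /bmulP[_ _ _ ->]; rewrite ltn_addr.
  by move=> y [n _ /grE yn] i /yn ->.
rewrite -[x](bcoordK B); move: {x}(bcoord B x) xP => u uP.
apply: (malg_ind (P := fun u => gen_submod (\bigcup_n gr n.+1 : set A^c^o) (belt u))).
- by rewrite belt0; apply: (submodule_span _).1.
- by move=> a v w vP wP; rewrite beltPr; apply: (submodule_span _).2.
move=> i /uP; case iE: (bdeg i) => [//|n] _; apply: Defs.sub_span.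
by exists n => //; rewrite -iE; apply: gr_bas.
Qed.

End BasedAlgebra.

Arguments bas {K A} B i.
Arguments idem {K A} B v.

(** * Free right modules over a based algebra and maps between them *)

Section FreeModule.
Variables (K : fieldType) (A : pzAlgType K) (B : based A) (W : choiceType).

Definition freemod : Type := {malg K[(W * bI B)%type]}.
HB.instance Definition _ := GRing.Zmodule.on freemod.

Definition fact (b : W * bI B) (i : bI B) : option (W * bI B) :=
  omap (pair b.1) (bmul b.2 i).

Definition fscale (a : A^c) (x : freemod) : freemod := bil fact x (bcoord B a).

Fact fscaleA a b x : fscale a (fscale b x) = fscale (a * b) x.
Proof.
rewrite /fscale [RHS](_ : _ = bil fact x (bil (@bmul _ _ B) (bcoord B b) (bcoord B a))).
  apply: bilA => -[w i] j k _; rewrite /fact /=.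
  have := bmulA i j k.
  by case: (bmul i j) (bmul j k) => [l|] [m|] //= => [->|->|<-].
by rewrite -bcoordM.
Qed.

Fact fscale1 : left_id 1 fscale.
Proof.
move=> x; rewrite /fscale bcoord1 [LHS]linear_sum /=.
elim/malg_elim: x => [|a u v IHu IHv|[w i]].
- by rewrite big1 // => v _; rewrite bil0l.
- rewrite -{2}IHu -{2}IHv scaler_sumr -big_split.
  by apply: eq_bigr => z _; rewrite bilPl.
rewrite (bigD1 (btgt i)) //= bilUU /fact /= bmul_idr eqxx /= big1 ?addr0 //.
by move=> v vi; rewrite bilUU /fact /= bmul_idr eq_sym (negPf vi).
Qed.

Fact fscaleDr : right_distributive fscale +%R.
Proof. by move=> a x y; rewrite /fscale bilDl. Qed.

Fact fscaleDl x : {morph fscale^~ x : a b / a + b}.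
Proof.
move=> a b; rewrite /fscale -raddfD; congr (bil _ _ _).
exact: bcoordD.
Qed.

HB.instance Definition _ :=
  GRing.Zmodule_isLmodule.Build A^c freemod fscaleA fscale1 fscaleDr fscaleDl.

Lemma fscaleE (a : A^c) (x : freemod) : a *: x = bil fact x (bcoord B a).
Proof. by []. Qed.

Lemma fscale_scal (a : K) (x : freemod) :
  (scal a : A^c) *: x = a *: (x : {malg K[(W * bI B)%type]}).
Proof.
rewrite fscaleE -[scal a]addr0 -[scal a]mulr1 bcoordP bcoord0 addr0 linearZ /=.
by rewrite (_ : bil fact x (bcoord B 1) = x) //; apply: fscale1.
Qed.

Variables (M : lmodType A^c) (F : W -> M).

Definition flift (x : freemod) : M :=
  lin (fun b : W * bI B => (bas B b.2 : A^c) *: F b.1 : kmod M) x.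

(** Linearity over [K] holds by construction. For the action of the algebra, the vector and then the
    scalar are reduced to basis elements, where a product is again a basis element or 0. *)
Lemma flift_linear : linear flift.
Proof.
have fl (a : K) (x y : freemod) : flift (a *: (x : {malg K[_]}) + y) =
    (scal a : A^c) *: flift x + flift y by rewrite [LHS]linearP.
have fl0 : flift 0 = 0 by exact: (raddf0 (lin (fun b : W * bI B => (bas B b.2 : A^c) *: F b.1 : kmod M))).
move=> a x y; have -> : flift (a *: x + y) = flift (a *: x) + flift y.
  by have := fl 1 (a *: x) y; rewrite rmorph1 !scale1r.
congr (_ + _); elim/malg_elim: x => [|b u v IHu IHv|[w i]].
- by rewrite [0 in LHS]/(0 : freemod) scaler0 fl0 scaler0.
- have -> : a *: (b *: u + v : freemod) =
      b *: ((a *: (u : freemod) : freemod) : {malg K[_]}) + (a *: (v : freemod)).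
    by rewrite [LHS]scalerDr; congr (_ + _); rewrite !fscaleE bilZl.
  rewrite fl IHu IHv fl scalerDr !scalerA; congr (_ *: _ + _).
  by rewrite /GRing.mul /= scalC.
rewrite [flift << _ >>]linU /= scalerA fscaleE.
have -> : (a * (bas B i : A^c)) = belt (bil (@bmul _ _ B) << i >> (bcoord B a)).
  by apply: (bcoord_inj (B := B)); rewrite beltK bcoordM bcoord_bas.
elim/malg_elim: (bcoord B a) => [|b u v IHu IHv|j].
- by rewrite !bil0r fl0 belt0 scale0r.
- rewrite !bilPr fl IHu IHv.
  by rewrite beltPr scalerDl -scalerA.
rewrite !bilUU /fact /=; case: (bmul i j) => [k|] /=; first by rewrite [LHS]linU.
by rewrite fl0 belt0 scale0r.
Qed.

HB.instance Definition _ :=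
  GRing.isLinear.Build A^c freemod M *:%R flift flift_linear.

Lemma fliftK (a : K) (x y : {malg K[(W * bI B)%type]}) :
  flift (a *: x + y) = (scal a : A^c) *: flift x + flift y.
Proof. by rewrite /flift linearP. Qed.

Lemma flift0 : flift (0 : {malg K[(W * bI B)%type]}) = 0.
Proof. by rewrite /flift linear0. Qed.

Lemma fliftU b : flift << b >> = (bas B b.2 : A^c) *: F b.1.
Proof. by rewrite /flift linU. Qed.

End FreeModule.

Arguments flift {K A} B {W M} F x.

Section MatrixMaps.
Variables (K : fieldType) (A : pzAlgType K) (B : based A) (W X : choiceType).
Variable F : W -> {malg K[(X * bI B)%type]}.

(* Locked, as unfolding it makes failing unifications very slow. *)
Fact mlift_key : unit. Proof. exact: tt. Qed.
Definition mlift : {malg K[(W * bI B)%type]} -> {malg K[(X * bI B)%type]} :=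
  locked_with mlift_key (flift B (F : W -> freemod B X)).

Lemma mliftE x : mlift x = flift B (F : W -> freemod B X) x.
Proof. by rewrite /mlift unlock. Qed.

Fact mlift_linear : linear mlift.
Proof. by move=> a x y; rewrite !mliftE fliftK fscale_scal. Qed.

HB.instance Definition _ := GRing.isLinear.Build K {malg K[(W * bI B)%type]}
  {malg K[(X * bI B)%type]} *:%R mlift mlift_linear.

Lemma mliftP a x y : mlift (a *: x + y) = a *: mlift x + mlift y.
Proof. exact: mlift_linear. Qed.

Lemma mlift0 : mlift 0 = 0.
Proof. exact: raddf0. Qed.

Lemma mliftU b : mlift << b >> = bil (@fact _ _ B X) (F b.1) << b.2 >>.
Proof. by rewrite mliftE fliftU fscaleE bcoord_bas. Qed.

Lemma mlift_bil x c :
  mlift (bil (@fact _ _ B W) x c) = bil (@fact _ _ B X) (mlift x) c.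
Proof.
have := linearZ_LR (flift B (F : W -> freemod B X)) (belt c) x.
by rewrite fscaleE beltK !mliftE /= => ->; rewrite fscaleE beltK.
Qed.

End MatrixMaps.

(** * Resolutions with a contracting homotopy *)

Section Cells.
Variables (K : fieldType) (A : pzAlgType K) (B : based A) (W : choiceType).
Variables (ok : pred W) (lvl : W -> nat) (vtx : W -> bV B).

(** The pairs [(w, i)] with this property form a K-basis of the direct sum of the projectives e A,
    with e the idempotent at [vtx w], over the valid [w] of level [n]. *)
Definition cell (n : nat) (b : W * bI B) : Prop :=
  [/\ ok b.1, lvl b.1 = n & vtx b.1 = bsrc b.2].

Lemma cell_supp_submod n :
  submodule (supp_in (cell n) : set (freemod B W)).
Proof.
split=> [|a x y xP yP]; first exact: supp_in0.
apply: supp_inD => //; rewrite fscaleE; apply: supp_in_bil => -[w i] j [w' k].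
move=> /xP[/= wok wl wi] _; rewrite /fact /=; case ij: (bmul i j) => [l|//] [<- <-].
by split=> //=; have [-> _ _ _] := bmulP ij.
Qed.

Definition cells n := Submod (cell_supp_submod n).
Definition cellmod n : lmodType A^c := submod_type (cells n).

Definition cval n (x : cellmod n) : freemod B W := submod_val x.

Arguments cval : simpl never.

Fact cval_linear n : linear (@cval n).
Proof. by []. Qed.

HB.instance Definition _ n :=
  GRing.isLinear.Build A^c (cellmod n) (freemod B W) *:%R (@cval n) (@cval_linear n).

Lemma cval_inj n : injective (@cval n).
Proof. exact: submod_val_inj. Qed.

Lemma cvalP n (x : cellmod n) : supp_in (cell n) (cval x).
Proof. exact: (submod_valP (U := cells n) x). Qed.

Arguments cvalP {n} x i _.

Definition incell n (x : freemod B W) (xP : supp_in (cell n) x) : cellmod n :=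
  insubmod (U := cells n) xP.

Lemma cell_idem w : ok w -> cell (lvl w) (w, bid (vtx w)).
Proof. by move=> wok; split=> //=; rewrite bsrc_id. Qed.

Definition genr n (w : W) : cellmod n :=
  if pselect (ok w /\ lvl w = n) is left h then
    incell (x := << (w, bid (vtx w)) >>)
      (supp_inU (ecast n (cell n (w, bid (vtx w))) h.2 (cell_idem h.1)))
  else 0.

Lemma genrE n w : ok w -> lvl w = n -> cval (genr n w) = << (w, bid (vtx w)) >>.
Proof. by rewrite /genr; case: pselect => // h wok wn; case: h. Qed.

Lemma genr_bas n w i : cell n (w, i) ->
  cval ((bas B i : A^c) *: genr n w) = << (w, i) >>.
Proof.
move=> [/= wok wn wi]; rewrite linearZ_LR /= genrE // fscaleE bcoord_bas bilUU /fact /=.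
by rewrite bmul_idl wi eqxx.
Qed.

Lemma cellmod_ind n (P : cellmod n -> Prop) :
  P 0 -> (forall a x y, P x -> P y -> P ((scal a : A^c) *: x + y)) ->
  forall x, (forall w i, (w, i) \in msupp (cval x : {malg K[_]}) -> cell n (w, i) ->
    P ((bas B i : A^c) *: genr n w)) -> P x.
Proof.
move=> P0 PP x Pg; have xP : supp_in (cell n) (cval x) := cvalP x.
(* The membership proof is quantified existentially, so that the induction can run over plain
   vectors of the free module. *)
have [h xE] : exists h, P (incell (n := n) (x := cval x) h); last first.
  by congr P: xE; apply: cval_inj.
move: (cval x) Pg xP => u Pg uP.
pose Q v := exists h, P (incell (n := n) (x := v) h).
apply: (malg_ind (P := Q)) => [|a v w [hv Pv] [hw Pw]|[w i] ui].
- by exists (@supp_in0 _ _ _); congr P: P0; apply: cval_inj.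
- exists (supp_inP (a := a) hv hw); congr P: (PP a _ _ Pv Pw).
  by apply: cval_inj; rewrite linearP /= fscale_scal.
have hc := uP _ ui; exists (supp_inU hc); congr P: (Pg _ _ ui hc).
by apply: cval_inj; rewrite genr_bas.
Qed.

Lemma eq_cellmod n (M : lmodType A^c) (f g : {linear cellmod n -> M}) x :
  (forall w, ok w -> lvl w = n -> f (genr n w) = g (genr n w)) -> f x = g x.
Proof.
move=> fg; apply: (cellmod_ind (P := fun x => f x = g x)) => [|a u v fu fv|w i _ [/= wok wn _]].
- by rewrite !linear0.
- by rewrite !linearP fu fv.
by rewrite !linearZ /= fg.
Qed.

(** A chosen preimage [m w] of the image of a generator need not be fixed by the idempotent at
    [vtx w]. The lift sends the generator to [m w] times this idempotent, which has the same image
    since the generator is fixed. *)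
Lemma cellmod_proj n : projective (cellmod n).
Proof.
move=> M N g f gsurj.
have [m mE] := choice (fun w => gsurj (f (genr n w))).
pose h : cellmod n -> M := flift B m \o @cval n.
have hL : linear h by move=> a x y; rewrite /h /= !linearP.
pose H : {linear cellmod n -> M} := HB.pack h (GRing.isLinear.Build _ _ _ _ h hL).
exists H => x; have gHL : linear (g \o H) by move=> a u v; rewrite /= hL linearP.
pose gH : {linear cellmod n -> N} :=
  HB.pack (g \o H) (GRing.isLinear.Build _ _ _ _ (g \o H) gHL).
apply: (eq_cellmod (f := gH)) => w wok wn.
have genr1 : (bas B (bid (vtx w)) : A^c) *: genr n w = genr n w.
  by apply: cval_inj; rewrite genr_bas ?genrE // -wn; apply: cell_idem.
by rewrite /= /h /= genrE // fliftU /= linearZ /= mE -linearZ /= genr1.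
Qed.

End Cells.

Arguments cval {K A B W ok lvl vtx n} x : simpl never.
Arguments cvalP {K A B W ok lvl vtx n} x i _.

(* A minimal resolution with [K]-basis the pairs of a cell [w] and a basis    *)
(* element of the algebra that starts at [vtx w], together with a             *)
(* [K]-linear contracting homotopy.                                           *)
Record cellular (K : fieldType) (A : pzAlgType K) (B : based A) := Cellular {
  cW : choiceType;
  cok : pred cW;
  clvl : cW -> nat;
  cvtx : cW -> bV B;
  cver : bV B -> cW;
  cdel : nat -> nat;
  cbd : cW -> {malg K[(cW * bI B)%type]};
  chom : cW * bI B -> {malg K[(cW * bI B)%type]};
  cver_ok : forall v, cok (cver v);
  cver_lvl : forall v, clvl (cver v) = 0%N;
  cver_vtx : forall v, cvtx (cver v) = v;
  cverP : forall w, cok w -> clvl w = 0%N -> w = cver (cvtx w);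
  cdel0 : cdel 0 = 0%N;
  cbd0 : forall w, clvl w = 0%N -> cbd w = 0;
  cbd_supp : forall n w, cok w -> clvl w = n.+1 ->
    supp_in (fun b => [/\ cell cok clvl cvtx n b, (0 < bdeg b.2)%N
                        & cdel n + bdeg b.2 = cdel n.+1]%N) (cbd w);
  chom_supp : forall n b, cell cok clvl cvtx n b ->
    supp_in (cell cok clvl cvtx n.+1) (chom b);
  cbdK : forall w, cok w -> mlift cbd (cbd w) = 0;
  chomP : forall n b, cell cok clvl cvtx n b ->
    mlift cbd (chom b) + lin chom (mlift cbd << b >>) =
    if (clvl b.1 == 0%N) && (bdeg b.2 == 0%N) then 0 else << b >>
}.

Section CellularResolution.
Variables (K : fieldType) (A : pzAlgType K) (B : based A) (C : cellular B).
Variable gr : nat -> set A.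
Hypothesis grE : forall n (x : A), gr n x <-> supp_in (fun i => bdeg i = n) (bcoord B x).

Local Notation T := {malg K[(cW C * bI B)%type]}.
Local Notation FM := (freemod B (cW C)).
Local Notation cell := (cell (@cok _ _ _ C) (@clvl _ _ _ C) (@cvtx _ _ _ C)).
Local Notation Q := (cellmod (@cok _ _ _ C) (@clvl _ _ _ C) (@cvtx _ _ _ C)).
Local Notation cells := (cells (@cok _ _ _ C) (@clvl _ _ _ C) (@cvtx _ _ _ C)).
Local Notation D := (mlift (@cbd _ _ _ C)).
Local Notation H := (lin (@chom _ _ _ C)).

Lemma flift_supp (M : lmodType A^c) (F : cW C -> M) (U : submod M) (x : T) :
  (forall w i, (w, i) \in msupp x -> U (F w)) -> U (flift B F x).
Proof.
have [U0 UP] := submodP U.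
move=> UF; apply: (malg_ind (P := fun x => U (flift B F x))) => [|a u v Uu Uv|[w i] xwi].
- by rewrite flift0.
- by rewrite fliftK; apply: UP.
by rewrite fliftU -[_ *: _]addr0; apply: UP => //; apply: UF xwi.
Qed.

Lemma bd_cells n x : supp_in (cell n.+1) x -> supp_in (cell n) (D x).
Proof.
move=> xP; rewrite mliftE; apply: (flift_supp (M := FM) (U := cells n)) => w i /xP[/= wok wn _].
by move=> b /(cbd_supp wok wn)[].
Qed.

Lemma hom_cells n x : supp_in (cell n) x -> supp_in (cell n.+1) (H x).
Proof. by move=> xP; apply: supp_in_lin => b /xP; apply: chom_supp. Qed.

Lemma supp_pos_submod :
  submodule (supp_in (fun b => 0 < bdeg b.2)%N : set FM).
Proof.
split=> [|a u v Uu Uv]; first exact: supp_in0.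
apply: supp_inD => //; rewrite fscaleE; apply: supp_in_bil => -[w i] j [w' k].
move=> /Uu/= i0 _; rewrite /fact /=; case ij: (bmul i j) => [l|//] [_ <-].
by have [_ _ _ ->] := bmulP ij; rewrite ltn_addr.
Qed.

Lemma bd_pos n x : supp_in (cell n.+1) x -> supp_in (fun b => 0 < bdeg b.2)%N (D x).
Proof.
move=> xP; rewrite mliftE; apply: (flift_supp (M := FM) (U := Submod supp_pos_submod)).
by move=> w i /xP[/= wok w1 _] b' /(cbd_supp wok w1)[].
Qed.

Lemma bdK x : (forall b, b \in msupp x -> cok b.1) -> D (D x) = 0.
Proof.
move=> xok; apply: (malg_ind (P := fun x => D (D x) = 0)) => [|a u v Du Dv|b /xok bok].
- by rewrite !mlift0.
- by rewrite !mliftP Du Dv scaler0 addr0.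
by rewrite mliftU mlift_bil cbdK ?bil0l.
Qed.

Lemma bd_level0 x : supp_in (cell 0%N) x -> D x = 0.
Proof.
move=> xP; apply: (malg_ind (P := fun x => D x = 0)) => [|a u v Du Dv|b /xP[_ b0 _]].
- by rewrite mlift0.
- by rewrite mliftP Du Dv scaler0 addr0.
by rewrite mliftU cbd0 ?bil0l.
Qed.

Lemma homotopy n x : supp_in (cell n) x ->
  (n = 0%N -> supp_in (fun b => 0 < bdeg b.2)%N x) -> D (H x) + H (D x) = x.
Proof.
move=> xP x0; apply: (malg_ind (P := fun x => D (H x) + H (D x) = x)) => [|a u v Pu Pv|b bx].
- by rewrite mlift0 linear0 mlift0 addr0.
- rewrite mliftP !linearP /= addrACA -scalerDr.  by rewrite Pu Pv.
rewrite linU; have cb := xP _ bx; rewrite (chomP cb); case: ifP => // /andP[/eqP l0 /eqP b0].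
by case: cb => _ + _; rewrite l0 => /esym/x0/(_ _ bx); rewrite b0.
Qed.

Fact diff_linear n : linear (fun x : Q n.+1 =>
  incell (bd_cells (cvalP x)) : Q n).
Proof.
move=> a x y; apply: cval_inj.
change (D (cval (a *: x + y)) = a *: (D (cval x) : FM) + D (cval y)).
by rewrite !mliftE !linearP.
Qed.

Definition cdiff n : {linear Q n.+1 -> Q n} :=
  HB.pack (fun x : Q n.+1 => incell (bd_cells (cvalP x)) : Q n)
    (GRing.isLinear.Build _ _ _ _ _ (@diff_linear n)).

Definition caug_gen (w : cW C) : deg0 gr :=
  @qproj A^c A^c^o (\bigcup_n gr n.+1) (idem B (cvtx w)).

Definition caug0 (x : FM) : deg0 gr := flift B caug_gen x.

Fact aug_linear : linear (caug0 \o @cval _ _ _ _ _ _ _ _ : Q 0%N -> deg0 gr).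
Proof. by move=> a x y; rewrite /caug0 /= linearP. Qed.

Definition caug : {linear Q 0%N -> deg0 gr} :=
  HB.pack (caug0 \o @cval _ _ _ _ _ _ _ _ : Q 0%N -> deg0 gr) (GRing.isLinear.Build _ _ _ _ _ aug_linear).

(** The cells of level 0 are the vertices, so level 0 is a copy of the algebra; this map forgets the
    cell. *)
Definition bproj (x : T) : {malg K[bI B]} := lin (fun b : cW C * bI B => << b.2 >>) x.

Lemma caugE (x : Q 0%N) :
  caug x = @qproj A^c A^c^o (\bigcup_n gr n.+1) (belt (bproj (cval x))).
Proof.
rewrite /= /caug0; have := @cvalP _ _ _ _ _ _ _ _ x.
move: (cval x) => {x} x /= xP.
apply: (malg_ind (P := fun x => flift B caug_gen x =
  @qproj A^c A^c^o (\bigcup_n gr n.+1) (belt (bproj x)))).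
- by rewrite flift0 /bproj linear0 belt0 linear0.
- move=> a u v; rewrite fliftK => -> ->.
  rewrite /bproj [in RHS]linearP beltPr.
  by symmetry; apply: (linearP (@qproj A^c A^c^o (\bigcup_n gr n.+1)) (scal a : A^c)).
move=> [w i] /xP[_ _ /= wi]; rewrite fliftU /bproj linU /caug_gen /=.
rewrite -linearZ /=; congr (qproj _ _).
rewrite /idem wi; apply: (bcoord_inj (B := B)).
by rewrite [LHS]bcoordM beltK !bcoord_bas bilUU bmul_idl eqxx.
Qed.

Lemma bproj_coef (x : T) v : cells 0%N x ->
  (bproj x)@_(bid v) = (x : {malg K[_]})@_(cver C v, bid v).
Proof.
move=> xP; apply: (malg_ind (P := fun x => (bproj x)@_(bid v) = x@_(cver C v, bid v))).
- by rewrite /bproj linear0 !mcoeff0.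
- by move=> a u w Pu Pw; rewrite /bproj linearP /= !mcoeffD !mcoeffZ Pu Pw.
move=> [w i] /xP[/= wok w0 wi]; rewrite /bproj linU !mcoeffU /= xpair_eqE.
have [iv|] := eqVneq i (bid v); last by rewrite andbF.
by rewrite (cverP wok w0) wi iv bsrc_id eqxx.
Qed.

Lemma caug_ker (x : Q 0%N) :
  caug x = 0 <-> supp_in (fun b => 0 < bdeg b.2)%N (cval x : {malg K[_]}).
Proof.
rewrite caugE -(linear0 (@qproj A^c A^c^o (\bigcup_n gr n.+1))) qproj_eqP subr0.
rewrite (deg0_ker grE) beltK; have xP := cvalP x; split=> [x0 [w i] xwi|x0].
  have [/= wok w0 wi] := xP _ xwi; rewrite lt0n; apply/eqP => /= i0.
  have : (bproj (cval x))@_(bid (bsrc i)) = 0.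
    by apply: mcoeff_outdom; apply/negP => /x0; rewrite bdeg_id.
  rewrite bproj_coef // -wi -(cverP wok w0) wi -(bdeg0 i0).
  by apply/eqP; rewrite mcoeff_neq0.
by apply: supp_in_lin => b /x0 b0; apply: supp_inU.
Qed.

Lemma caug_surj (y : deg0 gr) : exists x, caug x = y.
Proof.
have [z <-] := qproj_surj y.
pose f i : T := << (cver C (bsrc i), i) >>.
have uP : supp_in (cell 0%N) (lin f (bcoord B z)).
  apply: supp_in_lin => i _; apply: supp_inU.
  by split; rewrite ?cver_ok ?cver_lvl ?cver_vtx.
have fK : cancel (lin f) bproj.
  apply: malg_elim => [|a v w IHv IHw|i]; first by rewrite /bproj !linear0.
    by rewrite /bproj !linearP /= -!/(bproj _) IHv IHw.
  by rewrite /bproj !linU.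
exists (incell uP); rewrite caugE; congr (qproj _ _).
by rewrite [bproj _]fK bcoordK.
Qed.

Lemma cexact0 (x : Q 0%N) : caug x = 0 <-> exists y, cdiff 0 y = x.
Proof.
rewrite caug_ker; split=> [x0|[y <-]]; last exact: bd_pos (cvalP y).
exists (incell (hom_cells (cvalP x))); apply: cval_inj.
have Dx : D (cval x) = 0 by apply: bd_level0; apply: cvalP.
by have := homotopy (cvalP x) (fun=> x0); rewrite Dx linear0 addr0.
Qed.

(** If [x] is a cycle, d h + h d = 1 shows that [x] is the boundary of h x. *)
Lemma cexact n (x : Q n.+1) : cdiff n x = 0 <-> exists y, cdiff n.+1 y = x.
Proof.
split=> [/(congr1 (@cval _ _ _ _ _ _ _ _))/= Dx|[y <-]].
  exists (incell (hom_cells (cvalP x))).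
  apply: cval_inj; have := homotopy (cvalP x).
  by rewrite [D (cval x)]Dx linear0 addr0; apply.
by apply: cval_inj; apply: bdK => b /(cvalP y)[].
Qed.

Definition cres : @resolution A^c (deg0 gr) :=
  @Resolution A^c (deg0 gr) Q cdiff caug (@cellmod_proj _ _ _ _ _ _ _) caug_surj cexact0 cexact.

Definition cgrade n k : set (Q n) :=
  [set x | supp_in (fun b => cdel C n + bdeg b.2 = k)%N (cval x : {malg K[_]})].

(** This is the source of minimality: a generator times a basis element of positive degree lies in
    the radical by definition. *)
Lemma supp_pos_radical n (x : Q n) :
  supp_in (fun b => 0 < bdeg b.2)%N (cval x : {malg K[_]}) -> radical gr x.
Proof.
move=> x0; apply: cellmod_ind => [|a u v|w i /x0 /= i0 _].
- exact: (submodule_span _).1.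
- exact: (submodule_span _).2.
apply: Defs.sub_span; exists (bdeg i).-1, (bas B i), (genr _ _ _ n w); split=> //.
by rewrite prednK //; apply: gr_bas.
Qed.

Lemma cellular_generated : resolution_generated_in gr (cdel C).
Proof.
exists cres, cgrade; split.
- move=> n; split.
  + move=> k; split=> [|x y xP yP]; first exact: supp_in0.
    exact: supp_inB.
  + apply: (decomposition (c := fun x : Q n => cval x : {malg K[_]})
      (d := fun b : cW C * bI B => cdel C n + bdeg b.2)%N) => //.
    * exact: cval_inj.
    * move=> k x; have xP := cvalP x.
      have pP : cells n (piece (fun b : cW C * bI B => cdel C n + bdeg b.2)%N k (cval x)).
        by move=> b /(piece_supp xP)[].
      by exists (incell pP).
  + move=> m k x a xm /grE ak; rewrite /cgrade /= linearZ_LR /= fscaleE.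
    apply: supp_in_bil => -[w i] j [w' l] /xm /= <- /ak <-.
    rewrite /fact /=; case ij: (bmul i j) => [l'|//] [_ <-].
    by have [_ _ _ ->] := bmulP ij; rewrite addnA.
- split=> [k x xk|n k x xk].
    exists (belt (bproj (cval x))); last by rewrite -caugE.
    apply/grE; rewrite beltK; apply: supp_in_lin => b /xk.
    by rewrite cdel0 => bk; apply: supp_inU.
  change (supp_in (fun b => cdel C n + bdeg b.2 = k)%N (D (cval x))).
  have xP := @cvalP _ _ _ _ _ _ _ _ x.
  apply: (malg_ind (P := fun x => supp_in _ (D x))) => [|a u v Du Dv|[w i] xwi].
  + by rewrite mlift0; apply: supp_in0.
  + by rewrite mliftP; apply: supp_inP.
  have [/= wok wn wi] := xP _ xwi.
  rewrite mliftU; apply: supp_in_bil => -[w' i'] j [w'' l].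
  case/(cbd_supp wok wn) => _ _ /= d' /(fsubsetP msuppU_le)/fset1P ->.
  rewrite /fact /=; case ij: (bmul i' i) => [l'|//] [_ <-].
  by have [_ _ _ ->] := bmulP ij; rewrite addnA d'; apply: (xk _ xwi).
- split=> [x /caug_ker|n x /cexact[y <-]]; first exact: supp_pos_radical.
  by apply: supp_pos_radical; apply: bd_pos (cvalP y).
move=> n x; apply: cellmod_ind => [|a u v|w i _ [/= wok wn wi]].
- exact: (submodule_span _).1.
- exact: (submodule_span _).2.
rewrite -[_ *: _]addr0; apply: (submodule_span _).2; last exact: (submodule_span _).1.
apply: Defs.sub_span; rewrite /cgrade /= genrE //.
by apply: supp_inU; rewrite /= bdeg_id addn0.
Qed.

End CellularResolution.

(** The next term may depend on the relation between the two before it, so the recursion carries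
    pairs of consecutive terms with their proof. *)
Lemma dependent_choice_fam (X : nat -> Type) (R : forall n, X n -> X n.+1 -> Prop)
    (x0 : X 0%N) (x1 : X 1%N) :
  R 0%N x0 x1 -> (forall n x y, R n x y -> exists z, R n.+1 y z) ->
  exists2 s : forall n, X n, s 0%N = x0 & forall n, R n (s n) (s n.+1).
Proof.
move=> R01 next.
pose St n := {p : X n * X n.+1 | R n p.1 p.2}.
pose step n (p : St n) : St n.+1 :=
  let z := cid (next n _ _ (proj2_sig p)) in
  exist (fun q : X n.+1 * X n.+2 => R n.+1 q.1 q.2) ((sval p).2, sval z) (svalP z).
pose st := nat_rect St (exist (fun q : X 0%N * X 1%N => R 0%N q.1 q.2) (x0, x1) R01) step.
exists (fun n => (sval (st n)).1) => // n; exact: (svalP (st n)).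
Qed.

(** * Comparison of resolutions and the Ext algebra *)

Section Lifting.
Variables (R : pzRingType).

Lemma image_submod (X Y : lmodType R) (g : {linear X -> Y}) :
  submodule [set y | exists x, g x = y].
Proof.
split=> [|a _ _ [x <-] [y <-]]; first by exists 0; rewrite linear0.
by exists (a *: x + y); rewrite linearP.
Qed.

(** The target is replaced by the image of [g], onto which [g] is surjective. *)
Lemma projective_lift (P X Y : lmodType R) (g : {linear X -> Y}) (f : {linear P -> Y}) :
  projective P -> (forall x, exists z, g z = f x) ->
  exists h : {linear P -> X}, forall x, g (h x) = f x.
Proof.
move=> projP gf; pose N := Submod (image_submod g).
pose g' x : submod_type N := insubmod (U := N) (ex_intro _ x erefl : N (g x)).
pose f' x : submod_type N := insubmod (U := N) (gf x : N (f x)).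
have g'L : linear g' by move=> a x y; apply: val_inj; rewrite /= linearP.
have f'L : linear f' by move=> a x y; apply: val_inj; rewrite /= linearP.
pose G : {linear X -> submod_type N} := HB.pack g' (GRing.isLinear.Build _ _ _ _ g' g'L).
pose F : {linear P -> submod_type N} := HB.pack f' (GRing.isLinear.Build _ _ _ _ f' f'L).
have [|h hE] := projP _ _ G F; last by exists h => x; apply: (congr1 val (hE x)).
by move=> y; have [x xE] := submod_valP y; exists x; apply: val_inj.
Qed.

Variable M : lmodType R.
Variables P Q : @resolution R M.

Lemma comparison : exists phi : forall n, {linear P n -> Q n},
  (forall x, res_aug Q (phi 0%N x) = res_aug P x) /\
  (forall n x, res_diff Q n (phi n.+1 x) = phi n (res_diff P n x)).
Proof.
have [f0 f0E] := projective_lift (@res_proj _ _ P 0) (fun x => res_surj Q (res_aug P x)).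
pose S n (f : {linear P n -> Q n}) (g : {linear P n.+1 -> Q n.+1}) :=
  forall x, res_diff Q n (g x) = f (res_diff P n x).
have dL n (f : {linear P n -> Q n}) : linear (f \o res_diff P n).
  by move=> a x y /=; rewrite !linearP.
pose df n (f : {linear P n -> Q n}) : {linear P n.+1 -> Q n} :=
  HB.pack (f \o res_diff P n) (GRing.isLinear.Build _ _ _ _ (f \o res_diff P n) (dL n f)).
have [|f1 f1E] := @projective_lift _ _ _ (res_diff Q 0) (df _ f0) (@res_proj _ _ P 1).
  by move=> x; apply/res_exact0; rewrite /= f0E; apply/res_exact0; exists x.
have [|phi phi0 phiE] := @dependent_choice_fam _ S f0 f1 f1E.
  move=> n f g fg.
  have [|h hE] := @projective_lift _ _ _ (res_diff Q n.+1) (df _ g) (@res_proj _ _ P n.+2).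
    move=> x; apply/res_exact; rewrite /= fg.
    rewrite (_ : res_diff P n _ = 0) ?linear0 //.
    by apply/res_exact; exists x.
  by exists h.
by exists phi; split=> // x; rewrite phi0.
Qed.

(* [f] has components [P i -> Q j] of all degrees [i - j >= 0]. *)
Lemma null_homotopy (f : forall i j, {linear P i -> Q j}) :
  (forall j x, f 0%N j.+1 x = 0) ->
  (forall i j x, res_diff Q j (f i.+1 j.+1 x) = f i j (res_diff P i x)) ->
  (forall i x, res_aug Q (f i 0%N x) = 0) ->
  exists s : forall i j, {linear P i -> Q j}, forall i j (x : P i),
    f i j x = res_diff Q j (s i j.+1 x) +
              (if i is i'.+1 then fun x => s i' j (res_diff P i' x)
               else fun=> 0) x.
Proof.
move=> f0 fd faug.
pose X j := forall i, {linear P i -> Q j}.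
pose back j (s : X j) i : P i -> Q j :=
  if i is i'.+1 then fun x => s i' (res_diff P i' x) else fun=> 0.
(* The homotopy is built along the target index [j], for all source indices at once: d s(i, j+1) has
   to be f(i, j) - s(i-1, j) d, and s(i, 0) is 0. *)
pose S j (s : X j) (t : X j.+1) := forall i x,
  f i j x = res_diff Q j (t i x) + back j s i x.
pose s0 : X 0%N := fun i => \0.
have s1E i := projective_lift (@res_proj _ _ P i)
  (fun x => (res_exact0 _).1 (faug i x)).
have [s1 {}s1E] : exists s1 : X 1%N, S 0%N s0 s1.
  exists (fun i => projT1 (cid (s1E i))) => i x.
  by case: cid => /= h ->; rewrite /back; case: i {h} x => [|i] x; rewrite addr0.
have [|s _ sE] := dependent_choice_fam s1E.
  move=> j s t st.
  have backP i a x y : back j.+1 t i (a *: x + y) =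
      a *: back j.+1 t i x + back j.+1 t i y.
    by case: i x y => [|i] x y /=; rewrite ?scaler0 ?addr0 // !linearP.
  have bL i : linear (fun x => f i j.+1 x - back j.+1 t i x).
    by move=> a x y; rewrite linearP backP scalerBr opprD addrACA.
  pose g i : {linear P i -> Q j.+1} := HB.pack (fun x => f i j.+1 x - back j.+1 t i x)
    (GRing.isLinear.Build _ _ _ _ _ (bL i)).
  have gE i : exists h : {linear P i -> Q j.+2}, forall x, res_diff Q j.+1 (h x) = g i x.
    apply: projective_lift => [|x]; first exact: res_proj.
    apply/res_exact; rewrite /= /back; case: i x => [|i] x.
      by rewrite f0 subr0 linear0.
    rewrite linearB /= fd st; case: i x => [|i] x; first by rewrite /back addr0 subrr.
    rewrite /back (_ : res_diff P i _ = 0) ?linear0 ?addr0 ?subrr //.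
    by apply/res_exact; exists x.
  exists (fun i => projT1 (cid (gE i))) => i x.
  by case: cid => /= h ->; rewrite subrK.
by exists (fun i j => s j i) => i j x; rewrite sE.
Qed.

End Lifting.

Section ExtRing.
Variables (K : fieldType) (A : pzAlgType K) (M : lmodType A^c).
Implicit Types P Q : @resolution A^c M.

Definition clin P (f : cendo P) i j : {linear P i -> P j} :=
  HB.pack (f i j) (GRing.isLinear.Build _ _ _ _ (f i j) (@clinear K A M P f i j)).

(** Hence the homotopy class of a chain endomorphism is determined by its composite with the
    augmentation, that is, by its cocycle. *)
Lemma null_of_aug P (f : cendo P) :
  (forall i x, res_aug P (f i 0%N x) = 0) -> null_homotopic f.
Proof.
move=> f0; have [| | |s sE] := @null_homotopy _ _ P P (clin f); last by exists s.
- by move=> j x /=; rewrite cmap_lt.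
- by move=> i j x /=; rewrite cmap_diff.
- by move=> i x /=; rewrite f0.
Qed.

Section NullIdeal.
Variable P : @resolution A^c M.
Implicit Types f g : cendo P.

Lemma null_homotopic0 : @null_homotopic K A M P 0.
Proof.
exists (fun i j => \0) => i j x.
by rewrite [res_diff P j _]linear0 add0r; case: i x.
Qed.

Lemma null_homotopicD f g :
  null_homotopic f -> null_homotopic g -> null_homotopic (f + g).
Proof.
move=> [s sE] [t tE]; exists (fun i j => s i j \+ t i j) => i j x.
rewrite [LHS](_ : _ = f i j x + g i j x) // sE tE linearD addrACA /=.
by congr (_ + _); case: i x => [|i] x; rewrite ?addr0.
Qed.

Lemma null_homotopicN f : null_homotopic f -> null_homotopic (- f).
Proof.
move=> [s sE]; have nL i j : linear (fun x => - s i j x).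
  by move=> a x y; rewrite linearP opprD scalerN.
pose t i j : {linear P i -> P j} := HB.pack (fun x => - s i j x)
  (GRing.isLinear.Build _ _ _ _ _ (nL i j)).
exists t => i j x.
rewrite [LHS](_ : _ = - f i j x) // sE /= linearN opprD; congr (_ + _).
by case: i x => [|i] x; rewrite ?oppr0.
Qed.

Lemma null_homotopic_mulr f g : null_homotopic f -> null_homotopic (f * g).
Proof.
move=> [s sE].
have tL i j : linear (fun x : P i => \sum_(k < i.+1) s k j (g i k x)).
  move=> a x y; rewrite scaler_sumr -big_split; apply: eq_bigr => k _ /=.
  by rewrite clinear linearP.
pose t i j : {linear P i -> P j} := HB.pack (fun x : P i => \sum_(k < i.+1) s k j (g i k x))
  (GRing.isLinear.Build _ _ _ _ _ (tL i j)).
exists t => i j x /=.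
under eq_bigr do rewrite sE.
rewrite big_split linear_sum /=; congr (_ + _).
rewrite big_ord_recl add0r; case: i x => [|i] x; first by rewrite big_ord0.
by apply: eq_bigr => k _; rewrite /= cmap_diff.
Qed.

Lemma null_homotopic_mull f g : null_homotopic f -> null_homotopic (g * f).
Proof.
move=> [s sE].
have tL i j : linear (fun x : P i => \sum_(l < i.+2) g l j (s i l x)).
  move=> a x y; rewrite scaler_sumr -big_split; apply: eq_bigr => k _ /=.
  by rewrite linearP clinear.
pose t i j : {linear P i -> P j} := HB.pack (fun x : P i => \sum_(l < i.+2) g l j (s i l x))
  (GRing.isLinear.Build _ _ _ _ _ (tL i j)).
exists t => i j x /=.
under eq_bigr do rewrite sE cmapD.
rewrite big_split linear_sum /=; congr (_ + _).
  rewrite [RHS]big_ord_recl /= cmap_lt // linear0 add0r.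
  by apply: eq_bigr => l _; rewrite -cmap_diff.
case: i x => [|i] x //.
by rewrite big1 // => l _; rewrite cmap0.
Qed.

Lemma null_homotopic_ideal : two_sided (@null_homotopic K A M P).
Proof.
split; [exact: null_homotopic0|exact: null_homotopicD|].
by move=> f g h fN; apply/null_homotopic_mulr/null_homotopic_mull.
Qed.

(** [Ext] divides by a generated ideal; as the null-homotopic maps form an ideal, nothing is
    added. *)
Lemma ext_eqP f g :
  aproj (@null_homotopic K A M P) f = aproj _ g <-> null_homotopic (f - g).
Proof.
rewrite aproj_eqP; split; last exact: sub_ideal_gen.
by apply; [exact: null_homotopic_ideal|].
Qed.

End NullIdeal.

Section Transport.
Variables (P Q : @resolution A^c M).
Variables (phi : forall n, {linear P n -> Q n}) (psi : forall n, {linear Q n -> P n}).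
Hypothesis phi_diff : forall n x, res_diff Q n (phi n.+1 x) = phi n (res_diff P n x).
Hypothesis psi_diff : forall n x, res_diff P n (psi n.+1 x) = psi n (res_diff Q n x).

Fact transport_subproof (f : cendo P) :
  chain_endo (fun i j x => phi j (f i j (psi i x))).
Proof.
have [fL f_lt [n fn] fd] := cmapP f.
split=> [i j a x y|i j x ij||i j x].
- by rewrite linearP fL linearP.
- by rewrite f_lt ?linear0.
- by exists n => i j x ij; rewrite fn ?linear0.
- by rewrite phi_diff fd psi_diff.
Qed.
Definition transport f : cendo Q := CEndo (transport_subproof f).

Lemma transport_null f : null_homotopic f -> null_homotopic (transport f).
Proof.
move=> [s sE]; have tL i j : linear (fun x => phi j (s i j (psi i x))).
  by move=> a x y; rewrite !linearP.
pose t i j : {linear Q i -> Q j} := HB.pack (fun x => phi j (s i j (psi i x)))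
  (GRing.isLinear.Build _ _ _ _ _ (tL i j)).
exists t => i j x /=.
rewrite sE linearD phi_diff; congr (_ + _).
by case: i x => [|i] x; rewrite ?linear0 //= psi_diff.
Qed.

Lemma transportB f g : transport (f - g) = transport f - transport g.
Proof. by apply: cendo_eq => i j x; rewrite /= linearB. Qed.

Lemma transportD f g : transport (f + g) = transport f + transport g.
Proof. by apply: cendo_eq => i j x; rewrite /= linearD. Qed.

Lemma transportZ a f : transport (cscal P a * f) = cscal Q a * transport f.
Proof.
apply: cendo_eq => i j x; rewrite [RHS](cscal_compl a (transport f)).
rewrite [LHS](_ : _ = phi j (ccomp (cscal P a) f i j (psi i x))) //.
by rewrite cscal_compl linearZ.
Qed.

End Transport.

Section Comparison.
Variables (P Q : @resolution A^c M).
Variables (phi : forall n, {linear P n -> Q n}) (psi : forall n, {linear Q n -> P n}).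
Hypothesis phi_diff : forall n x, res_diff Q n (phi n.+1 x) = phi n (res_diff P n x).
Hypothesis psi_diff : forall n x, res_diff P n (psi n.+1 x) = psi n (res_diff Q n x).
Hypothesis phi_aug : forall x, res_aug Q (phi 0%N x) = res_aug P x.
Hypothesis psi_aug : forall x, res_aug P (psi 0%N x) = res_aug Q x.

(** This is psi phi. Taking it as the transport of the identity of [Q] makes it a chain endomorphism
    without further proof. *)
Definition roundtrip : cendo P := transport psi_diff phi_diff (cone Q).

Lemma roundtripE i x : roundtrip i i x = psi i (phi i x).
Proof. by rewrite /= cid_mapE rmorph1 scale1r. Qed.

Lemma roundtrip_neq i j x : i != j -> roundtrip i j x = 0.
Proof. by move=> ij; rewrite /= cid_map_neq // scaler0 linear0. Qed.

Lemma roundtrip_null : null_homotopic (roundtrip - 1).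
Proof.
apply: null_of_aug => i x.
rewrite [X in res_aug _ X](_ : _ = roundtrip i 0%N x - (1 : cendo P) i 0%N x) //.
rewrite linearB /=; case: i x => [|i] x.
  by rewrite !cid_mapE !rmorph1 !scale1r psi_aug phi_aug subrr.
by rewrite !cid_map_neq // !scaler0 !linear0 addr0.
Qed.

(** The composite phi f psi phi g psi contains psi phi in the middle. By [roundtrip_null] this is
    homotopic to 1, so transport is multiplicative on Ext. *)
Lemma transport_mul f g : exists2 u, u = roundtrip &
  transport phi_diff psi_diff f * transport phi_diff psi_diff g =
  transport phi_diff psi_diff (f * u * g).
Proof.
exists roundtrip => //; apply: cendo_eq => i k x /=.
rewrite linear_sum /=; apply: eq_bigr => j _; congr (phi k _).
rewrite big_ord_recr /= cid_mapE rmorph1 scale1r big1 ?add0r // => l _.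
by rewrite cid_map_neq ?scaler0 ?linear0 ?cmap0 // gtn_eqF.
Qed.

Lemma transport_roundtrip f :
  transport psi_diff phi_diff (transport phi_diff psi_diff f) =
  roundtrip * f * roundtrip.
Proof.
apply: cendo_eq => i k x; rewrite [RHS](_ : _ = \sum_(j < i.+1) \sum_(l < j.+1)
  roundtrip l k (f j l (roundtrip i j x))) // big_ord_recr big1 => [|j _]; last first.
  have -> : roundtrip i (widen_ord (leqnSn i) j) x = 0.
    by apply: roundtrip_neq; rewrite gtn_eqF //=.
  by rewrite big1 // => l _; rewrite !cmap0.
rewrite [LHS]/= Monoid.mul1m [roundtrip i _ x]roundtripE; have [ik|ki] := ltnP i k.
  rewrite cmap_lt // !linear0 big1 // => j _.
  by rewrite roundtrip_neq // ltn_eqF // (leq_trans (ltn_ord j) ik).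
rewrite (bigD1 (Ordinal (leq_ltn_trans ki (ltnSn i)))) // big1 => [|j jk].
  by rewrite Monoid.mulm1 [RHS]roundtripE.
apply: roundtrip_neq.
by apply: contra jk => /eqP jk; apply/eqP/val_inj.
Qed.

End Comparison.
End ExtRing.

Lemma bil_coef (K : fieldType) (I J L : choiceType) (op : I -> J -> option L)
    (x : {malg K[I]}) j l (s : seq I) : uniq s ->
  (forall i, op i j = Some l -> i \in s) ->
  (bil op x << j >>)@_l = \sum_(i <- s) x@_i * (op i j == Some l)%:R.
Proof.
move=> us sP; elim/malg_elim: x => [|a u v IHu IHv|i].
- by rewrite bil0l mcoeff0 big1 // => i _; rewrite mcoeff0 mul0r.
- rewrite bilPl mcoeffD mcoeffZ IHu IHv mulr_sumr -big_split /=.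
  by apply: eq_bigr => i _; rewrite mcoeffD mcoeffZ mulrDl mulrA.
rewrite bilUU; have [si|si] := boolP (i \in s); last first.
  rewrite big_seq big1 => [|k sk]; last first.
    by rewrite mcoeffU; case: eqP => [ik|]; [rewrite ik sk in si|rewrite mul0r].
  case ij: (op i j) => [k|]; rewrite ?mcoeff0 // mcoeffU; case: eqP => // kl.
  by move: si; rewrite sP // ij kl.
rewrite (bigD1_seq i) //= mcoeffUU mul1r big1 => [|k ki]; last first.
  by rewrite mcoeffU eq_sym (negPf ki) mul0r.
rewrite addr0; case: (op i j) => [k|] /=; last by rewrite mcoeff0.
by rewrite mcoeffU.
Qed.

(** * Coordinates on the Ext algebra *)

Section ExtCoordinates.
Variables (K : fieldType) (A : pzAlgType K) (B : based A) (C : cellular B).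
Variable gr : nat -> set A.
Hypothesis grE : forall n (x : A), gr n x <-> supp_in (fun i => bdeg i = n) (bcoord B x).

Local Notation W := (cW C).
Local Notation cell := (cell (@cok _ _ _ C) (@clvl _ _ _ C) (@cvtx _ _ _ C)).
Local Notation M := (deg0 gr).
Local Notation Qr := (cres C grE).
Local Notation Q := (cellmod (@cok _ _ _ C) (@clvl _ _ _ C) (@cvtx _ _ _ C)).
Local Notation gen := (genr (@cok _ _ _ C) (@clvl _ _ _ C) (@cvtx _ _ _ C)).
Local Notation E := (cendo Qr).

Hypothesis okT : forall w : W, cok w.
Variable lv : nat -> seq W.
Hypothesis lv_uniq : forall n, uniq (lv n).
Hypothesis lvP : forall n w, (w \in lv n) = (clvl w == n).
Variable mulJ : W -> W -> option W.
Hypothesis mulJ_lvl : forall w2 w1 w,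
  mulJ w2 w1 = Some w -> clvl w = (clvl w2 + clvl w1)%N.
Hypothesis mulJ_vtx : forall w2 w1 w, mulJ w2 w1 = Some w -> cvtx w = cvtx w2.
Hypothesis mulJ_ver : forall v w, mulJ (cver C v) w = if cvtx w == v then Some w else None.
(* The lift of the cocycle dual to [w] to a chain map sends the generator     *)
(* [w'] to [Fl w w'].                                                         *)
Variable Fl : W -> W -> {malg K[(W * bI B)%type]}.
Hypothesis Fl_supp : forall w w' m, clvl w' = (m + clvl w)%N ->
  supp_in (fun b => cell m b /\ btgt b.2 = cvtx w') (Fl w w').
Hypothesis Fl_bd : forall w w' m, clvl w' = (m.+1 + clvl w)%N ->
  mlift (@cbd _ _ _ C) (Fl w w') = mlift (Fl w) (cbd w').
Hypothesis Fl_id : forall w w' w2, clvl w' = (clvl w2 + clvl w)%N ->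
  (Fl w w')@_(w2, bid (cvtx w2)) = (mulJ w2 w == Some w')%:R.

(** The coordinate of [x] at the vertex [v] modulo the radical. *)
Definition ev v (x : Q 0%N) : K := (cval x : {malg K[_]})@_(cver C v, bid v).

Lemma evP v (a : K) x y : ev v ((scal a : A^c) *: x + y) = a * ev v x + ev v y.
Proof.
rewrite /ev linearP /= fscale_scal.
by rewrite [LHS]mcoeffD [X in X + _]mcoeffZ.
Qed.

Lemma ev0 v : ev v 0 = 0.
Proof. by rewrite /ev linear0 [LHS]mcoeff0. Qed.

Lemma evD v x y : ev v (x + y) = ev v x + ev v y.
Proof. by have := evP v 1 x y; rewrite rmorph1 scale1r mul1r. Qed.

Lemma ev_pos v (x : Q 0%N) :
  supp_in (fun b => 0 < bdeg b.2)%N (cval x : {malg K[_]}) -> ev v x = 0.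
Proof. by move=> x0; apply: mcoeff_outdom; apply/negP => /x0; rewrite bdeg_id. Qed.

Lemma ev_bas v i (x : Q 0%N) :
  ev v ((bas B i : A^c) *: x) = if i == bid v then ev v x else 0.
Proof.
rewrite /ev linearZ_LR /= fscaleE bcoord_bas; case: eqP => [->|iv].
  elim/malg_elim: (cval x) => [|a u w IHu IHw|[w j]].
  - by rewrite bil0l.
  - by rewrite bilPl !mcoeffD !mcoeffZ IHu IHw.
  rewrite bilUU /fact /= bmul_idr; case: eqP => // jv; rewrite mcoeff0 mcoeffU.
  case: eqP => // -[_ jE]; case: jv.
  by rewrite jE btgt_id.
apply: mcoeff_outdom; apply/negP => h.
have : supp_in (fun b : W * bI B => b.2 <> bid v)
    (bil (@fact _ _ B W) (cval x) << i >>).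
  apply: supp_in_bil => -[w j] k [w' l] _ /(fsubsetP msuppU_le)/fset1P ->.
  rewrite /fact /=; case jk: (bmul j i) => [m|//] [_ <-] mv.
  have [s t st d] := bmulP jk; move: d; rewrite mv bdeg_id => /esym/eqP.
  rewrite addn_eq0 => /andP[/eqP/bdeg0 j0 /eqP/bdeg0 i0]; case: iv.
  by rewrite i0; congr (bid _); rewrite -st j0 btgt_id -s mv bsrc_id.
by move/(_ _ h) => /=.
Qed.

Lemma gen_id n w : clvl w = n -> (bas B (bid (cvtx w)) : A^c) *: gen n w = gen n w.
Proof.
by move=> wn; apply: cval_inj; rewrite genr_bas ?genrE // -wn; apply: cell_idem.
Qed.

(** Modulo the radical only the coefficients of [y] at idempotents survive. *)
Lemma ev_linear n (h : {linear Q n -> Q 0%N}) v (y : Q n) : ev v (h y) =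
  \sum_(w <- lv n) (cval y : {malg K[_]})@_(w, bid v) * ev v (h (gen n w)).
Proof.
apply: (cellmod_ind (P := fun y => ev v (h y) = \sum_(w <- lv n)
  (cval y : {malg K[_]})@_(w, bid v) * ev v (h (gen n w)))) => [|a x z IHx IHz|w i _ wi].
- by rewrite linear0 ev0 big1 // => w _; rewrite linear0 [X in X * _]mcoeff0 mul0r.
- rewrite linearP evP IHx IHz mulr_sumr -big_split /=; apply: eq_bigr => w _.
  rewrite linearP /= fscale_scal [X in _ = X * _]mcoeffD [X in (X + _) * _]mcoeffZ.
  by rewrite mulrDl mulrA.
rewrite linearZ_LR ev_bas; have [_ /= wn wiE] := wi; rewrite genr_bas //.
rewrite (bigD1_seq w) /= ?lv_uniq ?lvP ?wn //= mcoeffU xpair_eqE eqxx /=.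
rewrite big1 => [|w' ww']; first by case: eqP => _; rewrite ?mul1r ?mul0r addr0.
by rewrite mcoeffU xpair_eqE eq_sym (negPf ww') mul0r.
Qed.

Lemma linear_pos m n (h : {linear Q m -> Q n}) (x : Q m) :
  supp_in (fun b => 0 < bdeg b.2)%N (cval x : {malg K[_]}) ->
  supp_in (fun b => 0 < bdeg b.2)%N (cval (h x) : {malg K[_]}).
Proof.
move=> x0; apply: (cellmod_ind (P := fun x => supp_in (fun b => 0 < bdeg b.2)%N
  (cval (h x) : {malg K[_]}))) => [|a u v hu hv|w i /x0 /= i0 wi].
- by rewrite !linear0; apply: supp_in0.
- by rewrite !linearP /= fscale_scal; apply: supp_inP.
rewrite !linearZ_LR /= fscaleE bcoord_bas; apply: supp_in_bil => -[w' j] k [w'' l] _.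
move=> /(fsubsetP msuppU_le)/fset1P ->; rewrite /fact /=.
case ji: (bmul j i) => [l'|//] [_ <-].
by have [_ _ _ ->] := bmulP ji; rewrite /= addn_gt0 i0 orbT.
Qed.

(** The value on the generator [w] of the cocycle of [f]. Values at other vertices are 0 by
    [gen_ev]. *)
Definition kcoef (f : E) (w : W) : K := ev (cvtx w) (f (clvl w) 0%N (gen (clvl w) w)).

Definition kbound (f : E) : nat := projT1 (cid (let: And4 _ _ h _ := cmapP f in h)).

Lemma kboundP f i j x : (j + kbound f < i)%N -> f i j x = 0.
Proof. by rewrite /kbound; case: cid => n /= h; apply: h. Qed.

(** All values of the cocycle on generators. The sum is finite because the components of [f] have
    bounded degree and each level has finitely many cells. *)
Definition kappa (f : E) : {malg K[W]} :=
  \sum_(n < (kbound f).+1) \sum_(w <- lv n) kcoef f w *: << w >>.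

Lemma kappa_coef f w : (kappa f)@_w = kcoef f w.
Proof.
have sumw (n : nat) : (\sum_(u <- lv n) kcoef f u *: << u >> : {malg K[W]})@_w =
    if clvl w == n then kcoef f w else 0.
  rewrite raddf_sum /=; case: ifP => wn.
    rewrite (bigD1_seq w) ?lvP ?lv_uniq //= mcoeffZ mcoeffUU mulr1 big1 ?addr0 //.
    by move=> u uw; rewrite mcoeffZ mcoeffU (negPf uw) mulr0.
  rewrite big_seq big1 // => u; rewrite lvP mcoeffZ mcoeffU => un.
  case: eqP => [uw|_]; last by rewrite mulr0.
  by rewrite -uw un in wn.
rewrite /kappa raddf_sum /=; have [wn|nw] := ltnP (clvl w) (kbound f).+1.
  rewrite (bigD1 (Ordinal wn)) //= sumw eqxx big1 ?addr0 // => n nw.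
  by rewrite sumw eq_sym; case: eqP => // nE; case/eqP: nw; apply: val_inj.
rewrite big1 => [|n _]; first by rewrite /kcoef kboundP ?ev0 // add0n.
by rewrite sumw; case: eqP => // wn; move: nw; rewrite wn leqNgt ltn_ord.
Qed.

Lemma kappaP a f g : kappa (cscal Qr a * f + g) = a *: kappa f + kappa g.
Proof.
apply/malgP => w; rewrite mcoeffD mcoeffZ !kappa_coef /kcoef -evP.
congr (ev _ (_ + _)); exact: (cscal_compl a f).
Qed.

Lemma kappa0 : kappa 0 = 0.
Proof. by apply/malgP => w; rewrite kappa_coef /kcoef ev0 mcoeff0. Qed.

Lemma kappaD f g : kappa (f + g) = kappa f + kappa g.
Proof. by have := kappaP 1 f g; rewrite mul1r scale1r. Qed.

(** By minimality both d s and s d have values in the radical, which [ev] kills. *)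
Lemma kappa_null f : null_homotopic f -> kappa f = 0.
Proof.
move=> [s sE]; apply/malgP => w; rewrite kappa_coef /kcoef mcoeff0 sE evD.
rewrite ev_pos ?add0r; last by apply: bd_pos; apply: cvalP.
move: (gen (clvl w) w) => /= {sE}; case: (clvl w) => [|n] x; first exact: ev0.
apply/ev_pos/linear_pos; apply: bd_pos; apply: cvalP.
Qed.

Lemma gen_ev (f : E) n w v : clvl w = n -> v != cvtx w -> ev v (f n 0%N (gen n w) : Q 0%N) = 0.
Proof.
move=> wn vw; rewrite -[gen n w]gen_id // -[f n 0%N _]/(clin f n 0%N _).
rewrite linearZ_LR ev_bas ifN //; apply: contra vw => /eqP/(congr1 (@bsrc _ _ B)).
by rewrite !bsrc_id => ->.
Qed.

(** If all coordinates vanish, every generator is sent into the kernel of the augmentation, and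
    [null_of_aug] applies. *)
Lemma kappa_inj f : kappa f = 0 -> null_homotopic f.
Proof.
move=> f0; apply: null_of_aug => i x.
have fL : linear (fun x : Qr i => res_aug Qr (f i 0%N x)).
  by move=> a u v; rewrite clinear linearP.
pose F : {linear Q i -> M} := HB.pack (fun x : Qr i => res_aug Qr (f i 0%N x))
  (GRing.isLinear.Build _ _ _ _ _ fL).
apply: (eq_cellmod (f := F) (g := \0)) => w _ wi.
apply/(@caug_ker _ _ _ C gr grE) => -[w0 i0] wi0.
rewrite /= lt0n; apply/negP => /eqP/bdeg0 i0E; have [/= _ lv0 vx] := cvalP _ _ wi0.
have : ev (bsrc i0) (f i 0%N (gen i w) : Q 0%N) = 0.
  have [->|] := eqVneq (bsrc i0) (cvtx w); last exact: gen_ev.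
  by rewrite -wi -[LHS]/(kcoef f w) -kappa_coef f0 mcoeff0.
rewrite /ev -vx -(cverP (okT _) lv0) vx -i0E => /eqP.
by rewrite mcoeff_eq0 wi0.
Qed.

(** The chain map with matrix [Fl w]; it has components only from level [j + clvl w] to level [j],
    and the test turns this into a total family. *)
Definition lmap (w : W) i j (x : Q i) : Q j :=
  if pselect (supp_in (cell j) (mlift (Fl w) (cval x)) /\ i = (j + clvl w)%N) is left h
  then incell (proj1 h) else 0.

Lemma lmapE w i j (x : Q i) : cval (lmap w j x) =
  if i == (j + clvl w)%N then mlift (Fl w) (cval x) else 0.
Proof.
rewrite /lmap; case: pselect => [[h ij]|h]; first by case: eqP.
case: eqP => [ij|_]; last exact: linear0.
case: h; split=> //; rewrite mliftE.
apply: (flift_supp (M := freemod B W) (U := cells _ _ _ j)) => w' k.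
by move=> /cvalP[/= _ wi _] b /(@Fl_supp w w' j (etrans wi ij))[].
Qed.

Fact lmap_subproof w : @chain_endo K A M Qr (@lmap w).
Proof.
split.
- move=> i j a x y; apply: cval_inj; rewrite [RHS]linearP /= !lmapE.
  case: eqP => _; last by rewrite scaler0 addr0.
  by rewrite !mliftE !linearP.
- move=> i j x ij; apply: cval_inj; rewrite lmapE linear0.
  by case: eqP => // ij'; exfalso; move: ij; rewrite ij' ltnNge leq_addr.
- exists (clvl w) => i j x ij; apply: cval_inj; rewrite lmapE linear0.
  by case: eqP => // ij'; exfalso; move: ij; rewrite ij' ltnn.
move=> i j x; apply: cval_inj; rewrite lmapE.
rewrite -[LHS]/(mlift (@cbd _ _ _ C) (cval (lmap w j.+1 x))) lmapE addSn eqSS.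
case: eqP => [ij|_]; last exact: mlift0.
change (mlift (@cbd _ _ _ C) (mlift (Fl w) (cval x)) =
  mlift (Fl w) (mlift (@cbd _ _ _ C) (cval x))).
have := @cvalP _ _ _ _ _ _ _ _ x; move: (cval x) => {x} x xP.
apply: (malg_ind (P := fun x : {malg K[_]} => mlift (@cbd _ _ _ C) (mlift (Fl w) x) =
  mlift (Fl w) (mlift (@cbd _ _ _ C) x))) => [|a u v Pu Pv|[w' k] /xP[/= _ wi _]].
- by rewrite !mlift0.
- by rewrite !mliftP Pu Pv.
by rewrite !mliftU !mlift_bil /= (@Fl_bd w w' j) // wi ij addSn.
Qed.
Definition lmapc w : E := CEndo (lmap_subproof w).

Lemma lmapc_ev w1 w j w2 : clvl w2 = j ->
  (cval (lmapc w1 (clvl w) j (gen (clvl w) w) : Q j) : {malg K[_]})@_(w2, bid (cvtx w)) =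
  (mulJ w2 w1 == Some w)%:R.
Proof.
move=> wj; rewrite lmapE; case: eqP => [wl|wl]; last first.
  rewrite [LHS]mcoeff0; case: eqP => // /mulJ_lvl wE; case: wl.
  by rewrite wE wj.
rewrite genrE // mliftU /=.
have -> : bil (@fact _ _ B W) (Fl w1 w) << bid (cvtx w) >> = Fl w1 w.
  have FS := @Fl_supp w1 w j wl.
  apply: (malg_ind (P := fun x : {malg K[_]} => bil (@fact _ _ B W) x << bid (cvtx w) >> = x)).
  - by rewrite bil0l.
  - by move=> a u v Pu Pv; rewrite bilPl Pu Pv.
  by move=> [w' i] /FS[_ /= iE]; rewrite bilUU /fact /= bmul_idr iE eqxx.
have [wv|wv] := eqVneq (cvtx w2) (cvtx w).
  by rewrite -wv Fl_id // wl wj.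
case: eqP => [/mulJ_vtx wE|_]; first by rewrite wE eqxx in wv.
apply: mcoeff_outdom; apply/negP => /(@Fl_supp w1 w j wl)[[_ _ /= wE] _].
by move: wv; rewrite wE bsrc_id eqxx.
Qed.

(** The value of the product on a generator [w] is that of [f] on the lift at [w]. By [ev_linear]
    only the idempotent coefficients of the lift count, and by [Fl_id] these are the structure
    constants of [mulJ]. *)
Lemma kappa_mul_lmapc f w1 : kappa (f * lmapc w1) = bil mulJ (kappa f) << w1 >>.
Proof.
apply/malgP => w; rewrite kappa_coef /kcoef.
rewrite [f * _ in LHS](_ : _ = ccomp f (lmapc w1)) //.
rewrite [LHS](_ : _ = ev (cvtx w) (\sum_(j < (clvl w).+1)
  clin f j 0%N (lmapc w1 (clvl w) j (gen (clvl w) w)))) //.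
rewrite (big_morph (ev (cvtx w)) (@evD _) (@ev0 _)).
rewrite (@bil_coef _ _ _ _ _ _ _ _ (flatten [seq lv j | j <- iota 0 (clvl w).+1])).
- rewrite big_flatten big_map -[iota _ _]/(index_iota 0 (clvl w).+1) big_mkord.
  apply: eq_bigr => j _; rewrite ev_linear !big_seq; apply: eq_bigr => w2.
  rewrite lvP => /eqP w2j; rewrite lmapc_ev // kappa_coef mulrC.
  case: eqP => [/mulJ_vtx wv|_]; last by rewrite !mulr0.
  by rewrite /kcoef w2j wv.
- elim: (iota 0 _) (iota_uniq 0 (clvl w).+1) => [//|n s IHs] /= /andP[ns us].
  rewrite cat_uniq lv_uniq IHs // andbT; apply/hasPn => u /flatten_mapP[m sm].
  by rewrite !lvP => /eqP ->; apply: contra ns => /eqP <-.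
move=> w2 /mulJ_lvl wE; apply/flatten_mapP; exists (clvl w2); last by rewrite lvP.
by rewrite mem_iota /= wE ltnS leq_addr.
Qed.

Definition sigma (u : {malg K[W]}) : E :=
  \sum_(w <- msupp u) cscal Qr u@_w * lmapc w.

Lemma kappa_cone : kappa 1 = \sum_v << cver C v >>.
Proof.
apply/malgP => w; rewrite kappa_coef /kcoef raddf_sum /=.
rewrite [X in ev _ X](_ : _ = (scal 1 : A^c) *: @cid_map K A M Qr (clvl w) 0%N
  (gen (clvl w) w)) // rmorph1 scale1r.
have [w0|w0] := eqVneq (clvl w) 0%N; last first.
  rewrite cid_map_neq // ev0 big1 // => v _; rewrite mcoeffU; case: eqP => // wE.
  by rewrite -wE cver_lvl in w0.
rewrite w0 cid_mapE /ev genrE // (bigD1 (cvtx w)) //= -(cverP _ w0) //.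
rewrite [in LHS](cverP _ w0) // cver_vtx mcoeffUU mcoeffUU big1 ?addr0 // => v vw.
rewrite mcoeffU; case: eqP => // wE; move: vw.
by rewrite -wE cver_vtx eqxx.
Qed.

Lemma kappa_lmapc w : kappa (lmapc w) = << w >>.
Proof.
rewrite -[lmapc w]mul1r kappa_mul_lmapc kappa_cone bil_suml (bigD1 (cvtx w)) //=.
rewrite bilUU mulJ_ver eqxx big1 ?addr0 // => v vw.
by rewrite bilUU mulJ_ver eq_sym (negPf vw).
Qed.

Lemma kappa_sigma u : kappa (sigma u) = u.
Proof.
rewrite {2}[u]malg_sum /sigma; elim: (enum_fset (msupp u)) => [|w s IHs].
  by rewrite !big_nil kappa0.
by rewrite !big_cons kappaP IHs kappa_lmapc.
Qed.

Lemma kappaN f : kappa (- f) = - kappa f.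
Proof. by apply: (addrI (kappa f)); rewrite -kappaD !subrr kappa0. Qed.

Lemma sigma_kappa f : null_homotopic (f - sigma (kappa f)).
Proof. by apply: kappa_inj; rewrite kappaD kappaN kappa_sigma subrr. Qed.

Lemma kappa_eq f g : null_homotopic (f - g) -> kappa f = kappa g.
Proof. by move/kappa_null/eqP; rewrite kappaD kappaN subr_eq0 => /eqP. Qed.

(** Up to homotopy [g] is a combination of the lifts [lmapc w], and for these the product is
    known. *)
Lemma kappaM f g : kappa (f * g) = bil mulJ (kappa f) (kappa g).
Proof.
rewrite -[in LHS](subrK (sigma (kappa g)) g) mulrDr kappaD.
rewrite kappa_null ?add0r; last exact/null_homotopic_mull/sigma_kappa.
rewrite {2}[kappa g]malg_sum /sigma; elim: (enum_fset _) => [|w s IHs].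
  by rewrite !big_nil mulr0 kappa0 bil0r.
rewrite !big_cons mulrDr mulrA -cscalC -mulrA kappaP IHs kappa_mul_lmapc.
by rewrite bilPr.
Qed.

Definition hat_degree (n : nat) : nat := if n == 1%N then 1%N else n./2.

Variable P : @resolution A^c M.
Variables (phi : forall n, {linear P n -> Qr n}) (psi : forall n, {linear Qr n -> P n}).
Hypothesis phi_diff : forall n x, res_diff Qr n (phi n.+1 x) = phi n (res_diff P n x).
Hypothesis psi_diff : forall n x, res_diff P n (psi n.+1 x) = psi n (res_diff Qr n x).
Hypothesis phi_aug : forall x, res_aug Qr (phi 0%N x) = res_aug P x.
Hypothesis psi_aug : forall x, res_aug P (psi 0%N x) = res_aug Qr x.

Local Notation toQ := (transport phi_diff psi_diff).
Local Notation toP := (transport psi_diff phi_diff).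
Local Notation cls := (aproj (@null_homotopic K A M P)).

Lemma null_conj (R : @resolution A^c M) (r f : cendo R) :
  null_homotopic (r - 1) -> null_homotopic (r * f * r - f).
Proof.
move=> r1; have -> : r * f * r - f = r * f * (r - 1) + (r - 1) * f.
  by rewrite mulrBr mulrBl mulr1 mul1r addrA subrK.
by apply: null_homotopicD; [apply: null_homotopic_mull|apply: null_homotopic_mulr].
Qed.

Definition ecoord (y : Ext P) : {malg K[W]} := kappa (toQ (arepr y)).
Definition eelt (u : {malg K[W]}) : Ext P := cls (toP (sigma u)).

Lemma ecoordE f : ecoord (cls f) = kappa (toQ f).
Proof.
apply: kappa_eq; rewrite -transportB; apply: transport_null.
by apply/ext_eqP; rewrite areprK.
Qed.

Lemma ecoordK : cancel ecoord eelt.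
Proof.
move=> y; have [f <-] := aproj_surj y; rewrite ecoordE; apply/ext_eqP.
rewrite -(subrK (toP (toQ f)) (toP _)) -addrA; apply: null_homotopicD.
  by rewrite -opprB; apply: null_homotopicN; rewrite -transportB;
    apply/transport_null/sigma_kappa.
rewrite transport_roundtrip; apply: null_conj; exact: roundtrip_null.
Qed.

Lemma eeltK : cancel eelt ecoord.
Proof.
move=> u; rewrite ecoordE -[RHS]kappa_sigma; apply: kappa_eq.
by rewrite transport_roundtrip; apply: null_conj; apply: roundtrip_null.
Qed.

Lemma ecoordP a x y : ecoord (scal a * x + y) = a *: ecoord x + ecoord y.
Proof.
have [f <-] := aproj_surj x; have [g <-] := aproj_surj y; rewrite !ecoordE.
have -> : scal a * cls f + cls g = cls (cscal P a * f + g).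
  by rewrite rmorphD rmorphM.
by rewrite ecoordE transportD transportZ kappaP.
Qed.

Lemma ecoordM x y : ecoord (x * y) = bil mulJ (ecoord x) (ecoord y).
Proof.
have [f <-] := aproj_surj x; have [g <-] := aproj_surj y.
rewrite -rmorphM !ecoordE -kappaM; apply: kappa_eq.
have [u -> ->] := transport_mul phi_diff psi_diff f g.
rewrite -transportB; apply: transport_null.
have -> : f * g - f * roundtrip phi_diff psi_diff * g =
    - (f * (roundtrip phi_diff psi_diff - 1) * g).
  by rewrite mulrBr mulrBl mulr1 opprB.
apply/null_homotopicN/null_homotopic_mulr/null_homotopic_mull.
exact: roundtrip_null.
Qed.

Lemma ecoord1 : ecoord 1 = \sum_v << cver C v >>.
Proof.
rewrite -(rmorph1 cls) ecoordE -kappa_cone; apply: kappa_eq.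
have -> : toQ 1 = roundtrip psi_diff phi_diff by [].
exact: roundtrip_null.
Qed.

Lemma Ext_degP n y : @Ext_deg K A M P n y <-> supp_in (fun w => clvl w = n) (ecoord y).
Proof.
split=> [[f fn <-]|yn].
  rewrite ecoordE; apply/supp_in_coef => w wn; rewrite kappa_coef /kcoef.
  by rewrite /= fn ?linear0 ?ev0 // add0n; apply/eqP.
exists (toP (sigma (ecoord y))); last exact: ecoordK.
move=> i j x ij /=.
suff -> : sigma (ecoord y) i j (phi i x) = 0 by rewrite linear0.
rewrite /sigma big_seq; elim/big_rec: _ => [//|w f /yn wn f0].
rewrite [LHS](_ : _ = ccomp (cscal Qr (ecoord y)@_w) (lmapc w) i j (phi i x) + f i j (phi i x)) //.
rewrite f0 addr0 cscal_compl (_ : lmapc w i j _ = 0) ?scaler0 //.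
by apply: cval_inj; rewrite lmapE wn (negPf ij) linear0.
Qed.

Lemma hat_ExtP n y : hat (@Ext_deg K A M P) n y <->
  supp_in (fun w => hat_degree (clvl w) = n) (ecoord y).
Proof.
have ecoordD x z : ecoord (x + z) = ecoord x + ecoord z.
  by have := ecoordP 1 x z; rewrite rmorph1 mul1r scale1r.
have sumP (U V : set (Ext P)) S T z :
    (forall x, U x <-> supp_in S (ecoord x)) ->
    (forall x, V x <-> supp_in T (ecoord x)) ->
    sumset U V z <-> supp_in (fun w => S w \/ T w) (ecoord z).
  move=> US VT; split=> [[x /US xS [t /VT tT <-]]|zST].
    by rewrite ecoordD; apply: supp_inD => w; [move/xS; left|move/tT; right].
  (* The indicator of [S] serves as a degree, so that [piece] splits [z] into its part on [S] and
     the rest. *)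
  pose d w : nat := `[< S w >].
  exists (eelt (piece d 1 (ecoord z))).
    by apply/US; rewrite eeltK => w /piece_deg; rewrite /d; case: asboolP.
  exists (eelt (piece d 0 (ecoord z))).
    apply/VT; rewrite eeltK => w /(piece_supp zST)[[Sw|//]].
    by rewrite /d asboolT.
  apply: (can_inj ecoordK); rewrite ecoordD !eeltK; apply/malgP => w.
  rewrite mcoeffD !piece_coef /d; case: asboolP => _ /=; rewrite ?addr0 ?add0r //.
have weaken S T z : (forall w : W, S w <-> T w) ->
    supp_in S (ecoord z) <-> supp_in T (ecoord z).
  by move=> ST; split=> zS w /zS /ST.
case: n => [|[|n]] /=.
- rewrite Ext_degP; apply: weaken => w; rewrite /hat_degree.
  by case: (clvl w) => [|[|[]]].
- rewrite sumP; [|exact: Ext_degP|move=> x; apply: sumP; exact: Ext_degP].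
  apply: weaken => w; rewrite /hat_degree.
  case: (clvl w) => [|[|[|[|n]]]]; split=> //; try by move=> [|[]]; by [].
  + by left.
  + by right; left.
  + by right; right.
rewrite sumP; [|exact: Ext_degP|exact: Ext_degP].
apply: weaken => w; rewrite /hat_degree; case: eqP => [->|_]; first by split=> // -[].
split=> [[->|->]|wn].
- by rewrite /= doubleK.
- by rewrite /= uphalf_double.
by rewrite -(odd_double_half (clvl w)) wn; case: (odd _); [right|left].
Qed.

End ExtCoordinates.

(** * Koszulness of the hat-graded Ext algebra *)

(* The classes of degree 0, 1 and [n + 2] are indexed by the vertices, the    *)
(* arrows and the pairs [(i, n)], the latter leading from [sv i] to [sv (e i)]*)
(* or [sv (o i)], according to the parity of [n].                             *)
Section ExtCategory.
Variables (V Ar S : finType) (asrc atgt : Ar -> V) (sv : S -> V) (e o : S -> S).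
Hypothesis sv_inj : injective sv.
Hypothesis ee : forall i, e (e i) = e i.
Hypothesis eo : forall i, e (o i) = o i.
Hypothesis oe : forall i, o (e i) = o i.

Definition eclass : choiceType := (V + (Ar + S * nat))%type.

Notation Ver v := (inl v : eclass).
Notation Arr a := (inr (inl a) : eclass).
Notation Hi i n := (inr (inr (i, n)) : eclass).

Definition elvl (w : eclass) : nat :=
  match w with inl _ => 0%N | inr (inl _) => 1%N | inr (inr x) => x.2.+2 end.
Definition par (i : S) (n : nat) : S := if odd n then o i else e i.
Definition evtx (w : eclass) : V :=
  match w with inl v => v | inr (inl a) => atgt a | inr (inr x) => sv (par x.1 x.2) end.
Definition esrc (w : eclass) : V :=
  match w with inl v => v | inr (inl a) => asrc a | inr (inr x) => sv x.1 end.

(* [emul w2 w1] is [w1] followed by [w2]. *)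
Definition emul (w2 w1 : eclass) : option eclass :=
  match w2, w1 with
  | inl v, _ => if evtx w1 == v then Some w1 else None
  | _, inl v => if esrc w2 == v then Some w2 else None
  | inr (inr (j, m)), inr (inr (i, n)) =>
      if (j == par i n) && ~~ (odd m && odd n) then Some (Hi i (m + n).+2) else None
  | _, _ => None
  end.

Lemma emul_ver v w : emul (Ver v) w = if evtx w == v then Some w else None.
Proof. by case: w => [|[]]. Qed.

Lemma emul_idr v w : emul w (Ver v) = if esrc w == v then Some w else None.
Proof.
case: w => [u|[a|[i n]]] //=; rewrite eq_sym.
by case: eqP => // ->.
Qed.

Lemma par_par i m n : ~~ (odd m && odd n) -> par (par i n) m = par i (m + n).
Proof.
by rewrite /par oddD; case: (odd m) (odd n) => [] [] //= _; rewrite ?ee ?eo ?oe.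
Qed.

Lemma par2 i n : par i n.+2 = par i n.
Proof. by rewrite /par /= negbK. Qed.

Lemma emul_lvl w2 w1 w : emul w2 w1 = Some w -> elvl w = (elvl w2 + elvl w1)%N.
Proof.
case: w2 w1 => [v2|[a2|[j m]]] [v1|[a1|[i n]]] //=; case: ifP => // _ [<-] //=.
  by rewrite addn0.
by rewrite !addnS addSn.
Qed.

Lemma emul_vtx w2 w1 w : emul w2 w1 = Some w -> evtx w = evtx w2.
Proof.
case: w2 w1 => [v2|[a2|[j m]]] [v1|[a1|[i n]]] //=; case: ifP => //.
- by move=> /eqP <- [<-].
- by move=> /eqP <- [<-].
- by move=> /eqP <- [<-].
- by move=> _ [<-].
- by move=> _ [<-].
by move=> /andP[/eqP -> mn] [<-] /=; rewrite par2 par_par.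
Qed.

Lemma emul_src w2 w1 w : emul w2 w1 = Some w -> esrc w = esrc w1 /\ esrc w2 = evtx w1.
Proof.
case: w2 w1 => [v2|[a2|[j m]]] [v1|[a1|[i n]]] //=; case: ifP => //.
- by move=> /eqP <- [<-].
- by move=> /eqP <- [<-].
- by move=> /eqP <- [<-].
- by move=> /eqP <- [<-].
- by move=> /eqP <- [<-].
by move=> /andP[/eqP -> mn] [<-] /=.
Qed.

Lemma emul_hat w2 w1 w : emul w2 w1 = Some w ->
  hat_degree (elvl w) = (hat_degree (elvl w2) + hat_degree (elvl w1))%N.
Proof.
case: w2 w1 => [v2|[a2|[j m]]] [v1|[a1|[i n]]] //=; case: ifP => //.
- by move=> _ [<-].
- by move=> _ [<-].
- by move=> _ [<-].
- by move=> _ [<-].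
- by move=> _ [<-]; rewrite addn0.
move=> /andP[_ mn] [<-] /=; rewrite /hat_degree /= addnS addSn; congr _.+2.
by rewrite halfD (negPf mn).
Qed.

(** On three classes [Hi] both bracketings are nonzero exactly when the endpoints match and at most
    one of the three indices is odd. *)
Lemma emulA i j k : obind (emul^~ k) (emul i j) = obind (emul i) (emul j k).
Proof.
case: i => [v|w2].
  rewrite emul_ver; case: ifP => jv /=.
    case jk: (emul j k) => [l|//] /=.
    by rewrite (emul_vtx jk) jv.
  case jk: (emul j k) => [l|//] /=.
  by rewrite (emul_vtx jk) jv.
case: k => [v|w0].
  rewrite emul_idr; case jk: (emul _ j) => [l|]; rewrite /obind /oapp.
    by rewrite emul_idr (emul_src jk).1; case: ifP; rewrite ?jk.
  by case: ifP; rewrite ?jk.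
case: j => [v|w1].
  rewrite emul_ver emul_idr; case: eqP => [iv|iv]; case: eqP => [jv|jv] //=.
  - case ik: (emul (inr w2) (inr w0)) => [l|]; last by move: ik => /= ->.
    by case: jv; rewrite -iv; have [_ ->] := emul_src ik.
  - case ik: (emul (inr w2) (inr w0)) => [l|]; last by move: ik => /= ->.
    by case: iv; rewrite -jv; have [_ ->] := emul_src ik.
case: w2 w1 w0 => [a|[k l]] [b|[j m]] [c|[i n]] //=; try by case: ifP.
have [->|jv] := eqVneq j (par i n); last first.
  by case: ifP => //= _; rewrite (negPf jv).
rewrite /=; case: (boolP (odd m && odd n)) => /= [/andP[om on]|mn].
  case: ifP => // /andP[_]; rewrite om andbT => /negPf lm.
  by rewrite /= eqxx oddD lm om on.
rewrite par_par // par2; case: (k == _) => //=; rewrite negbK.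
have -> : ~~ (odd l && odd (m + n)) = ~~ (odd l && odd m) && ~~ (odd (l + m) && odd n).
  by rewrite !oddD; case: (odd l) (odd m) (odd n) mn => [] [] [].
case: (~~ (odd l && odd m)) => //=; rewrite eqxx /= negbK; case: ifP => // _.
by rewrite !addSn !addnS addnA.
Qed.

Variables (K : fieldType) (A : pzAlgType K).
Variables (coord : A -> {malg K[eclass]}) (elt : {malg K[eclass]} -> A).
Hypothesis coordK : cancel coord elt.
Hypothesis eltK : cancel elt coord.
Hypothesis coordP : forall a x y, coord (scal a * x + y) = a *: coord x + coord y.
Hypothesis coordM : forall x y, coord (x * y) = bil emul (coord x) (coord y).
Hypothesis coord1 : coord 1 = \sum_v << Ver v >>.

Definition edeg (w : eclass) : nat := hat_degree (elvl w).

Fact emulP i j k : emul i j = Some k ->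
  [/\ evtx k = evtx i, esrc k = esrc j, esrc i = evtx j & edeg k = (edeg i + edeg j)%N].
Proof.
by move=> ij; rewrite (emul_vtx ij) /edeg (emul_hat ij); have [-> ->] := emul_src ij.
Qed.

Fact edeg0 i : edeg i = 0%N -> i = Ver (evtx i).
Proof. by case: i => [v|[a|[i n]]]. Qed.

(** A product in Ext composes its right factor first. For left-to-right reading, the source of a
    class is therefore its end [evtx], and its target is [esrc]. *)
Definition ebased : based A :=
  Based (bid := fun v => Ver v) (bdeg := edeg) coordK eltK coordP coordM coord1
    emulA emul_ver emul_idr emulP (fun=> erefl) (fun=> erefl) (fun=> erefl) edeg0.

(* Words in the classes of degree 1, the last letter first. *)
Definition eword : choiceType := (V * seq eclass)%type.

Definition isarr (l : eclass) : bool := if l is inr (inl _) then true else false.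
Definition isx (l : eclass) : bool := if l is inr (inr (_, 0%N)) then true else false.
Definition headx (s : seq eclass) : bool := if s is l :: _ then isx l else false.
Definition wend (v : V) (s : seq eclass) : V := if s is l :: _ then esrc l else v.
(** Each letter and its left neighbour must form a leading monomial. Among composable pairs this
    excludes only a left factor [Hi _ 0] with a right factor [Hi _ 0] or [Hi _ 1]: those products
    are normal words for [Hi _ 2] and [Hi _ 3]. *)
Fixpoint okw (v : V) (s : seq eclass) : bool :=
  if s is l :: u then [&& edeg l == 1%N, evtx l == wend v u, okw v u & headx u ==> isarr l]
  else true.

Local Notation WE := (eword * eclass)%type.
Local Notation dot x l := (bil (@fact _ _ ebased eword) (x : {malg K[WE]}) << l >>).

(* In hat-degree 1, [Hi i 0] and [Hi i 1] are letters with the quadratic      *)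
(* relation [Hi (e i) 1 * Hi i 0 = Hi i 3 = Hi (o i) 0 * Hi i 1], whose first *)
(* side is the leading term; [wcor] is the corresponding correction of the    *)
(* monomial differential.                                                     *)
Definition wcor (v : V) (l : eclass) (u : seq eclass) : {malg K[WE]} :=
  match l, u with
  | inr (inr (i, 0%N)), inr (inr (j, 1%N)) :: t => << ((v, Hi (o j) 0 :: t), Hi i 1) >>
  | _, _ => 0
  end.

Definition wbd (w : eword) : {malg K[WE]} :=
  if w.2 is l :: u then << ((w.1, u), l) >> - wcor w.1 l u else 0.

(** The leftmost letter of the normal word of the coefficient is moved to the end of the cell,
    provided that it forms a leading monomial with the last letter there. The normal word of
    [Hi i n'.+2] begins with [Hi (par i n') 0]. *)
Definition whom (b : WE) : {malg K[WE]} :=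
  let: (v, s, l) := b in
  match l with
  | inl _ => 0
  | inr (inl a) => << ((v, l :: s), Ver (asrc a)) >>
  | inr (inr (i, n)) =>
      if headx s then 0 else
      if n is n'.+2 then << ((v, Hi (par i n') 0 :: s), Hi i n') >>
      else << ((v, l :: s), Ver (sv i)) >>
  end.

Local Notation wcell := (cell (B := ebased) (fun w : eword => okw w.1 w.2)
  (fun w : eword => size w.2) (fun w : eword => wend w.1 w.2)).

Lemma dotU (w : eword) (l m : eclass) :
  dot << (w, l) >> m = opb (omap (pair w) (emul l m)).
Proof. exact: bilUU. Qed.

Lemma dotB (x y : {malg K[WE]}) m : dot (x - y) m = dot x m - dot y m.
Proof. by rewrite -[- y]scaleN1r addrC bilPl scaleN1r addrC. Qed.

Lemma dot0 m : dot 0 m = 0.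
Proof. exact: bil0l. Qed.

Lemma wcorP v i j t : wcor v (Hi i 0) (Hi j 1 :: t) = << ((v, Hi (o j) 0 :: t), Hi i 1) >>.
Proof. by []. Qed.

Lemma wbd_supp n (w : eword) : okw w.1 w.2 -> size w.2 = n.+1 ->
  supp_in (fun b : WE => [/\ wcell n b, (0 < edeg b.2)%N & (n + edeg b.2 = n.+1)%N]) (wbd w).
Proof.
case: w => v [//|l u] /= /and4P[/eqP l1 /eqP lu uok ul] [un]; rewrite /wbd /=.
apply: supp_inB; first by apply: supp_inU; rewrite /= l1 addn1; split=> //; split=> //=; rewrite lu.
case: l l1 lu {ul} => [v'|[a|[i [|n']]]] _ lu; try exact: supp_in0.
case: u un uok lu => [|[v'|[a|[j [|[|m]]]]] t] tn uok lu; try exact: supp_in0.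
move: tn uok lu => /= tn /and3P[/eqP jt tok tj] /sv_inj ij; apply: supp_inU; split=> //=; last by rewrite addn1.
split=> //=; last by rewrite /par /= -ij oe.
rewrite /par /= eo -jt eqxx tok /=.
by case: (headx t) tj.
Qed.

Lemma whom_supp n (b : WE) : wcell n b -> supp_in (wcell n.+1) (whom b).
Proof.
case: b => [[v s] l] [/= sok sn sl]; rewrite /whom.
case: l sl => [u|[a|[i n']]] /= sl; first exact: supp_in0.
  apply: supp_inU; split=> //=; last by rewrite sn.
  by rewrite sl eqxx sok implybT.
case: ifP => [_|hs]; first exact: supp_in0.
case: n' sl => [|[|n']] /= sl; apply: supp_inU; split=> //=; rewrite ?sn // hs sok sl.
- by rewrite eqxx.
- by rewrite eqxx.
by rewrite par2 /par /=; case: ifP; rewrite ?ee ?eo ?eqxx.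
Qed.

Lemma wcor_id v l u : dot (wcor v l u) (Ver (wend v [:: l])) = wcor v l u.
Proof.
case: l => [w|[a|[i [|n]]]] /=; rewrite ?dot0 //.
by case: u => [|[w|[a|[j [|[|m]]]]] t]; rewrite ?dot0 // dotU /= eqxx.
Qed.

Lemma dot_wbd v l u m : dot (wbd (v, l :: u)) m =
  opb (omap (pair (v, u)) (emul l m)) - dot (wcor v l u) m.
Proof. by rewrite -dotU -dotB. Qed.

(** The coefficient in the correction is the odd class [Hi i 1], whose product with an arrow or
    another odd class is 0. *)
Lemma wcor_annihil v l u w : (if w is inr (inr (_, n)) then odd n else isarr w) ->
  dot (wcor v l u) w = 0.
Proof.
case: l => [x|[a|[i [|n]]]]; rewrite /wcor ?dot0 //.
case: u => [|[x|[a|[j [|[|m]]]]] t]; rewrite ?dot0 //.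
case: w => [//|[a|[k n]]]; rewrite dotU //= => ->.
by rewrite andbF.
Qed.

Lemma wbd_arrow v s a : okw v s -> dot (wbd (v, s)) (Arr a) = 0.
Proof.
case: s => [_|l u /and4P[/eqP l1 _ _ _]]; first exact: dot0.
rewrite dot_wbd wcor_annihil // subr0; case: l l1 => [//|[b|[i n]]] _ //.
Qed.

Lemma wbdK (w : eword) : okw w.1 w.2 -> mlift (B := ebased) wbd (wbd w) = 0.
Proof.
case: w => v [|l u] wok; first exact: mlift0.
have [l1 lu uok ul] : [/\ edeg l == 1%N, evtx l == wend v u, okw v u & headx u ==> isarr l].
  exact: and4P wok.
have -> : mlift (B := ebased) wbd (wbd (v, l :: u)) =
    dot (wbd (v, u)) l - mlift (B := ebased) wbd (wcor v l u).
  have <- : mlift (B := ebased) wbd << ((v, u), l) >> = dot (wbd (v, u)) l by rewrite mliftU.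
  exact: raddfB.
have [la|la] := boolP (isarr l).
  by case: l la {wok l1 lu ul} => [//|[a|//]] _; rewrite wbd_arrow // mlift0 subrr.
have hu : headx u = false by apply: contraNF la; move: ul => /implyP.
case: l l1 la lu {wok ul} => [//|[//|[i n]]] l1 _ lu.
case: u uok lu hu => [|k t] uok lu kx.
  have -> : wcor v (Hi i n) [::] = 0 by case: (n).
  by rewrite mlift0 subr0; apply: dot0.
have [k1 kt tok tk] : [/\ edeg k == 1%N, evtx k == wend v t, okw v t & headx t ==> isarr k].
  exact: and4P uok.
case: k k1 kx lu kt tk {uok} => [//|[b|[j [//|[|m]]]]] k1 _ lu kt tk; last by [].
  have -> : wcor v (Hi i n) (Arr b :: t) = 0 by case: (n).
  have c0 : wcor v (Arr b) t = 0 by [].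
  have e0 : emul (Arr b) (Hi i n) = None by [].
  rewrite mlift0 subr0 dot_wbd e0 c0.
  by rewrite dot0 subr0.
have c0 : wcor v (Hi j 1) t = 0 by [].
rewrite dot_wbd c0 dot0 subr0.
case: n l1 lu => [|[|n]] l1 lu; last by [].
  have ij : e i = j := sv_inj (eqP lu).
  rewrite wcorP mliftU [((_, _), _).1]/= [((_, _), _).2]/= dot_wbd wcor_annihil // subr0.
  (* The leading monomial and its correction are two expressions of the same class [Hi i 3], so they
     cancel. *)
  have -> : emul (Hi j 1) (Hi i 0) = Some (Hi i 3) by rewrite /= /par /= ij eqxx.
  have -> : emul (Hi (o j) 0) (Hi i 1) = Some (Hi i 3) by rewrite /= /par /= -ij oe eqxx.
  exact: subrr.
have -> : emul (Hi j 1) (Hi i 1) = None by rewrite /= andbF.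
have -> : wcor v (Hi i 1) (Hi j 1 :: t) = 0 by [].
by rewrite mlift0 subrr.
Qed.

(** The cell of the correction ends in a letter [Hi _ 0]. Multiplied by [m], its coefficient is 0 or
    some [Hi], and there [whom] is 0. *)
Lemma wcor_whom v l u m : lin whom (dot (wcor v l u) m) = 0.
Proof.
have dot_headx i j t : lin whom (dot << ((v, Hi j 0 :: t), Hi i 1) >> m) = 0.
  rewrite dotU; case: m => [w|[a|[k n]]] /=.
  - by case: ifP => _; rewrite ?linear0 // linU.
  - by rewrite linear0.
  by case: ifP => _; rewrite ?linear0 // linU.
case: l => [w|[a|[i [|n]]]]; rewrite /wcor ?dot0 ?linear0 //.
case: u => [|[w|[a|[j [|[|k]]]]] t]; rewrite ?dot0 ?linear0 //.
Qed.

Lemma whomP n (b : WE) : wcell n b ->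
  mlift (B := ebased) wbd (whom b) + lin whom (mlift (B := ebased) wbd << b >>) =
  if (size b.1.2 == 0%N) && (edeg b.2 == 0%N) then 0 else << b >>.
Proof.
case: b => [[v s] l] [/= sok sn sl]; rewrite mliftU [_.1]/= [_.2]/=.
have hom_bd : lin whom (dot (wbd (v, s)) l) =
    if s is k :: t then lin whom (opb (omap (pair (v, t)) (emul k l))) else 0.
  case: s {sok sn sl} => [|k t]; rewrite /wbd /=; first by rewrite dot0 linear0.
  by rewrite dotB linearB /= wcor_whom subr0 dotU.
rewrite hom_bd {hom_bd}; case: l sl => [u|[a|[i m]]] sl.
- rewrite mlift0 add0r; case: s sok sn sl => [//|k t] /= /and4P[k1 kt tok tk] _ ku.
  rewrite emul_idr ku eqxx /= linU.
  case: k k1 {kt} tk ku => [//|[a|[i [|[|m]]]]] //= _ tk <- //.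
  + by have -> : headx t = false by case: (headx t) tk.
  + by have -> : headx t = false by case: (headx t) tk.
- rewrite mliftU /= andbF {1}/wbd /= subr0 dotU /= eqxx.
  case: s sok {sn sl} => [|k t] /=; first by rewrite addr0.
  by move=> /and4P[k1 _ _ _]; case: k k1 => [//|[c|[i [|[|m]]]]] //= _; rewrite linear0 addr0.
have -> : (size s == 0%N) && (edeg (Hi i m) == 0%N) = false by rewrite andbF.
(* When the last letter of the cell is [Hi _ 0], the homotopy vanishes on the element itself; the
   differential multiplies this letter into the coefficient, and the homotopy takes it out again. *)
have [hs|hs] := boolP (headx s).
  rewrite mlift0 add0r.
  case: s hs sok sn sl => [//|[//|[//|[j [|//]]]] t] _ /= /and3P[_ _ tk] _ /sv_inj ->.
  have ht : headx t = false by case: (headx t) tk.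
  by rewrite eqxx /= linU /= ht add0n /par; case: (odd m).
have s_cases : (if s is k :: t then isarr k \/ exists2 j, k = Hi j 1 & headx t = false
    else True).
  case: s sok hs {sn sl} => [//|[w|[a|[j [|[|k]]]]] t] //= tk _; first by left.
  right; exists j => //; case/and3P: tk => _ _.
  by case: (headx t).
case: s hs sok sn sl s_cases => [|k t] hs sok sn sl s_cases.
  rewrite addr0; case: m sl => [|[|m]] sl; rewrite mliftU /wbd /= subr0 dotU /=.
  - by rewrite eqxx.
  - by rewrite eqxx.
  by rewrite eqxx.
case: s_cases => [karr|[j kE ht]].
  case: k karr hs sok sn sl => [//|[a|//]] _ hs sok sn sl.
  rewrite linear0 addr0; case: m sl => [|[|m]] sl; rewrite mliftU /wbd /= subr0 dotU /=.
  - by rewrite eqxx.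
  - by rewrite eqxx.
  by rewrite eqxx.
(* The remaining case has last letter [Hi j 1]. If the coefficient begins with [Hi _ 0], the
   correction of the differential appears in d h and is cancelled by h d. *)
rewrite {k}kE in hs sok sn sl *; move: sl => /= /sv_inj ->.
set j' := par i m.
case: m @j' => [|[|m]] j'; rewrite mliftU [((_, _), _).1]/= [((_, _), _).2]/= dot_wbd.
- rewrite wcor_id emul_idr [esrc _]/= eqxx [opb _]/= wcorP.
  rewrite eqxx [opb _]/= linU /whom ht; have -> : o j' = par i 1 by rewrite /j' /par /= oe.
  exact: subrK.
- have -> : wcor v (Hi i 1) (Hi j' 1 :: t) = 0 by [].
  rewrite emul_idr [esrc _]/= eqxx dot0 subr0 andbF [opb (omap _ None)]/= linear0.
  exact: addr0.
have -> : emul (Hi (par i m) 0) (Hi i m) = Some (Hi i m.+2) by rewrite /= eqxx.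
rewrite wcorP dotU eqxx andTb.
have -> : emul (Hi (par i m) 1) (Hi i m) = if odd m then None else Some (Hi i m.+3).
  by rewrite /= eqxx if_neg.
have -> : odd m.+2 = odd m by rewrite /= negbK.
case: (boolP (odd m)) => om.
  by transitivity (opb (omap (pair (v, Hi j' 1 :: t)) (Some (Hi i m.+2))) - 0 + 0 : {malg K[WE]});
    [congr (_ + _); apply: linear0|rewrite addr0; apply: subr0].
have -> : o j' = par i m.+3 by rewrite /j' /par /= negbK (negPf om) oe.
rewrite linU /whom ht; exact: subrK.
Qed.

Fact wverP (w : eword) : okw w.1 w.2 -> size w.2 = 0%N -> w = (wend w.1 w.2, [::]).
Proof. by case: w => v [|]. Qed.

Fact wbd0 (w : eword) : size w.2 = 0%N -> wbd w = 0.
Proof. by case: w => v [|]. Qed.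

Definition wcellular : cellular ebased :=
  @Cellular K A ebased eword (fun w => okw w.1 w.2) (fun w => size w.2)
    (fun w => wend w.1 w.2) (fun v => (v, [::])) id wbd whom (fun=> isT) (fun=> erefl)
    (fun=> erefl) wverP erefl wbd0 wbd_supp whom_supp wbdK whomP.

Lemma ext_koszul (gr : nat -> set A) :
  (forall n x, gr n x <-> supp_in (fun w => edeg w = n) (coord x)) -> koszul gr.
Proof.
move=> grE; pose grE' : forall n (x : A), gr n x <->
  supp_in (fun i => bdeg i = n) (bcoord ebased x) := grE.
split; [exact: based_graded grE'|exact: based_split grE'|].
exact: (cellular_generated wcellular grE').
Qed.

End ExtCategory.

(** * A basis of Lambda *)

(* The nonzero path classes of [Lambda]: [(s, l)] is the class of the path of *)
(* length [l] that starts at the vertex [s], through [alpha_1] if [s = 1];    *)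
(* [(0, l)], [1 <= l <= 5], stands for the beginning of the path through      *)
(* [alpha_7]. Vertices and arrows are numbered from 1 here.                   *)
Definition nxt (s : nat) : nat :=
  nth 0%N [:: 7; 2; 3; 4; 5; 6; 12; 8; 9; 10; 11; 12; 13; 14; 15; 16; 17; 12]%N s.
Definition lmax (s : nat) : nat :=
  nth 0%N [:: 5; 7; 6; 5; 6; 5; 6; 6; 5; 6; 5; 6; 5; 6; 5; 6; 5; 6]%N s.
Definition okI (x : nat * nat) : bool :=
  [&& (x.1 <= 17)%N, (x.2 <= lmax x.1)%N & (x.1 != 0%N) || (x.2 != 0%N)].
Definition srcn (x : nat * nat) : nat := if x.1 == 0%N then 1%N else x.1.
Definition endn (x : nat * nat) : nat := iter x.2 nxt x.1.
(** A path through [alpha_7] that reaches length 6 contains one side of the commutativity relation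
    and is renamed to the path through [alpha_1]. *)
Definition cmul (x y : nat * nat) : option (nat * nat) :=
  if endn x != srcn y then None
  else if x.2 == 0%N then Some y
  else if y.2 == 0%N then Some x
  else let z := (if (x.1 == 0%N) && (5 < x.2 + y.2)%N then 1%N else x.1, (x.2 + y.2)%N) in
       if okI z then Some z else None.
(** The number of the first arrow of a path coded by [s]; [acode] codes an arrow in turn as a path
    of length 1. *)
Definition anum (s : nat) : nat := if s == 0%N then 7%N else if (s <= 6)%N then s else s.+1.
Definition acode (k : nat) : nat * nat :=
  (if (k <= 6)%N then k else if k == 7%N then 0%N else k.-1, 1%N).
Definition pathn (x : nat * nat) : seq nat := map anum (traject nxt x.1 x.2).

Definition allI : seq (nat * nat) :=
  [seq x <- [seq (s, l) | s <- iota 0 18, l <- iota 0 8] | okI x].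

Lemma allIP x : okI x = (x \in allI).
Proof.
rewrite mem_filter; case: x => s l; case ok: (okI _) => //=.
suff -> : (s, l) \in [seq (s, l) | s <- iota 0 18, l <- iota 0 8] by [].
have [/andP[s17 lm] _] : (s <= 17)%N && (l <= lmax s)%N /\ True.
  by split=> //; move: ok => /and3P[-> ->].
apply/allpairsP; exists (s, l); split=> //; rewrite mem_iota add0n ltnS //.
by apply: leq_trans lm _; move: s s17 {ok}; do 18!case=> //.
Qed.

(** The basis is finite, so statements about it are decided by running through [allI]. *)
Lemma forallI (p : pred (nat * nat)) : all p allI -> forall x, okI x -> p x.
Proof. by move=> /allP ap x; rewrite allIP => /ap. Qed.

Definition basis : choiceType := {x : nat * nat | okI x}.

Lemma forall_basis (p : pred (nat * nat)) : all p allI -> forall i : basis, p (val i).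
Proof. by move=> ap i; apply: forallI => //; apply: valP. Qed.

Lemma forall_basis2 (p : rel (nat * nat)) :
  all (fun x => all (p x) allI) allI -> forall i j : basis, p (val i) (val j).
Proof.
move=> ap i j; move: j; apply: forall_basis.
exact: (forall_basis (p := fun x => all (p x) allI)).
Qed.

Lemma cmul_ok (i j : basis) : if cmul (val i) (val j) is Some z then okI z else true.
Proof.
by apply: (forall_basis2 (p := fun x y => if cmul x y is Some z then okI z else true));
  vm_compute.
Qed.

Definition mulI (i j : basis) : option basis := obind insub (cmul (val i) (val j)).

Lemma mulI_val i j : omap val (mulI i j) = cmul (val i) (val j).
Proof.
rewrite /mulI; have := cmul_ok i j; case: (cmul _ _) => [z|//] /= zok.
by rewrite insubT.
Qed.

Lemma omap_val_inj : injective (omap (val : basis -> _)).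
Proof. by move=> [x|] [y|] //= [] xy; congr Some; apply: val_inj. Qed.

Lemma cmul_props (i j : basis) : if cmul (val i) (val j) is Some z then
   [&& srcn z == srcn (val i), endn z == endn (val j), endn (val i) == srcn (val j)
     & z.2 == (val i).2 + (val j).2]%N else true.
Proof.
by apply: (forall_basis2 (p := fun x y => if cmul x y is Some z then
  [&& srcn z == srcn x, endn z == endn y, endn x == srcn y & z.2 == x.2 + y.2]%N else true));
  vm_compute.
Qed.

Lemma srcn_bound (i : basis) : (0 < srcn (val i) <= 17)%N.
Proof. by apply: (forall_basis (p := fun x => 0 < srcn x <= 17)%N); vm_compute. Qed.

Lemma endn_bound (i : basis) : (0 < endn (val i) <= 17)%N.
Proof. by apply: (forall_basis (p := fun x => 0 < endn x <= 17)%N); vm_compute. Qed.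

Definition srcI (i : basis) : 'I_17 := inord (srcn (val i)).-1.
Definition tgtI (i : basis) : 'I_17 := inord (endn (val i)).-1.

Lemma srcIE i : (srcI i).+1 = srcn (val i).
Proof. by have /andP[h0 h1] := srcn_bound i; rewrite /srcI inordK prednK. Qed.

Lemma tgtIE i : (tgtI i).+1 = endn (val i).
Proof. by have /andP[h0 h1] := endn_bound i; rewrite /tgtI inordK prednK. Qed.

Fact idI_subproof (v : 'I_17) : okI (v.+1, 0%N).
Proof. by rewrite /okI /= ltn_ord. Qed.
Definition idI (v : 'I_17) : basis := Sub (v.+1, 0%N) (idI_subproof v).

Lemma mulIP i j k : mulI i j = Some k ->
  [/\ srcI k = srcI i, tgtI k = tgtI j, tgtI i = srcI j
    & (val k).2 = ((val i).2 + (val j).2)%N].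
Proof.
move=> /(congr1 (omap val)); rewrite mulI_val /= => ij.
have := cmul_props i j; rewrite ij => /and4P[/eqP s /eqP t /eqP st /eqP d].
by split=> //; apply/val_inj/succn_inj; rewrite /= ?srcIE ?tgtIE.
Qed.

Lemma mulI_idl v i : mulI (idI v) i = if srcI i == v then Some i else None.
Proof.
apply: omap_val_inj; rewrite mulI_val /cmul /= -srcIE eqSS val_eqE eq_sym.
by case: eqP.
Qed.

Lemma mulI_idr v i : mulI i (idI v) = if tgtI i == v then Some i else None.
Proof.
apply: omap_val_inj; rewrite mulI_val /cmul {1}/srcn /= -tgtIE eqSS val_eqE.
case: eqP => //= vi; case: eqP => // i0; congr Some.
have : val i = (endn (val i), 0%N).
  by rewrite /endn i0 /=; case: (val i) i0 => s l /= ->.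
by rewrite -tgtIE vi => ->.
Qed.

Lemma mulIA i j k : obind (mulI^~ k) (mulI i j) = obind (mulI i) (mulI j k).
Proof.
apply: omap_val_inj.
have E1 : omap val (obind (mulI^~ k) (mulI i j)) =
    obind (cmul^~ (val k)) (cmul (val i) (val j)).
  by rewrite -mulI_val; case: (mulI i j) => //= l; rewrite mulI_val.
have E2 : omap val (obind (mulI i) (mulI j k)) =
    obind (cmul (val i)) (cmul (val j) (val k)).
  by rewrite -mulI_val; case: (mulI j k) => //= l; rewrite mulI_val.
rewrite E1 E2; have [ij|ij] := eqVneq (endn (val i)) (srcn (val j)); last first.
  have -> : cmul (val i) (val j) = None by rewrite /cmul ij.
  have := cmul_props j k; case: (cmul (val j) _) => //= z /and4P[/eqP zj _ _ _].
  by rewrite /cmul zj ij.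
have [jk|jk] := eqVneq (endn (val j)) (srcn (val k)); last first.
  have -> : cmul (val j) (val k) = None by rewrite /cmul jk.
  have := cmul_props i j; case: (cmul (val i) _) => //= z /and4P[_ /eqP zj _ _].
  by rewrite /cmul zj jk.
(* Only composable triples remain; the guards keep the enumeration of triples short. *)
pose p x y := (endn x == srcn y) ==> all (fun z =>
  (endn y == srcn z) ==> (obind (cmul^~ z) (cmul x y) == obind (cmul x) (cmul y z))) allI.
have : p (val i) (val j) by apply: forall_basis2; vm_compute.
rewrite /p ij eqxx => /allP /(_ (val k)); rewrite -allIP (valP k) jk eqxx.
by move=> /(_ isT)/eqP.
Qed.

Lemma srcI_id v : srcI (idI v) = v.
Proof. by apply/val_inj/succn_inj; rewrite srcIE. Qed.

Lemma tgtI_id v : tgtI (idI v) = v.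
Proof. by apply/val_inj/succn_inj; rewrite tgtIE. Qed.

Lemma deg0I (i : basis) : (val i).2 = 0%N -> i = idI (srcI i).
Proof.
move=> i0; apply: val_inj; rewrite /= srcIE; have /and3P[_ _] := valP i.
rewrite i0 orbF /srcn => /negPf ->.
by rewrite [LHS]surjective_pairing i0.
Qed.

(** * Evaluation of paths and normal forms modulo the relations *)

Section LambdaBasis.
Variable K : fieldType.
Local Notation PA := (pathalg exQ K).
Local Notation path := (qpath exQ).

Fact arrI_subproof (a : 'I_18) : okI (acode a.+1).
Proof. by case: a; do 18!case=> //. Qed.
Definition arrI (a : 'I_18) : basis := Sub (acode a.+1) (arrI_subproof a).

Lemma forall_arr (p : pred nat) : all p (iota 0 18) -> forall a : 'I_18, p a.
Proof. by move=> /allP ap a; apply: ap; rewrite mem_iota /= ltn_ord. Qed.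

Lemma src_arrI (a : 'I_18) : srcI (arrI a) = src (a : arr exQ).
Proof.
apply: val_inj; rewrite /= /srcI !inordK /=.
- by apply/eqP; apply: (forall_arr (p := fun a =>
    (srcn (acode a.+1)).-1 == (nth 0%N src_tab a).-1)%N).
- by apply: (forall_arr (p := fun a => (nth 0%N src_tab a).-1 < 17)%N).
by apply: (forall_arr (p := fun a => (srcn (acode a.+1)).-1 < 17)%N).
Qed.

Lemma tgt_arrI (a : 'I_18) : tgtI (arrI a) = tgt (a : arr exQ).
Proof.
apply: val_inj; rewrite /= /tgtI !inordK /=.
- by apply/eqP; apply: (forall_arr (p := fun a =>
    (endn (acode a.+1)).-1 == (nth 0%N tgt_tab a).-1)%N).
- by apply: (forall_arr (p := fun a => (nth 0%N tgt_tab a).-1 < 17)%N).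
by apply: (forall_arr (p := fun a => (endn (acode a.+1)).-1 < 17)%N).
Qed.

Fixpoint evs (v : 'I_17) (s : seq 'I_18) : option basis :=
  if s is a :: s' then obind (mulI (arrI a)) (evs (tgt (a : arr exQ)) s')
  else Some (idI v).
Definition evp (p : path) : option basis := evs (qstart p) (qarrows p).

Lemma evs_props v s i : walk (Q := exQ) v s -> evs v s = Some i ->
  [/\ srcI i = v, tgtI i = last v (map (@tgt exQ) s) & (val i).2 = size s].
Proof.
elim: s v i => [|a s IHs] v i /=.
  by move=> _ [<-]; rewrite srcI_id tgtI_id.
case/andP=> /eqP <- sw; case se: (evs _ s) => [j|//] /= /mulIP[-> -> _ ->].
have [_ -> ->] := IHs _ _ sw se.
by rewrite src_arrI.
Qed.

Lemma evs_cat v s t : walk (Q := exQ) v (s ++ t) ->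
  evs v (s ++ t) = obind (fun i => obind (mulI i) (evs (last v (map (@tgt exQ) s)) t)) (evs v s).
Proof.
elim: s v => [|a s IHs] v /= => [tw|/andP[_ sw]].
  case vt: (evs v t) => [j|//] /=; have [jv _ _] := evs_props tw vt.
  by rewrite mulI_idl jv eqxx.
rewrite IHs //; case: (evs _ s) => [j|//] /=; case: (evs _ t) => [k|] /=.
  by rewrite -mulIA.
by case: (mulI _ j).
Qed.

Lemma evp_cat (p q : path) : qend p = qstart q ->
  obind evp (pcat p q) = obind (fun i => obind (mulI i) (evp q)) (evp p).
Proof.
move=> pq; have [r rE rval] := pcat_some pq; rewrite rE /= /evp.
have rs : qstart r = qstart p by rewrite /qstart rval.
have ra : qarrows r = qarrows p ++ qarrows q by rewrite /qarrows rval.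
rewrite rs ra evs_cat; first by rewrite -pq.
by rewrite walk_cat -/(qend p) pq; case: p {pq rE rs ra rval} => x xw; case: q => y yw;
  rewrite xw yw.
Qed.

Lemma evp_props (p : path) i : evp p = Some i ->
  [/\ srcI i = qstart p, tgtI i = qend p & (val i).2 = size (qarrows p)].
Proof. by apply: evs_props; case: p. Qed.

(* Evaluation of paths; its kernel is the ideal of relations. *)
Fact cls_key : unit. Proof. exact: tt. Qed.
Definition cls : PA -> {malg K[basis]} :=
  locked_with cls_key (lin (fun p : path => opb (evp p))).

Lemma clsP a (x y : {malg K[path]}) : cls (a *: x + y) = a *: cls x + cls y.
Proof. by rewrite /cls !unlock linearP. Qed.

Lemma cls0 : cls 0 = 0.
Proof. by rewrite /cls unlock; apply: linear0. Qed.

Lemma clsU p : cls << p >> = opb (evp p).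
Proof. by rewrite /cls unlock linU. Qed.

Lemma clsB x y : cls (x - y) = cls x - cls y.
Proof. by rewrite addrC -scaleN1r [LHS]clsP scaleN1r addrC. Qed.

Lemma clsD x y : cls (x + y) = cls x + cls y.
Proof. by rewrite -[x]scale1r [LHS]clsP !scale1r. Qed.

Lemma clsM x y : cls (x * y) = bil mulI (cls x) (cls y).
Proof.
rewrite -[x * y]/(pmul x y).
elim/malg_elim: x => [|a u v IHu IHv|p].
- by rewrite pmul0l cls0 bil0l.
- rewrite pmulDl pmulZl [LHS]clsP [in RHS]clsP bilPl.
  by apply: congr2 IHv; apply: congr1 IHu.
elim/malg_elim: y => [|a u v IHu IHv|q].
- by rewrite pmul0r cls0 bil0r.
- rewrite pmulDr pmulZr [LHS]clsP [in RHS]clsP bilPr.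
  by apply: congr2 IHv; apply: congr1 IHu.
have -> : cls (pmul << p >> << q >>) = opb (obind evp (pcat p q)).
  by rewrite pmulUU; case: (pcat p q) => [r|] /=; [exact: clsU|exact: cls0].
apply: etrans (esym (congr2 (bil mulI) (clsU p) (clsU q))).
have [pq|pq] := eqVneq (qend p) (qstart q).
  rewrite evp_cat //; case: (evp p) => [i|] /=; last by rewrite bil0l.
  by case: (evp q) => [j|] /=; rewrite ?bil0r ?bilUU.
rewrite pcat_none //=; case ip: (evp p) => [i|] /=; last by rewrite bil0l.
case jq: (evp q) => [j|] /=; last by rewrite bil0r.
rewrite bilUU; case ij: (mulI i j) => [k|//].
have [_ _ st _] := mulIP ij; have [_ it _] := evp_props ip.
by have [js _ _] := evp_props jq; move: pq; rewrite -it st js eqxx.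
Qed.

Lemma cls1 : cls 1 = \sum_v << idI v >>.
Proof.
rewrite -[1]/(pone exQ K) /pone.
rewrite (big_morph cls clsD cls0); apply: eq_bigr => v _.
exact: clsU.
Qed.

Lemma cls_alpha k : cls (alpha K k) = << arrI (inord k.-1) >>.
Proof.
rewrite clsU /evp /= mulI_idr.
by rewrite tgt_arrI eqxx.
Qed.

Definition vertex (v : 'I_17) : PA := << @triv exQ v >>.

Lemma cls_triv v : cls (vertex v) = << idI v >>.
Proof. exact: clsU. Qed.

Fixpoint evw (s : seq nat) : option (nat * nat) :=
  match s with
  | [::] => None
  | [:: k] => Some (acode k)
  | k :: s' => obind (cmul (acode k)) (evw s')
  end.

Definition arrow_range (s : seq nat) := all (fun k => 0 < k <= 18)%N s.

Lemma val_arrI k : (0 < k <= 18)%N -> val (arrI (inord k.-1)) = acode k.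
Proof. by case/andP=> k0 k18; rewrite /= inordK prednK. Qed.

Lemma cls_word s : s != [::] -> arrow_range s ->
  exists2 r, cls (word K s) = opb r & omap val r = evw s.
Proof.
elim: s => [//|k s IHs] _ /= /andP[kr sr]; rewrite /word big_cons clsM cls_alpha.
case: s IHs sr => [_ _|m s IHs sr].
  rewrite big_nil cls1; exists (Some (arrI (inord k.-1))); last first.
    by rewrite -(val_arrI kr).
  rewrite linear_sum (bigD1 (tgtI (arrI (inord k.-1)))) //= bilUU mulI_idr eqxx.
  by rewrite big1 ?addr0 // => v vk; rewrite bilUU mulI_idr eq_sym (negPf vk).
have [r] := IHs isT sr; rewrite /word => -> <-; exists (obind (mulI (arrI (inord k.-1))) r).
  by case: r => [i|]; rewrite ?bil0r ?bilUU.
by case: r => [i|] //=; rewrite -(val_arrI kr) -mulI_val.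
Qed.

Definition rel_words : seq (seq nat) :=
  [:: [:: 3; 4; 5; 6; 13; 14]; [:: 5; 6; 13; 14; 15; 16]; [:: 9; 10; 11; 12; 13; 14];
      [:: 11; 12; 13; 14; 15; 16]; [:: 13; 14; 15; 16; 17; 18];
      [:: 15; 16; 17; 18; 13; 14]; [:: 17; 18; 13; 14; 15; 16]]%N.
Definition top_word : seq nat := [:: 1; 2; 3; 4; 5; 6]%N.
Definition bot_word : seq nat := [:: 7; 8; 9; 10; 11; 12]%N.

Lemma ex_relationsE (x : PA) : ex_relations x <->
  x = word K top_word - word K bot_word \/ exists2 s, s \in rel_words & x = word K s.
Proof.
rewrite (_ : ex_relations x =
  (x \in word K top_word - word K bot_word :: map (word K) rel_words)) // in_cons.
split=> [/orP[/eqP|/mapP]|[->|/mapP h]]; [by left|by right|by rewrite eqxx|].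
by rewrite h orbT.
Qed.

Lemma cls_relations x : ex_relations x -> cls x = 0.
Proof.
case/ex_relationsE => [->|[s sP ->]].
  rewrite clsB; have [//|//|r -> rE] := @cls_word top_word.
  have [//|//|t -> tE] := @cls_word bot_word.
  have /omap_val_inj -> : omap val r = omap val t by rewrite rE tE; vm_compute.
  by rewrite subrr.
have sOK : [&& s != [::], arrow_range s & evw s == None].
  move: sP; rewrite !inE.
  by do 6![case/orP=> [/eqP ->|]; first by vm_compute] => /eqP ->; vm_compute.
case/and3P: sOK => s0 sr /eqP sN; have [r -> rE] := cls_word s0 sr.
by case: r rE => [i|//] /=; rewrite sN.
Qed.

Lemma cls_ideal x : ideal_gen (@ex_relations K) x -> cls x = 0.
Proof.
move=> xI; apply: (xI (fun x => cls x = 0)); last exact: cls_relations.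
split=> [|y z y0 z0|a b y y0]; first exact: cls0.
  by rewrite clsD y0 z0 addr0.
by rewrite !clsM y0 bil0r bil0l.
Qed.

(** The vertex in front is needed for paths of length 0, where the word is empty and denotes 1. *)
Definition rep (i : basis) : PA := vertex (srcI i) * word K (pathn (val i)).

Lemma path_range (i : basis) : arrow_range (pathn (val i)).
Proof. by apply: (forall_basis (p := fun x => arrow_range (pathn x))); vm_compute. Qed.

Lemma cls_rep i : cls (rep i) = << i >>.
Proof.
rewrite clsM cls_triv; case i0: ((val i).2 == 0%N).
  rewrite /pathn (eqP i0) /= /word big_nil cls1 linear_sum (bigD1 (srcI i)) //=.
  rewrite bilUU mulI_idl srcI_id eqxx big1 ?addr0 => [|v vi].
    by rewrite [in RHS](deg0I (eqP i0)).
  by rewrite bilUU mulI_idl srcI_id (negPf vi).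
have [||r -> rE] := @cls_word (pathn (val i)); [|exact: path_range|].
  by move: i0; rewrite /pathn; case: (val i) => s [].
have : (0 < (val i).2)%N ==> (evw (pathn (val i)) == Some (val i)).
  by apply: (forall_basis (p := fun x => (0 < x.2)%N ==> (evw (pathn x) == Some x)));
    vm_compute.
rewrite lt0n i0 /= -rE; case: r {rE} => [j|//] /eqP[/val_inj ->].
by rewrite bilUU mulI_idl eqxx.
Qed.

Local Notation I0 := (ideal_gen (@ex_relations K)).

Lemma I0_0 : I0 0.
Proof. by have [h _ _] := two_sided_ideal_gen (@ex_relations K). Qed.

Lemma I0D x y : I0 x -> I0 y -> I0 (x + y).
Proof. by have [_ h _] := two_sided_ideal_gen (@ex_relations K); apply: h. Qed.

Lemma I0M a b x : I0 x -> I0 (a * x * b).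
Proof. by have [_ _ h] := two_sided_ideal_gen (@ex_relations K); apply: h. Qed.

Lemma I0Ml a x : I0 x -> I0 (a * x).
Proof. by move=> Ix; rewrite -[a * x]mulr1; apply: I0M. Qed.

Lemma I0_trans x y z : I0 (x - y) -> I0 (y - z) -> I0 (x - z).
Proof. by move=> Ixy Iyz; rewrite -(subrK y x) -addrA; apply: I0D. Qed.

Lemma I0MB a x y : I0 (x - y) -> I0 (a * x - a * y).
Proof. by move=> Ixy; rewrite -mulrBr; apply: I0Ml. Qed.

Lemma I0Mr b x : I0 x -> I0 (x * b).
Proof. by move=> Ix; rewrite -[x]mul1r; apply: I0M. Qed.

Lemma I0Z a (x : PA) : I0 x -> I0 (a *: x).
Proof.
move=> Ix; rewrite (_ : a *: x = scal a * x); first exact: I0Ml.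
rewrite -[scal a * x]/(pmul (a *: pone exQ K) x) pmulZl.
by rewrite (pmul1l x).
Qed.

Lemma word_cat s t : word K (s ++ t) = word K s * word K t.
Proof. by rewrite /word big_cat. Qed.

Lemma word_cons k s : word K (k :: s) = alpha K k * word K s.
Proof. exact: big_cons. Qed.

Lemma vertex_arrow (a : 'I_18) : vertex (src (a : arr exQ)) * alpha K a.+1 = alpha K a.+1.
Proof.
rewrite -[_ * _]/(pmul _ _) /alpha inord_val pmulUU.
by rewrite (pcat_trivl (arrow (a : arr exQ))).
Qed.

Lemma arrow_vertex (a : 'I_18) : alpha K a.+1 * vertex (tgt (a : arr exQ)) = alpha K a.+1.
Proof.
rewrite -[_ * _]/(pmul _ _) /alpha inord_val pmulUU.
by rewrite (pcat_trivr (arrow (a : arr exQ))).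
Qed.

(** The rewriting step. An arrow in front of a normal path gives a normal path, or a path that
    begins with the side of the commutativity relation through [alpha_7], or one that begins with a
    monomial relation. *)
Lemma path_step (a : 'I_18) (i : basis) : srcI i = tgt (a : arr exQ) ->
  let s := a.+1 :: pathn (val i) in
  if cmul (acode a.+1) (val i) is Some z then
    (s == pathn z) || ((s == bot_word ++ drop 6 s) && (pathn z == top_word ++ drop 6 s))
  else take 6 s \in rel_words.
Proof.
move=> ia /=; pose p a x := let s := a.+1 :: pathn x in
  (endn (acode a.+1) == srcn x) ==> if cmul (acode a.+1) x is Some z then
    (s == pathn z) || ((s == bot_word ++ drop 6 s) && (pathn z == top_word ++ drop 6 s))
  else take 6 s \in rel_words.
have : p a (val i).
  apply: (forall_basis (p := p a)); apply: (forall_arr (p := fun a => all (p a) allI)).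
  by vm_compute.
by rewrite /p -srcIE ia -tgt_arrI tgtIE eqxx.
Qed.

Lemma alpha_rep (a : 'I_18) (i : basis) : srcI i = tgt (a : arr exQ) ->
  I0 (alpha K a.+1 * rep i - (if mulI (arrI a) i is Some j then rep j else 0)).
Proof.
move=> ia.
have -> : alpha K a.+1 * rep i = word K (a.+1 :: pathn (val i)).
  have -> : rep i = vertex (tgt (a : arr exQ)) * word K (pathn (val i)) by rewrite /rep ia.
  apply: etrans (mulrA _ _ _) _; apply: etrans (esym (word_cons _ _)).
  exact: (congr1 (fun z => z * word K (pathn (val i))) (arrow_vertex a)).
have := path_step ia; rewrite -[acode _]/(val (arrI a)) -mulI_val /=.
case ai: (mulI (arrI a) i) => [j|] /=; last first.
  move=> sR; rewrite subr0 -(cat_take_drop 6 (_ :: _)) word_cat; apply: I0Mr.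
  by apply: sub_ideal_gen; apply/ex_relationsE; right; exists (take 6 (a.+1 :: pathn (val i))).
have [js _ _ _] := mulIP ai; rewrite /rep js src_arrI.
have vw (b : 'I_18) t : vertex (src (b : arr exQ)) * word K (b.+1 :: t) = word K (b.+1 :: t).
  apply: etrans (congr1 _ (word_cons _ _)) _; apply: etrans (mulrA _ _ _) _.
  apply: etrans (esym (word_cons _ _)).
  exact: (congr1 (fun z => z * word K t) (vertex_arrow b)).
case/orP=> [/eqP <-|]; first by rewrite vw subrr; apply: I0_0.
case/andP=> /eqP sE /eqP ->; move: (drop 5 (pathn (val i))) sE => r sE.
(* Arrows are counted from 0 here, so this is [alpha_7]. *)
have a6 : a = 6%N :> nat by case: sE.
rewrite sE; have -> : vertex (src (a : arr exQ)) * word K (top_word ++ r) =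
    word K (top_word ++ r).
  have -> : src (a : arr exQ) = src (inord 0 : arr exQ).
    by apply: val_inj; rewrite /= a6 !inordK.
  have -> : top_word ++ r = (inord 0 : 'I_18).+1 :: behead top_word ++ r by rewrite inordK.
  exact: vw.
have -> : word K (bot_word ++ r) - word K (top_word ++ r) =
    -1 * (word K top_word - word K bot_word) * word K r.
  by rewrite mulN1r opprB mulrBl -!word_cat.
by apply: I0M; apply: sub_ideal_gen; apply/ex_relationsE; left.
Qed.

Definition optrep (r : option basis) : PA := if r is Some i then rep i else 0.

(** By induction from the right end of the path, one arrow at a time, using [alpha_rep]. With
    [cls_relations] this identifies the kernel of [cls] with the ideal. *)
Lemma path_rep (p : path) : I0 ((<< p >> : PA) - optrep (evp p)).
Proof.
case: p => -[v s] sw; rewrite /optrep /evp /qstart /qarrows /=.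
elim: s v sw => [|a s IHs] v sw /=.
  rewrite /rep srcI_id /= /word big_nil mulr1 (_ : QPath sw = triv v).
    by rewrite subrr; apply: I0_0.
  exact: val_inj.
have [/eqP va tw] := andP sw.
have -> : (<< QPath sw >> : PA) = alpha K a.+1 * << @QPath exQ (tgt a, s) tw >>.
  have aE : alpha K a.+1 = (<< arrow (a : arr exQ) >> : PA) by rewrite /alpha inord_val.
  rewrite aE; apply: etrans (esym (pmulUU K _ _)).
  have [//|r rE rval] := @pcat_some exQ (arrow (a : arr exQ)) (@QPath exQ (tgt (a : arr exQ), s) tw).
  have rq : QPath sw = r.
    by apply: val_inj; rewrite [RHS]rval /= /qstart /qarrows /=; move: va => /= ->.
  apply: etrans (congr1 (@pbasis exQ K) (esym rE)).
  exact: (congr1 (fun z => @pbasis exQ K (Some z)) rq).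
have := IHs _ tw; case ts: (evs (tgt a) s) => [i|] /= Ip.
  have [ia _ _] := evs_props tw ts.
  exact: (I0_trans (I0MB (alpha K a.+1) Ip) (alpha_rep ia)).
rewrite subr0; apply: I0Ml.
by move: Ip; rewrite subr0.
Qed.

Lemma I0P a (x y z t : PA) : I0 (x - y) -> I0 (z - t) ->
  I0 ((a *: x + z) - (a *: y + t)).
Proof. by move=> Ixy Izt; rewrite opprD addrACA -scalerBr; apply: I0D => //; apply: I0Z. Qed.

Definition repl (u : {malg K[basis]}) : PA := lin rep u.

Lemma replP a u w : repl (a *: u + w) = a *: repl u + repl w.
Proof. exact: linearP. Qed.

Lemma cls_repl u : cls (repl u) = u.
Proof.
elim/malg_elim: u => [|a u w IHu IHw|i].
- by rewrite /repl linear0 cls0.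
- rewrite replP; apply: etrans (clsP _ _ _) _.
  by apply: congr2 IHw; apply: congr1 IHu.
by apply: etrans (cls_rep i); rewrite /repl linU.
Qed.

Lemma repl_cls (x : PA) : I0 (x - repl (cls x)).
Proof.
have I0_eq (y z : PA) : z = y -> I0 (y - z) by move=> ->; rewrite subrr; apply: I0_0.
elim/malg_elim: x => [|a u w IHu IHw|p].
- exact: (I0_eq 0 _ (etrans (congr1 repl cls0) (linear0 _))).
- have E : repl (cls (a *: u + w)) = a *: repl (cls u) + repl (cls w).
    by apply: etrans (congr1 repl (clsP _ _ _)) (replP _ _ _).
  have Ip := I0P a IHu IHw; have Iq := I0_eq _ _ E.
  by have := I0_trans Ip Iq.
have E : repl (cls << p >>) = optrep (evp p).
  apply: etrans (congr1 repl (clsU p)) _.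
  by rewrite /repl; case: (evp p) => [i|] /=; [exact: linU|exact: linear0].
have Ip := path_rep p; have Iq := I0_eq _ _ E.
by have := I0_trans Ip Iq.
Qed.

End LambdaBasis.

Section LambdaBased.
Variable K : fieldType.
Local Notation PA := (pathalg exQ K).
Local Notation path := (qpath exQ).
Local Notation proj := (@aproj K PA (@ex_relations K)).

Definition lcoord (y : Lambda K) : {malg K[basis]} := cls (arepr y).
Definition lelt (u : {malg K[basis]}) : Lambda K := proj (repl u).

Lemma cls_eq (x y : PA) : ideal_gen (@ex_relations K) (x - y) -> cls x = cls y.
Proof. by move=> /cls_ideal/eqP; rewrite clsB subr_eq0 => /eqP. Qed.

Lemma lcoordE x : lcoord (proj x) = cls x.
Proof. by apply/cls_eq/aproj_eqP; rewrite areprK. Qed.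

Lemma lcoordK : cancel lcoord lelt.
Proof.
move=> y; apply: etrans (areprK y); apply/esym/aproj_eqP.
exact: repl_cls.
Qed.

Lemma leltK : cancel lelt lcoord.
Proof. by move=> u; apply: etrans (lcoordE _) (cls_repl u). Qed.

Lemma cls_scal a (x : PA) : cls (scal a * x) = a *: cls x.
Proof.
have -> : scal a * x = a *: x.
  rewrite -[scal a * x]/(pmul (a *: pone exQ K) x) pmulZl.
  by rewrite (pmul1l x).
by rewrite -[a *: x]addr0; apply: etrans (clsP a x 0) _; rewrite [cls 0]cls0 addr0.
Qed.

Lemma lcoordP a x y : lcoord (scal a * x + y) = a *: lcoord x + lcoord y.
Proof.
have [x' <-] := aproj_surj x; have [y' <-] := aproj_surj y.
have -> : scal a * proj x' + proj y' = proj (scal a * x' + y').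
  by rewrite rmorphD rmorphM.
by rewrite !lcoordE clsD cls_scal.
Qed.

Lemma lcoordM x y : lcoord (x * y) = bil mulI (lcoord x) (lcoord y).
Proof.
have [x' <-] := aproj_surj x; have [y' <-] := aproj_surj y.
have -> : proj x' * proj y' = proj (x' * y') by rewrite rmorphM.
by rewrite !lcoordE clsM.
Qed.

Lemma lcoord1 : lcoord 1 = \sum_v << idI v >>.
Proof. by apply: etrans (lcoordE 1) (cls1 K). Qed.

Definition lambda_based : based (Lambda K) :=
  Based (bid := idI) (bdeg := fun i : basis => (val i).2)
    lcoordK leltK lcoordP lcoordM lcoord1 mulIA mulI_idl mulI_idr mulIP
    srcI_id tgtI_id (fun=> erefl) deg0I.

Lemma path_lengthP n (x : {malg K[path]}) : @path_length exQ K n x <->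
  supp_in (fun p : path => size (qarrows p) = n) x.
Proof. by []. Qed.

Lemma path_length_mul m n (x y : PA) :
  @path_length exQ K m x -> @path_length exQ K n y -> @path_length exQ K (m + n) (x * y).
Proof.
move=> /path_lengthP xm /path_lengthP yn; apply/path_lengthP.
rewrite -[x * y]/(pmul x y) /pmul big_seq.
elim/big_rec: _ => [|p u xp uP]; first exact: supp_in0.
apply: supp_inD => //; rewrite big_seq; elim/big_rec: _ => [|q v yq vP].
  exact: supp_in0.
apply: supp_inP => //; rewrite /pbasis.
have [pq|pq] := eqVneq (qend p) (qstart q); last first.
  by rewrite pcat_none //; apply: supp_in0.
have [r -> rE] := pcat_some pq; apply: supp_inU.
by rewrite /qarrows rE /= size_cat (xm p xp) (yn q yq).
Qed.

Lemma path_length_word s : @path_length exQ K (size s) (word K s).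
Proof.
elim: s => [|k s IHs].
  rewrite /word big_nil; apply/path_lengthP; rewrite -[1]/(pone exQ K) /pone.
  elim/big_rec: _ => [|v u _ uP]; first exact: supp_in0.
  by apply: supp_inD => //; apply: supp_inU.
rewrite word_cons [size _]/= -add1n; apply: path_length_mul => //.
by apply/path_lengthP; apply: supp_inU.
Qed.

Lemma Lambda_lengthP n (y : Lambda K) :
  @Lambda_length K n y <-> supp_in (fun i => bdeg i = n) (bcoord lambda_based y).
Proof.
split=> [[x xn <-]|yn].
  rewrite [bcoord _ _]lcoordE.
  move: xn => /path_lengthP xn; apply: (malg_ind (P := fun x => supp_in _ (cls x))) => [|a u v uP vP|p].
  - by rewrite [cls 0]cls0; apply: supp_in0.
  - by rewrite clsP; apply: supp_inP.
  move=> /xn <-; rewrite clsU; apply: supp_in_opb => i /evp_props[_ _].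
  exact.
exists (repl (lcoord y)); last exact: lcoordK.
apply/path_lengthP; rewrite /repl; apply: supp_in_lin => i /yn <- /=.
have -> : (val i).2 = (0 + size (pathn (val i)))%N.
  by rewrite add0n /pathn size_map size_traject.
apply: path_length_mul; last exact: path_length_word.
by apply/path_lengthP; apply: supp_inU.
Qed.

Definition basis_enum : seq basis := pmap insub allI.

Lemma basis_enumP i : i \in basis_enum.
Proof.
by rewrite mem_pmap_sub -allIP (valP i).
Qed.

End LambdaBased.

(** * The minimal resolution over Lambda *)

(* The sources of the relations: 12, 14, 16 first, as these are also the ends *)
(* of the relations and of all the higher generators.                         *)
Definition stab : seq nat := [:: 12; 14; 16; 1; 3; 5; 8; 10]%N.
Definition svn (i : nat) : nat := nth 0%N stab i.
Definition en (i : nat) : nat := nth 0%N [:: 0; 1; 2; 0; 1; 2; 1; 2]%N i.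
Definition on (i : nat) : nat := nth 0%N [:: 1; 2; 0; 1; 2; 0; 2; 0]%N i.
Definition sv (i : 'I_8) : 'I_17 := inord (svn i).-1.
Definition es (i : 'I_8) : 'I_8 := inord (en i).
Definition os (i : 'I_8) : 'I_8 := inord (on i).
Definition asrc (a : 'I_18) : 'I_17 := src (a : arr exQ).
Definition atgt (a : 'I_18) : 'I_17 := tgt (a : arr exQ).

Lemma forall_S (p : pred nat) : all p (iota 0 8) -> forall i : 'I_8, p i.
Proof. by move=> /allP ap a; apply: ap; rewrite mem_iota /= ltn_ord. Qed.

Lemma es_val i : es i = en i :> nat.
Proof. by rewrite inordK //; apply: (forall_S (p := fun i => en i < 8)%N). Qed.
Lemma os_val i : os i = on i :> nat.
Proof. by rewrite inordK //; apply: (forall_S (p := fun i => on i < 8)%N). Qed.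
Lemma sv_val i : (sv i).+1 = svn i.
Proof.
have /andP[h0 h1] : (0 < svn i <= 17)%N by apply: (forall_S (p := fun i => 0 < svn i <= 17)%N).
by rewrite inordK prednK.
Qed.

Lemma sv_inj : injective sv.
Proof.
move=> i j /(congr1 (fun v : 'I_17 => v.+1)); rewrite !sv_val => ij; apply: val_inj.
by apply/eqP; rewrite -(nth_uniq 0%N (s := stab)) ?ltn_ord //; apply/eqP.
Qed.

Lemma es_es i : es (es i) = es i.
Proof.
apply: val_inj; rewrite /= !es_val.
by apply/eqP; apply: (forall_S (p := fun i => en (en i) == en i)).
Qed.
Lemma es_os i : es (os i) = os i.
Proof.
apply: val_inj; rewrite /= es_val os_val.
by apply/eqP; apply: (forall_S (p := fun i => en (on i) == on i)).
Qed.
Lemma os_es i : os (es i) = os i.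
Proof.
apply: val_inj; rewrite /= !os_val es_val.
by apply/eqP; apply: (forall_S (p := fun i => on (en i) == on i)).
Qed.

Notation W := (eclass 'I_17 'I_18 'I_8).
Notation Ver v := (inl v : W).
Notation Arr a := (inr (inl a) : W).
Notation Hi i n := (inr (inr (i, n)) : W).
Notation vtx := (@evtx _ _ _ atgt sv es os).
Notation lvl := (@elvl 'I_17 'I_18 'I_8).

(* The coefficient of the differential from [Hi i n.+1] to [Hi i n] is a path *)
(* of length [thr n].                                                         *)
Definition thr (n : nat) : nat := if odd n then 4%N else 2%N.
(** The number of the vertex at which the generator [Hi i n] ends. *)
Definition cn (i n : nat) : nat := svn (if odd n then on i else en i).
Definition fn (i : nat) : nat := (anum (svn i)).-1.
Definition fa (i : 'I_8) : 'I_18 := inord (fn i).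
(** The commutativity relation, the only one with two terms; these begin with the arrows [a1] and
    [a7]. *)
Definition i1 : 'I_8 := inord 3.
Definition a1 : 'I_18 := inord 0.
Definition a7 : 'I_18 := inord 6.

Lemma vtx_Hi i n : (vtx (Hi i n)).+1 = cn i n.
Proof. by rewrite /= sv_val /cn /par; case: (odd n); rewrite ?es_val ?os_val. Qed.

Lemma fa_val i : fa i = fn i :> nat.
Proof. by rewrite inordK //; apply: (forall_S (p := fun i => fn i < 18)%N). Qed.

Lemma cn_props (i : 'I_8) n :
  [&& cn i n != 0%N, lmax (cn i n) == 5%N, cn i n <= 17, cn i n != 1%N
    & endn (cn i n, thr n) == cn i n.+1]%N.
Proof.
pose p b i := let c := svn (if b then on i else en i) in
  [&& c != 0%N, lmax c == 5%N, c <= 17, c != 1%N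
    & iter (if b then 4%N else 2%N) nxt c == svn (if ~~ b then on i else en i)]%N.
rewrite /cn /thr /endn /=; apply: (forall_S (p := p (odd n))).
by case: (odd n).
Qed.

Section LambdaResolution.
Variable K : fieldType.
Local Notation TT := {malg K[(W * basis)%type]}.
Local Notation B := (lambda_based K).
Local Notation dot x k := (bil (@fact _ _ B W) (x : TT) << k >>).

(** The value is 0 when [(s, l)] is not a nonzero path, so products with paths become additions of
    lengths. *)
Definition T (w : W) (s l : nat) : TT := opb (omap (pair w) (insub (s, l) : option basis)).

Lemma T_ok w (k : basis) : T w (val k).1 (val k).2 = << (w, k) >>.
Proof. by rewrite /T -surjective_pairing valK. Qed.

Lemma T_eq w (k : basis) s l : val k = (s, l) -> << (w, k) >> = T w s l.
Proof. by move=> kE; rewrite -T_ok kE. Qed.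

Lemma T0 w s l : ~~ okI (s, l) -> T w s l = 0.
Proof. by move=> sl; rewrite /T insubF //; apply: negbTE. Qed.

Lemma okI_suffix s l m : s != 0%N -> okI (s, (l + m)%N) -> okI (endn (s, l), m).
Proof.
move=> s0 slm; have sl : okI (s, l).
  move: slm; rewrite /okI /= s0 /= !andbT => /andP[-> /=].
  by apply: leq_trans; apply: leq_addr.
have m7 : (m < 8)%N.
  have := forallI (p := fun x => (x.2 < 8)%N) isT slm => /=.
  by apply: leq_ltn_trans; apply: leq_addl.
pose p x := (x.1 != 0%N) ==> all (fun m =>
  okI (x.1, x.2 + m)%N ==> okI (endn x, m)) (iota 0 8).
have /implyP/(_ s0)/allP h : p (s, l) by apply: forallI sl.
by apply: (implyP (h m _)); rewrite ?mem_iota.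
Qed.

Lemma mulI_insub (k : basis) s l m : s != 0%N -> endn (s, l) != 0%N ->
  val k = (endn (s, l), m) ->
  obind (mulI^~ k) (insub (s, l)) = insub (s, (l + m)%N).
Proof.
move=> s0 e0 kE; have [sl|sl] := boolP (okI (s, l)); last first.
  rewrite insubF ?(negbTE sl) //= insubF //; apply: contraNF sl.
  rewrite /okI /= s0 /= !andbT => /andP[-> /=].
  by apply: leq_trans; apply: leq_addr.
rewrite (insubT okI sl) /=; apply: omap_val_inj.
have srck : srcn (val k) = endn (s, l) by rewrite kE /srcn /= (negPf e0).
rewrite mulI_val SubK /cmul srck eqxx /= kE /= (negPf s0) /=.
have iv (z : nat * nat) : omap val (insub z : option basis) = if okI z then Some z else None.
  by case: insubP => [u -> <-|/negPf ->].
rewrite iv; case: eqP => [l0|_].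
  have := valP k; rewrite kE l0 /endn /= => -> //.
case: eqP => [->|_]; last by [].
by rewrite addn0 sl.
Qed.

Lemma dotT w s l (k : basis) m : s != 0%N -> endn (s, l) != 0%N ->
  val k = (endn (s, l), m) -> dot (T w s l) k = T w s (l + m).
Proof.
move=> s0 e0 kE; rewrite /T -(mulI_insub s0 e0 kE).
case: (insub (s, l)) => [j|] /=; last by rewrite bil0l.
by rewrite bilUU /fact /=.
Qed.

Lemma mliftT_gen (F : W -> TT) w s l :
  mlift (B := B) F (T w s l) =
  if insub (s, l) : option basis is Some k then dot (F w) k else 0.
Proof.
rewrite /T; case: (insub _) => [k|] /=; last exact: (@mlift0 _ _ B _ _ F).
by rewrite mliftU.
Qed.

Lemma mliftT (F : W -> TT) w s l w' s' l' : F w = T w' s' l' ->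
  s' != 0%N -> s != 0%N -> endn (s', l') = s -> mlift (B := B) F (T w s l) = T w' s' (l' + l).
Proof.
move=> Fw s'0 s0 sE; rewrite mliftT_gen; case: insubP => [k _ kE|sl].
  by rewrite Fw (@dotT w' s' l' k l) ?sE.
by rewrite T0 //; apply: contra sl => sl; rewrite -sE; apply: okI_suffix.
Qed.

Lemma linT (F : W * basis -> TT) w s l :
  lin F (T w s l) = if insub (s, l) : option basis is Some k then F (w, k) else 0.
Proof. by rewrite /T; case: (insub _) => [k|] /=; [exact: linU|exact: linear0]. Qed.

Local Notation lcell := (cell (B := B) (fun _ : W => true) lvl vtx).

Lemma T_cell n w s l : lvl w = n -> srcn (s, l) = (vtx w).+1 -> supp_in (lcell n) (T w s l).
Proof.
move=> wn sE; apply: supp_in_opb => b; case: insubP => [k _ kE|//] [<-].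
split=> //=; apply/val_inj/succn_inj.
by rewrite [RHS]srcIE kE sE.
Qed.

Lemma T_deg w s l : supp_in (fun b : W * basis => (val b.2).2 = l) (T w s l).
Proof. by apply: supp_in_opb => b; case: insubP => [k _ kE|//] [<-] /=; rewrite kE. Qed.

Lemma T_tgt w s l (v : 'I_17) : endn (s, l) = v.+1 ->
  supp_in (fun b : W * basis => tgtI b.2 = v) (T w s l).
Proof.
move=> sE; apply: supp_in_opb => b; case: insubP => [k _ kE|//] [<-] /=.
by apply/val_inj/succn_inj; rewrite tgtIE kE.
Qed.

Definition lbd (w : W) : TT :=
  match w with
  | inl _ => 0
  | inr (inl a) => T (Ver (asrc a)) (acode a.+1).1 1
  | inr (inr (i, 0%N)) => T (Arr (fa i)) (nxt (svn i)) 5 - (if i == i1 then T (Arr a7) 7 5 else 0)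
  | inr (inr (i, n.+1)) => T (Hi i n) (cn i n) (thr n)
  end.

(** The value is 8 when no relation starts where [a] does. *)
Definition src_idx (a : 'I_18) : nat := index (asrc a).+1 stab.

(* Of the two sides of the commutativity relation, the one that starts with   *)
(* [alpha_7] is the leading term, so the arrow [a1] is annihilated.           *)
Definition lhom (b : W * basis) : TT :=
  let (s, l) := val b.2 in
  match b.1 with
  | inl _ => if l == 0%N then 0 else T (Arr (inord (anum s).-1)) (nxt s) l.-1
  | inr (inl a) =>
      if (l < 5)%N || (a == a1) then 0 else
      if a == a7 then - T (Hi i1 0) 12 (l - 5) else
      if (src_idx a < 8)%N then T (Hi (inord (src_idx a)) 0) (cn (src_idx a) 0) (l - 5) else 0
  | inr (inr (i, n)) => if (l < thr n)%N then 0 else T (Hi i n.+1) (cn i n.+1) (l - thr n)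
  end.

Lemma asrcE (a : 'I_18) : (asrc a).+1 = srcn (acode a.+1).
Proof. by rewrite -[asrc a]src_arrI srcIE. Qed.

Lemma atgtE (a : 'I_18) : (atgt a).+1 = endn (acode a.+1).
Proof. by rewrite -[atgt a]tgt_arrI tgtIE. Qed.

Lemma fa_src i : asrc (fa i) = sv i.
Proof.
apply/val_inj/succn_inj; rewrite [LHS]asrcE sv_val fa_val; apply/eqP.
by apply: (forall_S (p := fun i => srcn (acode (fn i).+1) == svn i)).
Qed.

Lemma fa_tgt i : (atgt (fa i)).+1 = nxt (svn i).
Proof.
rewrite atgtE fa_val; apply/eqP.
by apply: (forall_S (p := fun i => endn (acode (fn i).+1) == nxt (svn i))).
Qed.

Lemma lbd_supp n (w : W) : lvl w = n.+1 ->
  supp_in (fun b : W * basis => [/\ lcell n b, (0 < (val b.2).2)%N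
    & stacked_degree 6 2 n + (val b.2).2 = stacked_degree 6 2 n.+1]%N) (lbd w).
Proof.
have TP w' s l : lvl w' = n -> srcn (s, l) = (vtx w').+1 -> (0 < l)%N ->
    (stacked_degree 6 2 n + l = stacked_degree 6 2 n.+1)%N ->
    supp_in (fun b : W * basis => [/\ lcell n b, (0 < (val b.2).2)%N
      & stacked_degree 6 2 n + (val b.2).2 = stacked_degree 6 2 n.+1]%N) (T w' s l).
  move=> w'n sE l0 d b bT; have bl := T_deg bT; rewrite bl.
  by split=> //; apply: T_cell bT.
case: w => [//|[a|[i [|m]]]] /= [nE].
- apply: TP; rewrite -?nE //.
  by rewrite /srcn /= -[RHS]/((asrc a).+1) asrcE.
- apply: supp_inB.
    apply: TP; rewrite -?nE //= -fa_tgt //.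
  case: eqP => [_|_]; last exact: supp_in0.
  apply: TP; rewrite -?nE //=.
  by rewrite -[RHS]/((atgt a7).+1) atgtE inordK.
have /and5P[c0 _ _ _ _] := cn_props i m.
apply: TP; rewrite -?nE //.
- by rewrite /srcn /= (negPf c0) -vtx_Hi.
- by rewrite /thr; case: (odd m).
rewrite /stacked_degree /= !negbK /thr !uphalf_half; case: (odd m) => /=; lia.
Qed.

Lemma first_arrow (k : basis) : let: (s, l) := val k in
  [&& 0 < anum s <= 18, endn (acode (anum s)) == nxt s, nxt s != 0,
      srcn (acode (anum s)) == srcn (s, l)
    & (l != 0) ==> okI (nxt s, l.-1) && (cmul (acode (anum s)) (nxt s, l.-1) == Some (s, l))]%N.
Proof.
by apply: (forall_basis (p := fun x => let: (s, l) := x in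
  [&& 0 < anum s <= 18, endn (acode (anum s)) == nxt s, nxt s != 0,
      srcn (acode (anum s)) == srcn (s, l)
    & (l != 0) ==> okI (nxt s, l.-1) && (cmul (acode (anum s)) (nxt s, l.-1) == Some (s, l))]%N));
  vm_compute.
Qed.

Definition first (s : nat) : 'I_18 := inord (anum s).-1.

Lemma firstE s : (0 < anum s <= 18)%N -> (first s).+1 = anum s.
Proof. by case/andP=> s0 s18; rewrite inordK prednK. Qed.

Lemma lhom_supp n b : lcell n b -> supp_in (lcell n.+1) (lhom b).
Proof.
case: b => [w k] [_ /= wn wk]; rewrite /lhom /=.
case kE: (val k) => [s l]; case: w wn wk => [v|[a|[i m]]] /= <- wk.
- case: eqP => _; first exact: supp_in0.
  have := first_arrow k; rewrite kE => /and5P[sr /eqP st /negPf s0 _ _].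
  apply: T_cell => //; rewrite /srcn /= s0.
  by rewrite -[RHS]/((atgt (first s)).+1) atgtE firstE.
- case: ifP => _; first exact: supp_in0.
  case: ifP => _.
    rewrite -scaleN1r; apply: supp_inZ; apply: T_cell => //.
    by rewrite -[RHS]/((vtx (Hi i1 0)).+1) vtx_Hi /i1 inordK.
  case: ifP => [s8|_]; last exact: supp_in0.
  have /and5P[c0 _ _ _ _] := cn_props (inord (src_idx a)) 0.
  apply: T_cell => //; rewrite -[RHS]/((vtx (Hi (inord (src_idx a)) 0)).+1) vtx_Hi.
  by move: c0; rewrite /srcn /= (inordK s8) => /negPf ->.
case: ifP => _; first exact: supp_in0.
have /and5P[c0 _ _ _ _] := cn_props i m.+1.
by apply: T_cell => //; rewrite -[RHS]/((vtx (Hi i m.+1)).+1) vtx_Hi /srcn /= (negPf c0).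
Qed.

Lemma dot_sub (x y : TT) k : dot (x - y) k = dot x k - dot y k.
Proof. by rewrite -[- y]scaleN1r addrC bilPl scaleN1r addrC. Qed.

Lemma dot_Ver a (k : basis) :
  dot (T (Ver (asrc a)) (acode a.+1).1 1) k =
  opb (omap (pair (Ver (asrc a))) (mulI (arrI a) k)).
Proof.
rewrite -[1%N]/((acode a.+1).2) -[acode a.+1]/(val (arrI a)) T_ok bilUU.
by rewrite /fact.
Qed.

Lemma fa_props (i : 'I_8) : let a := fn i in let x := nxt (svn i) in
  [&& (acode a.+1).1 == svn i, svn i != 0, x != 0, endn (svn i, 1) == x,
      endn (x, 5) == cn i 0, lmax x == 6, lmax (svn i) == (if val i == 3 then 7 else 5)
    & (val i == 3) || (a != 0) && (a != 6)]%N.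
Proof.
by apply: (forall_S (p := fun i => let a := fn i in let x := nxt (svn i) in
  [&& (acode a.+1).1 == svn i, svn i != 0, x != 0, endn (svn i, 1) == x,
      endn (x, 5) == cn i 0, lmax x == 6, lmax (svn i) == (if i == 3 then 7 else 5)
    & (i == 3) || (a != 0) && (a != 6)]%N)).
Qed.

Lemma dot_Hi0 (i : 'I_8) (k : basis) m : val k = (cn i 0, m) ->
  dot (lbd (Hi i 0)) k = T (Arr (fa i)) (nxt (svn i)) (5 + m) -
                         (if i == i1 then T (Arr a7) 7 (5 + m) else 0).
Proof.
move=> kE; have /and5P[_ s0 x0 /eqP sx /and4P[/eqP xE _ _ _]] := fa_props i.
have /and5P[c0 _ _ _ _] := cn_props i 0.
rewrite dot_sub (@dotT _ _ _ _ m) ?xE //; congr (_ - _).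
have [iE|_] := eqVneq i i1; last by rewrite bil0l.
by rewrite (@dotT _ _ _ _ m) // kE iE /i1 inordK.
Qed.

Lemma val_i1 : i1 = 3 :> nat. Proof. by rewrite inordK. Qed.
Lemma val_a1 : a1 = 0 :> nat. Proof. by rewrite inordK. Qed.
Lemma val_a7 : a7 = 6 :> nat. Proof. by rewrite inordK. Qed.

Lemma mlift_lbd_Arr i l : mlift (B := B) lbd (T (Arr (fa i)) (nxt (svn i)) l) =
  T (Ver (sv i)) (svn i) l.+1.
Proof.
have /and5P[/eqP aE s0 x0 /eqP sx _] := fa_props i.
rewrite (@mliftT _ _ _ _ (Ver (asrc (fa i))) (svn i) 1) ?fa_src //.
by rewrite -[LHS]/(T (Ver (asrc (fa i))) (acode (fa i).+1).1 1) ?fa_src fa_val aE.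
Qed.

(** From length 6 on, the resulting path is coded as one through [alpha_1]; this is where the two
    terms of the commutativity relation meet. *)
Lemma mlift_lbd_a7 l : mlift (B := B) lbd (T (Arr a7) 7 l) =
  T (Ver (sv i1)) (if l < 5 then 0 else 1)%N l.+1.
Proof.
rewrite mliftT_gen; case: insubP => [k _ kE|l7]; last first.
  by rewrite T0 //; apply: contra l7; do 8![case: l => [|l] //].
rewrite [lbd _]/(T _ _ _) dot_Ver.
have -> : asrc a7 = sv i1.
  by apply/val_inj/succn_inj; rewrite [LHS]asrcE sv_val val_i1 val_a7.
have E : cmul (acode 7) (7, l)%N = Some ((if l < 5 then 0 else 1)%N, l.+1).
  have := valP k; rewrite kE; move: (l) => {kE}.
  by do 8!case=> //.
rewrite /T; congr (opb (omap _ _)); apply: omap_val_inj.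
rewrite mulI_val kE /= val_a7 E; case: insubP => [u _ /= -> //|].
have := valP k; rewrite kE; move: (l) => {kE E}.
by do 8!case=> //.
Qed.

(** Except at [Hi i1 0], where the two terms cancel, the composite path exceeds [lmax]: it has
    length 6 where at most 5 is allowed, or 7 where at most 6 is. *)
Lemma lbdK w : mlift (B := B) lbd (lbd w) = 0.
Proof.
case: w => [v|[a|[i [|n]]]] /=.
- exact: (@mlift0 _ _ B _ _ lbd).
- by rewrite mliftT_gen; case: insubP => // k _ _; rewrite /= bil0l.
- have mB x y : mlift (B := B) lbd (x - y) = mlift (B := B) lbd x - mlift (B := B) lbd y.
    exact: raddfB.
  rewrite mB mlift_lbd_Arr; have [->|i3] := eqVneq i i1.
    by rewrite mlift_lbd_a7 /= val_i1 subrr.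
  rewrite [mlift (B := B) lbd 0](@mlift0 _ _ B _ _ lbd) subr0 T0 //.
  have /and5P[_ s0 _ _ /and4P[_ _ /eqP lm _]] := fa_props i.
  rewrite /okI /= lm; case: eqP => [i3'|_]; last by rewrite andbF.
  by case/eqP: i3; apply: val_inj; rewrite /= i3' val_i1.
have /and5P[c0 /eqP lm _ _ /eqP cE] := cn_props i n.
rewrite mliftT_gen; case: insubP => // k _ kE.
case: n kE c0 lm cE => [|n] kE c0 lm cE.
  have /and5P[_ s0 x0 _ /and4P[_ /eqP xm _ _]] := fa_props i.
  rewrite (dot_Hi0 kE) !T0 ?if_same ?subr0 //.
  by rewrite /okI /= xm andbF.
have /and5P[d0 /eqP dm _ _ /eqP dE] := cn_props i n.
rewrite [lbd _]/(T _ _ _) (@dotT _ _ _ _ (thr n.+1)) ?dE //.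
by rewrite T0 // /okI /= dm /thr /=; case: (odd n); rewrite andbF.
Qed.

(** What the homotopy needs to know about an arrow followed by a path. A nonzero product has this
    arrow as its first one, up to the renaming after [alpha_7]; a vanishing product begins with the
    monomial relation whose first arrow it is. *)
Definition arrow_case (a : nat) (x : nat * nat) : bool :=
  let idx := index (srcn (acode a.+1)) stab in
  (endn (acode a.+1) == srcn x) ==>
  if cmul (acode a.+1) x is Some z then
    (z.2 != 0%N) && (z.2.-1 == x.2) &&
    (if (a == 6) && (5 <= x.2)%N then (z.1 == 1%N) && (x.1 == 7%N)
     else [&& anum z.1 == a.+1, nxt z.1 == x.1
            & (x.2 < 5) || (a == 0) || (8 <= idx)]%N)
  else [&& 5 <= x.2, a != 0, a != 6, idx < 8, fn idx == a & nxt (svn idx) == x.1]%N.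

Lemma arrow_caseP (a : 'I_18) (k : basis) : arrow_case a (val k).
Proof.
apply: (forall_basis (p := arrow_case a)).
apply: (forall_arr (p := fun a => all (arrow_case a) allI)).
by vm_compute.
Qed.

(** The two terms are complementary: for [m] at least [thr n] the first is the identity and the
    second is 0, below [thr n] it is the reverse. *)
Lemma lhomP_Hi n (i : 'I_8) (k : basis) m : val k = (cn i n, m) ->
  mlift (B := B) lbd (lhom (Hi i n, k)) + lin lhom (mlift (B := B) lbd << (Hi i n, k) >>) =
  << (Hi i n, k) >>.
Proof.
move=> kE; have /and5P[c0 /eqP lm c17 _ /eqP cE] := cn_props i n.
have m5 : (m <= 5)%N by have := valP k; rewrite kE /okI /= lm => /and3P[].
have lk : lhom (Hi i n, k) =
    if (m < thr n)%N then 0 else T (Hi i n.+1) (cn i n.+1) (m - thr n) by rewrite /lhom kE.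
have Dh : mlift (B := B) lbd (lhom (Hi i n, k)) = if (m < thr n)%N then 0 else << (Hi i n, k) >>.
  rewrite lk; case: ltnP => mt; first exact: (@mlift0 _ _ B _ _ lbd).
  have /and5P[d0 _ _ _ _] := cn_props i n.+1.
  rewrite (@mliftT _ _ _ _ (Hi i n) (cn i n) (thr n)) //.
  by rewrite subnKC // (T_eq _ kE).
rewrite Dh {Dh lk} mliftU.
have hD : lin lhom (dot (lbd (Hi i n)) k) = if (m < thr n)%N then << (Hi i n, k) >> else 0.
  case: n kE c0 lm c17 cE => [|n] kE c0 lm c17 cE.
    have /and5P[_ s0 x0 _ /and4P[_ /eqP xm _ a06]] := fa_props i.
    rewrite (dot_Hi0 kE) linearB /= linT.
    have okx s : lmax s = 6%N -> (s <= 17)%N -> s != 0%N -> okI (s, 5 + m)%N = (m < 2)%N.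
      by move=> lm6 s17 s1; rewrite /okI /= lm6 s17 s1; case: (m) => [|[|[]]].
    have x17 : (nxt (svn i) <= 17)%N by apply: (forall_S (p := fun i => nxt (svn i) <= 17)%N).
    have [iE|i3] := eqVneq i i1.
      rewrite linT; case: insubP => [k1 _ k1E|_]; case: insubP => [k2 k2ok k2E|k2n].
      - have faE : fa i = a1 by apply: val_inj; rewrite /= fa_val iE val_i1 val_a1.
        rewrite {1}/lhom /= k1E faE eqxx orbT sub0r /lhom /= k2E eqxx.
        have -> : (a7 == a1) = false by rewrite -val_eqE /= val_a7 val_a1.
        rewrite addKn opprK; move: k2ok; rewrite okx // => ->.
        by rewrite (T_eq _ kE) iE /i1 inordK.
      - have faE : fa i = a1 by apply: val_inj; rewrite /= fa_val iE val_i1 val_a1.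
        rewrite {1}/lhom /= k1E faE eqxx orbT subr0.
        by move: k2n; rewrite okx // => /negPf ->.
      - rewrite sub0r /lhom /= k2E eqxx.
        have -> : (a7 == a1) = false by rewrite -val_eqE /= val_a7 val_a1.
        rewrite addKn opprK; move: k2ok; rewrite okx // => ->.
        by rewrite (T_eq _ kE) iE /i1 inordK.
      - by rewrite subr0; move: k2n; rewrite okx // => /negPf ->.
    rewrite linear0 subr0; case: insubP => [k1 + k1E|]; rewrite okx //; last by move/negPf ->.
    move=> ->; rewrite /lhom /= k1E.
    have i3' : (i == 3 :> nat) = false.
      by apply: contraNF i3 => /eqP i3; apply/eqP/val_inj; rewrite /= val_i1.
    move: a06; rewrite i3' /= => /andP[f0 f6].
    rewrite -!val_eqE /= fa_val val_a1 val_a7 (negPf f0) (negPf f6) /=.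
    have idx : src_idx (fa i) = i.
      by rewrite /src_idx fa_src sv_val index_uniq ?ltn_ord.
    by rewrite idx ltn_ord addKn (T_eq _ kE) inord_val.
  have /and5P[d0 /eqP dm d17 _ /eqP dE] := cn_props i n.
  rewrite [lbd _]/(T _ _ _) (@dotT _ _ _ _ m) ?dE // linT.
  have okt : okI (cn i n, thr n + m)%N = (m < thr n.+1)%N.
    rewrite /okI /= d17 dm d0 /= andbT /thr /=; case: (odd n) => /=.
      by case: (m) => [|[|[]]].
    by case: (m) => [|[|[|[|[]]]]].
  case: insubP => [k1 + k1E|]; rewrite okt; last by move/negPf ->.
  move=> ->; rewrite /lhom /= k1E ltnNge leq_addr /= addKn.
  by rewrite (T_eq _ kE).
by rewrite hD; case: ifP; rewrite ?add0r ?addr0.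
Qed.

Lemma lhom_Arr a (k : basis) t m : val k = (t, m) -> lhom (Arr a, k) =
  if (m < 5)%N || (a == a1) then 0 else
  if a == a7 then - T (Hi i1 0) 12 (m - 5) else
  if (src_idx a < 8)%N then T (Hi (inord (src_idx a)) 0) (cn (src_idx a) 0) (m - 5) else 0.
Proof. by move=> kE; rewrite /lhom kE. Qed.

Lemma lhom_Ver v (k : basis) : lhom (Ver v, k) =
  if (val k).2 == 0%N then 0 else T (Arr (first (val k).1)) (nxt (val k).1) (val k).2.-1.
Proof. by rewrite /lhom; case: (val k). Qed.

Lemma lhomP n b : lcell n b ->
  mlift (B := B) lbd (lhom b) + lin lhom (mlift (B := B) lbd << b >>) =
  if (lvl b.1 == 0%N) && ((val b.2).2 == 0%N) then 0 else << b >>.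
Proof.
case: b => [w k] [_ _ wk0]; have {wk0} wk : vtx w = srcI k := wk0.
rewrite [(w, k).1]/= [(w, k).2]/=; case: w wk => [v|[a|[i m]]] wk; last first.
- have kE : val k = (cn i m, (val k).2).
    have := srcIE k; rewrite -wk vtx_Hi /srcn; case: (val k) => s l /=.
    have /and5P[_ _ _ c1 _] := cn_props i m; case: eqP => [_ cE|_ -> //].
    by rewrite cE in c1.
  exact: (lhomP_Hi kE).
- rewrite mliftU [lbd _]/(T (Ver (asrc a)) (acode a.+1).1 1) dot_Ver /=.
  have := arrow_caseP a k; rewrite /arrow_case -atgtE.
  have -> : srcn (val k) = (atgt a).+1 by rewrite -srcIE -wk.
  rewrite eqxx implyTb -[acode a.+1]/(val (arrI a)) -mulI_val.
  have -> : index (srcn (val (arrI a))) stab = src_idx a by rewrite -asrcE.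
  case ak: (mulI (arrI a) k) => [z|] /=; last first.
    rewrite linear0 addr0 => /and5P[m5 a0 a6 i8 /andP[/eqP fE /eqP xE]].
    case kE: (val k) m5 xE => [t m] m5 xE; rewrite (lhom_Arr a kE).
    have m5' : (m < 5)%N = false by rewrite ltnNge m5.
    rewrite -!val_eqE /= val_a1 val_a7 (negPf a0) (negPf a6) m5' /= i8.
    have iE : (inord (src_idx a) : 'I_8) = src_idx a :> nat by rewrite inordK.
    set i : 'I_8 := inord _ in iE *.
    have i3 : (i == i1) = false.
      by apply: contraNF a0 => /eqP iE'; rewrite -fE -iE iE' val_i1.
    rewrite -[in cn _ _]iE.
    have /and5P[_ s0 x0 _ /and4P[/eqP x5 _ _ _]] := fa_props i.
    have /and5P[c0 _ _ _ _] := cn_props i 0.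
    rewrite (@mliftT _ _ _ _ (Arr (fa i)) (nxt (svn i)) 5) //; last first.
      by rewrite /= i3 subr0.
    rewrite subnKC // (T_eq _ kE) iE xE; congr (T (Arr _) _ _).
    by apply: val_inj; rewrite /= fa_val iE fE.
  rewrite linU; case/andP=> /andP[z0 /eqP zm].
  have hz := lhom_Ver (asrc a) z; rewrite (negPf z0) in hz.
  rewrite hz zm; case: ifP => [/andP[/eqP a6 m5]|a6].
    move=> /andP[/eqP z1 /eqP k7].
    have aE : a = a7 by apply: val_inj; rewrite /= a6 val_a7.
    rewrite z1; case kE: (val k) k7 m5 => [t m] /= tE m5; rewrite (lhom_Arr a kE).
    rewrite tE in kE.
    have -> : (a == a1) = false by rewrite -val_eqE /= a6 val_a1.
    have m5' : (m < 5)%N = false by rewrite ltnNge m5.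
    rewrite aE eqxx m5' /= -scaleN1r [mlift _ _]linearZ /= scaleN1r.
    (* The homotopy gives minus [Hi i1 0], whose boundary leaves an unwanted term at [a1]. It
       cancels against h d, because the path through [alpha_7] is coded as one through [alpha_1] and
       [lhom] splits off [a1]. *)
    have D1 : mlift (B := B) lbd (T (Hi i1 0) 12 (m - 5)) = T (Arr a1) 2 m - T (Arr a7) 7 m.
      rewrite mliftT_gen; case: insubP => [k2 _ k2E|k2n].
        rewrite (@dot_Hi0 i1 k2 (m - 5)%N) ?k2E ?val_i1 // eqxx subnKC //.
        by congr (T (Arr _) _ _ - _); apply: val_inj; rewrite /= fa_val val_i1 val_a1.
      have m6 : (m <= 6)%N by have := valP k; rewrite kE => /and3P[].
      by case/negP: k2n; rewrite /okI /= andbT /lmax /=; apply: leq_trans (leq_sub2r 5 m6) _.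
    by rewrite D1 opprB [first 1](_ : _ = a1) // [nxt 1]/= subrK (T_eq _ kE).
  move=> /and3P[/eqP zn /eqP zt zc].
  have zr : (0 < anum (val z).1 <= 18)%N by rewrite zn /= ltn_ord.
  have fz : first (val z).1 = a by apply/val_inj/succn_inj; rewrite [LHS](firstE zr) zn.
  rewrite fz zt T_ok addrC -[RHS]addr0; congr (_ + _).
  case kE: (val k) zc a6 => [t m] /= zc a6; rewrite (lhom_Arr a kE).
  rewrite [X in mlift _ X](_ : _ = 0); first exact: (@mlift0 _ _ B _ _ lbd).
  case: ifP => // /negbT /norP[m5 a0]; case: eqP => [a7E|_].
    by move: a6; rewrite a7E val_a7 eqxx /= leqNgt (negPf m5).
  case: ltnP => // i8; move: zc; rewrite (negPf m5) leqNgt i8 orbF /= => a0'.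
  by case/negP: a0; rewrite -val_eqE /= val_a1.
rewrite mliftU [lbd _]/= bil0l linear0 addr0 lhom_Ver.
have := first_arrow k; case kE: (val k) => [s l]; rewrite [(s, l).1]/= [(s, l).2]/=.
case/and5P=> sr _ _ /eqP srcE; have [_ _|l0] := eqVneq l 0%N.
  exact: (@mlift0 _ _ B _ _ lbd).
rewrite implyTb andbF => /andP[ok' /eqP mE].
rewrite mliftT_gen (insubT okI ok') [lbd _]/(T (Ver (asrc (first s))) (acode (first s).+1).1 1) dot_Ver.
have -> : mulI (arrI (first s)) (Sub (nxt s, l.-1) ok') = Some k.
  by apply: omap_val_inj; rewrite mulI_val !SubK firstE // mE -kE.
congr (<< (Ver _, _) >>); apply/val_inj/succn_inj; rewrite [LHS]asrcE firstE // srcE.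
by rewrite -kE -srcIE -wk.
Qed.

Fact lverP (w : W) : true -> lvl w = 0%N -> w = Ver (vtx w).
Proof. by case: w => [v|[a|[i n]]]. Qed.

Fact lbd0 (w : W) : lvl w = 0%N -> lbd w = 0.
Proof. by case: w => [v|[a|[i n]]]. Qed.

Definition lambda_cellular : cellular B :=
  @Cellular K (Lambda K) B W (fun=> true) lvl vtx (fun v => Ver v) (stacked_degree 6 2)
    lbd lhom (fun=> isT) (fun=> erefl) (fun=> erefl) lverP erefl lbd0
    (fun n w _ => @lbd_supp n w) lhom_supp (fun w _ => lbdK w) lhomP.

Lemma lambda_stacked : stacked (@Lambda_length K) 6 2.
Proof.
have grE := @Lambda_lengthP K; split; first exact: (based_graded grE).
  exact: (based_finite (B := B) basis_enumP).
exact: (cellular_generated lambda_cellular grE).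
Qed.

End LambdaResolution.

(** * Chain maps lifting the dual cocycles over Lambda *)

Section Lifts.
Variable K : fieldType.
Local Notation TT := {malg K[(W * basis)%type]}.
Local Notation B := (lambda_based K).
Local Notation dot x k := (bil (@fact _ _ B W) (x : TT) << k >>).
Local Notation T := (@T K).
Local Notation lbd := (@lbd K).
Local Notation D := (mlift (B := B) lbd).
Local Notation lcell := (cell (B := B) (fun _ : W => true) lvl vtx).
Local Notation mul := (@emul _ _ _ asrc atgt sv es os).
Local Notation src := (@esrc _ _ _ asrc sv).
Local Notation parS := (@par 'I_8 es os).

(** A vertex restricts the identity to the generators that start there, and an arrow is removed from
    the front of the relations. The class [Hi i n] moves the tail of its chain to the chain of the
    relation at its end. Since the generating degrees are additive except for two odd indices, where
    2 is missing, the coefficient then has length 0 or 2. *)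
Definition lift (w w' : W) : TT :=
  match w, w' with
  | inl v, _ => if src w' == v then T w' (vtx w').+1 0 else 0
  | inr (inl a), inr (inl a') => if a == a' then T (Ver (atgt a)) (atgt a).+1 0 else 0
  | inr (inl a), inr (inr (i, 0%N)) =>
      (if a == fa i then T (Arr (first (nxt (svn i)))) (nxt (nxt (svn i))) 4 else 0) -
      (if (i == i1) && (a == a7) then T (Arr (first 7)) 8 4 else 0)
  | inr (inr (i, n)), inr (inr (j, p)) =>
      if i != j then 0 else
      match (p - n)%N with
      | 0%N => T (Ver (vtx w)) (cn i n) 0
      | 1%N => T (Arr (first (cn i n))) (nxt (cn i n)) (thr n).-1
      | m.+2 => T (Hi (parS i n) m) (cn (parS i n) m) (if odd n && odd m then 2 else 0)
      end
  | _, _ => 0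
  end.

Lemma first_props s : (0 < s <= 17)%N ->
  [/\ (first s).+1 = anum s, (acode (first s).+1).1 = s & (asrc (first s)).+1 = s].
Proof.
move=> s17; have : (0 < anum s <= 18)%N && ((acode (anum s)).1 == s).
  pose p s := (0 < s)%N ==> (0 < anum s <= 18)%N && ((acode (anum s)).1 == s).
  have : all p (iota 0 18) by vm_compute.
  by move=> /allP/(_ s); rewrite mem_iota /p; case/andP: s17 => -> s17; apply.
case/andP=> sr /eqP sE; rewrite asrcE firstE //; split=> //.
by rewrite /srcn sE; case: s s17 {sr sE}.
Qed.

Lemma D_first s l : (0 < s <= 17)%N -> nxt s != 0%N ->
  D (T (Arr (first s)) (nxt s) l) = T (Ver (asrc (first s))) s l.+1.
Proof.
move=> s17 n0; have [_ sE _] := first_props s17.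
rewrite (@mliftT _ _ _ _ _ (Ver (asrc (first s))) s 1) //.
  by rewrite -[LHS]/(T (Ver (asrc (first s))) (acode (first s).+1).1 1) sE.
by case: s s17 {n0 sE}.
Qed.

Lemma cn_vtx (i : 'I_8) n : (0 < cn i n <= 17)%N.
Proof. by have /and5P[c0 _ c17 _ _] := cn_props i n; rewrite lt0n c0. Qed.

Lemma par_cn (i : 'I_8) n : svn (parS i n) = cn i n.
Proof. by rewrite /cn /par; case: (odd n); rewrite ?es_val ?os_val. Qed.

Lemma cn_par (i : 'I_8) n m : cn (parS i n) m =
  svn (if odd m then on (if odd n then on i else en i) else en (if odd n then on i else en i)).
Proof. by rewrite /cn /par; case: (odd n); rewrite ?es_val ?os_val. Qed.

Lemma cn_par_even (i : 'I_8) n m : ~~ (odd n && odd m) -> cn (parS i n) m = cn i (n + m).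
Proof.
rewrite cn_par /cn oddD; case: (odd n) (odd m) => [] [] //= _; apply/eqP.
- by apply: (forall_S (p := fun i => svn (en (on i)) == svn (on i))).
- by apply: (forall_S (p := fun i => svn (on (en i)) == svn (on i))).
by apply: (forall_S (p := fun i => svn (en (en i)) == svn (en i))).
Qed.

(** For two odd indices the moved chain ends two arrows too early. *)
Lemma cn_par_odd (i : 'I_8) n m : odd n && odd m ->
  endn (cn (parS i n) m, 2%N) = cn i (n + m).
Proof.
rewrite cn_par /cn oddD => /andP[-> ->] /=; apply/eqP.
by apply: (forall_S (p := fun i => nxt (nxt (svn (on (on i)))) == svn (en i))).
Qed.

Lemma cn2 i n : cn i n.+2 = cn i n.
Proof. by rewrite /cn /= negbK. Qed.

Lemma nxt_cn (i : 'I_8) n : nxt (cn i n) != 0%N.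
Proof.
rewrite /cn; pose p i := (nxt (svn (on i)) != 0%N) && (nxt (svn (en i)) != 0%N).
by have /andP[] : p i by [apply: forall_S]; case: (odd n).
Qed.

Lemma rel_props (i : 'I_8) : let x := nxt (svn i) in
  [&& 0 < x <= 17, nxt x != 0, endn (nxt x, 4) == cn i 0 & lmax (nxt x) == 5]%N.
Proof.
by apply: (forall_S (p := fun i => let x := nxt (svn i) in
  [&& 0 < x <= 17, nxt x != 0, endn (nxt x, 4) == cn i 0 & lmax (nxt x) == 5]%N)).
Qed.

Lemma first_tgt s : (0 < s <= 17)%N -> (atgt (first s)).+1 = nxt s.
Proof.
move=> s17; have [fE _ _] := first_props s17; rewrite atgtE fE; apply/eqP.
pose p s := (0 < s)%N ==> (endn (acode (anum s)) == nxt s).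
have : all p (iota 0 18) by vm_compute.
by move=> /allP/(_ s); rewrite mem_iota /p; case/andP: s17 => -> s17; apply.
Qed.

Lemma lift_supp w w' m : lvl w' = (m + lvl w)%N ->
  supp_in (fun b => lcell m b /\ tgtI b.2 = vtx w') (lift w w').
Proof.
have TP v s l : lvl v = m -> srcn (s, l) = (vtx v).+1 -> endn (s, l) = (vtx w').+1 ->
    supp_in (fun b => lcell m b /\ tgtI b.2 = vtx w') (T v s l).
  move=> vm sE tE b bT; split; first exact: (T_cell vm sE bT).
  exact: (T_tgt tE bT).
have src_cn (i : 'I_8) n l : srcn (cn i n, l) = cn i n.
  by have /andP[c0 _] := cn_vtx i n; rewrite /srcn /= -[_ == _]negbK -lt0n c0.
have sT s l : (0 < s)%N -> srcn (s, l) = s by case: s.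
case: w => [v|[a|[i n]]] /=.
- rewrite addn0 => w'm; case: eqP => _; last exact: supp_in0.
  exact: TP.
- case: w' TP => [v|[a'|[i [|p]]]] TP /= w'm; try exact: supp_in0.
    have m0 : m = 0%N by move: w'm; rewrite addn1 => -[].
    case: eqP => [aE|_]; last exact: supp_in0.
    by apply: TP; rewrite ?m0 //= aE.
  have m1 : m = 1%N by move: w'm; rewrite addn1 => -[].
  have /and4P[x17 nx /eqP xE _] := rel_props i.
  apply: supp_inB; case: ifP => h; try exact: supp_in0.
    apply: TP; rewrite ?m1 // ?vtx_Hi //.
    by rewrite sT ?lt0n // -[RHS]/((atgt (first (nxt (svn i)))).+1) first_tgt.
  case/andP: h => /eqP iE _.
  apply: TP; first by rewrite m1.
    by rewrite sT // -[RHS]/((atgt (first 7)).+1) first_tgt.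
  by rewrite vtx_Hi iE val_i1.
case: w' TP => [v|[a'|[j p]]] TP /= w'm; try exact: supp_in0.
case: eqP => [ij|_] /=; last exact: supp_in0.
have pE : p = (m + n)%N by move: w'm; rewrite !addnS => -[].
rewrite -ij pE addnK in TP *; case: m pE w'm TP => [|[|m]] pE w'm TP.
- by apply: TP; rewrite // vtx_Hi.
- apply: TP; rewrite // ?vtx_Hi.
    by rewrite sT ?lt0n ?nxt_cn // -[RHS]/((atgt (first (cn i n))).+1) first_tgt // cn_vtx.
  have /and5P[_ _ _ _ /eqP <-] := cn_props i n.
  by rewrite /thr; case: (odd n).
apply: TP; rewrite // ?vtx_Hi // !addSn cn2 addnC.
case: ifP => [nm|/negbT nm]; first exact: cn_par_odd.
by rewrite -cn_par_even.
Qed.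

Lemma dot_idT w s l (v : 'I_17) : endn (s, l) = v.+1 -> dot (T w s l) (idI v) = T w s l.
Proof.
move=> sE; rewrite /T; case: insubP => [k _ kE|_] /=; last exact: bil0l.
rewrite bilUU /fact /= mulI_idr ifT //; apply/eqP/val_inj/succn_inj.
by rewrite [LHS]tgtIE kE.
Qed.

Lemma mlift_idT (F : W -> TT) w w' s l : F w = T w' (vtx w).+1 0 ->
  srcn (s, l) = (vtx w).+1 -> mlift (B := B) F (T w s l) = T w' s l.
Proof.
move=> Fw sE; rewrite mliftT_gen /T; case: insubP => [k _ kE|_] //=.
rewrite Fw -[((vtx w).+1)]/((val (idI (vtx w))).1) -[X in T _ _ X]/((val (idI (vtx w))).2) T_ok.
rewrite bilUU /fact /= mulI_idl ifT //; apply/eqP/val_inj/succn_inj.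
by rewrite [LHS]srcIE kE.
Qed.

Lemma mlift_id (F : W -> TT) w (v : 'I_17) :
  mlift (B := B) F (T w v.+1 0) = dot (F w) (idI v).
Proof. by rewrite -[v.+1]/((val (idI v)).1) -[X in T _ _ X]/((val (idI v)).2) T_ok mliftU. Qed.

Lemma mliftB (F : W -> TT) x y :
  mlift (B := B) F (x - y) = mlift (B := B) F x - mlift (B := B) F y.
Proof. exact: raddfB. Qed.

Lemma lift_bd_ver v w' m : lvl w' = m.+1 ->
  D (lift (Ver v) w') = mlift (B := B) (lift (Ver v)) (lbd w').
Proof.
move=> w'm; have -> : D (lift (Ver v) w') = if src w' == v then lbd w' else 0.
  rewrite /lift; case: eqP => _; last exact: (@mlift0 _ _ B _ _ lbd).
  rewrite mlift_id; case: w' w'm => [u|[a|[i [|n]]]] //= _.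
  - by rewrite dot_idT // -[RHS]/((atgt a).+1) atgtE.
  - have /and5P[_ _ _ _ /and4P[/eqP x5 _ _ _]] := fa_props i.
    rewrite dot_sub dot_idT; last by rewrite x5 -vtx_Hi.
    congr (_ - _); case: eqP => [iE|_]; last exact: bil0l.
    by rewrite dot_idT // -[RHS]/((vtx (Hi i 0)).+1) vtx_Hi iE val_i1.
  have /and5P[_ _ _ _ /eqP cE] := cn_props i n.
  by rewrite dot_idT // cE -[RHS]/((vtx (Hi i n.+1)).+1) vtx_Hi.
have LT w s l : srcn (s, l) = (vtx w).+1 -> mlift (B := B) (lift (Ver v)) (T w s l) =
    if src w == v then T w s l else 0.
  move=> sE; case wv: (src w == v).
    by rewrite (@mlift_idT _ _ w) //= wv.
  by rewrite mliftT_gen; case: insubP => // k _ _; rewrite /lift wv bil0l.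
case: w' w'm => [u|[a|[i [|n]]]] // _.
- rewrite [lbd _]/(T _ _ _) LT //; last first.
    by rewrite -[RHS]/((asrc a).+1) asrcE.
- rewrite [lbd _]/(T _ _ _ - _) mliftB LT; last first.
    by rewrite -[RHS]/((atgt (fa i)).+1) fa_tgt; have /and5P[_ _ /negPf x0 _ _] := fa_props i;
       rewrite /srcn /= x0.
  rewrite -[src (Arr (fa i))]/(asrc (fa i)) fa_src -[src (Hi i 0)]/(sv i).
  have [iE|_] := eqVneq i i1; last first.
    rewrite [mlift (B := B) _ 0](@mlift0 _ _ B _ _ _) !subr0.
    by case: eqP => // _; apply: subr0.
  rewrite LT; last by rewrite -[RHS]/((atgt a7).+1) atgtE val_a7.
  have -> : src (Arr a7) = sv i.
    by apply/val_inj/succn_inj; rewrite [LHS]asrcE sv_val iE val_i1 val_a7.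
  by case: eqP => _; rewrite ?subr0.
rewrite [lbd _]/(T _ _ _) LT //.
by rewrite vtx_Hi /srcn /=; have /and5P[/negPf -> _ _ _ _] := cn_props i n.
Qed.

(** At [Hi i 1] the lift is 0: the tail of length 4 of a relation, extended by a path of length 2,
    is a zero path. *)
Lemma lift_bd_arr a w' m : lvl w' = m.+2 ->
  D (lift (Arr a) w') = mlift (B := B) (lift (Arr a)) (lbd w').
Proof.
case: w' => [u|[b|[i [|[|n]]]]] w'm; try discriminate w'm.
- have /and4P[x17 nx /eqP xE _] := rel_props i.
  have /and5P[_ _ x0 _ _] := fa_props i.
  rewrite [lift _ _]/(_ - _) [lbd _]/(T _ _ _ - _) !mliftB; congr (_ - _).
    rewrite fun_if D_first // [D 0](@mlift0 _ _ B _ _ lbd).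
    rewrite mliftT_gen; case: eqP => [aE|/eqP aE]; last first.
      case: insubP => [k _ _|//]; rewrite [lift _ _](_ : _ = 0) ?bil0l //=.
      by rewrite (negPf aE).
    rewrite -mliftT_gen (@mlift_idT _ _ (Ver (atgt a))).
    + congr (T (Ver _) _ _); apply/val_inj/succn_inj.
      by have [_ _ ->] := first_props x17; rewrite aE fa_tgt.
    + by rewrite /= aE eqxx.
    by rewrite -[RHS]/((atgt (fa i)).+1) fa_tgt /srcn /= (negPf x0).
  case: ifP => [/andP[/eqP iE /eqP aE]|]; last first.
    case: eqP => [iE /=|_ _]; rewrite [D 0](@mlift0 _ _ B _ _ lbd).
      move=> aE; rewrite mliftT_gen; case: insubP => [k _ _|//].
      by rewrite [lift _ _](_ : _ = 0) ?bil0l //= aE.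
    by rewrite [mlift (B := B) _ 0](@mlift0 _ _ B _ _ _).
  rewrite iE eqxx (@D_first 7) // (@mlift_idT _ _ (Ver (atgt a))).
  + congr (T (Ver _) _ _); apply/val_inj/succn_inj.
    have [_ _ ->] := first_props (s := 7) isT.
    by rewrite aE atgtE val_a7.
  + by rewrite /= aE eqxx.
  by rewrite -[RHS]/((atgt a7).+1) atgtE val_a7.
- have /and4P[x17 nx /eqP xE /eqP lx] := rel_props i.
  rewrite [lift _ _]/(0) [D 0](@mlift0 _ _ B _ _ lbd).
  have /and5P[c0 _ _ _ _] := cn_props i 0.
  rewrite [lbd _]/(T _ _ _) mliftT_gen; case: insubP => // k _ kE.
  rewrite [lift _ _]/(_ - _) dot_sub; apply/esym/eqP; rewrite subr_eq0; apply/eqP.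
  transitivity (0 : TT); [|symmetry]; case: ifP => h; try exact: bil0l.
    by rewrite (@dotT _ _ _ _ _ 2) ?xE // T0 // /okI /= lx andbF.
  case/andP: h => /eqP iE _.
  have c12 : cn i 0 = 12 by rewrite iE val_i1.
  by rewrite (@dotT _ _ _ _ _ 2) ?kE ?c12 // T0.
rewrite [lift _ _]/(0) [D 0](@mlift0 _ _ B _ _ lbd).
by rewrite [lbd _]/(T _ _ _) mliftT_gen; case: insubP => // k _ _; rewrite bil0l.
Qed.

Lemma lift_Hi (i : 'I_8) n p m : p = (m + n)%N -> lift (Hi i n) (Hi i p) =
  match m with
  | 0%N => T (Ver (vtx (Hi i n))) (cn i n) 0
  | 1%N => T (Arr (first (cn i n))) (nxt (cn i n)) (thr n).-1
  | m.+2 => T (Hi (parS i n) m) (cn (parS i n) m) (if odd n && odd m then 2 else 0)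
  end.
Proof. by move=> ->; rewrite /lift eqxx addnK. Qed.

Lemma D_Hi (i : 'I_8) n l : D (T (Hi i n.+1) (cn i n.+1) l) = T (Hi i n) (cn i n) (thr n + l).
Proof.
have /and5P[c0 _ _ _ /eqP cE] := cn_props i n.
have /and5P[d0 _ _ _ _] := cn_props i n.+1.
exact: mliftT.
Qed.

Lemma par_end (i : 'I_8) n m :
  endn (cn (parS i n) m, if odd n && odd m then 2 else 0)%N = cn i (n + m).
Proof.
by case: ifP => [nm|/negbT nm]; [exact: cn_par_odd|rewrite -cn_par_even].
Qed.

(** No generator [Hi] ends at vertex 1, so the two-term differential never occurs in a chain reached
    by a lift. *)
Lemma par_i1 (i : 'I_8) n : parS i n != i1.
Proof.
rewrite -val_eqE /= val_i1 /par.
case: (odd n); rewrite ?es_val ?os_val.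
  by apply: (forall_S (p := fun i => on i != 3)%N).
by apply: (forall_S (p := fun i => en i != 3)%N).
Qed.

(** Both sides are a single generator times a path, and the lengths agree because [thr n + thr n.+1]
    is 6, the length of a relation. *)
Lemma lift_bd_hi (i : 'I_8) n w' m : lvl w' = (m.+1 + n.+2)%N ->
  D (lift (Hi i n) w') = mlift (B := B) (lift (Hi i n)) (lbd w').
Proof.
case: w' => [u|[b|[j p]]] w'm; [discriminate w'm|by rewrite addSn addnS in w'm|].
have {w'm} -> : p = (m + n).+1 by move: w'm; rewrite addSn !addnS => -[].
have [<-|ij] := eqVneq i j; last first.
  rewrite [lift _ _](_ : _ = 0); last by rewrite /= ij.
  rewrite [D 0](@mlift0 _ _ B _ _ lbd) [lbd _]/(T _ _ _) mliftT_gen.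
  by case: insubP => // k _ _; rewrite [lift _ _](_ : _ = 0) ?bil0l //= ij.
have /and5P[c0 /eqP lc _ _ /eqP cE] := cn_props i n.
have /and5P[d0 _ _ _ /eqP dE] := cn_props i n.+1.
have c17 := cn_vtx i n.
rewrite (@lift_Hi i n _ m.+1) // [lbd _]/(T _ _ _).
case: m => [|[|m]].
- rewrite D_first ?nxt_cn // add0n (@mlift_idT _ _ (Ver (vtx (Hi i n)))).
  + have [_ _ sE] := first_props c17.
    rewrite prednK /thr; last by case: (odd n).
    congr (T (Ver _) _ _); apply/val_inj/succn_inj.
    by rewrite [LHS]sE -vtx_Hi.
  + by rewrite (@lift_Hi i n _ 0) // vtx_Hi.
  by rewrite vtx_Hi /srcn /= (negPf c0).
- rewrite (_ : (if odd n && odd 0 then 2 else 0)%N = 0%N); last by rewrite andbF.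
  have -> : T (Hi (parS i n) 0) (cn (parS i n) 0) 0 =
      T (Hi (parS i n) 0) (vtx (Hi (parS i n) 0)).+1 0 by rewrite vtx_Hi.
  have lE : lbd (Hi (parS i n) 0) = T (Arr (fa (parS i n))) (nxt (svn (parS i n))) 5.
    rewrite /lbd (negPf (par_i1 i n)); exact: subr0.
  rewrite mlift_id lE.
  have /and5P[_ s0 x0 _ /and4P[/eqP xE _ _ _]] := fa_props (parS i n).
  rewrite dot_idT; last by rewrite xE -vtx_Hi.
  have e : fa (parS i n) = first (cn i n) by rewrite -par_cn.
  rewrite e par_cn (@mliftT _ _ _ _ _ (Arr (first (cn i n))) (nxt (cn i n)) (thr n).-1).
  + by congr (T _ _ _); rewrite /thr /=; case: (odd n).
  + by rewrite (@lift_Hi i n _ 1).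
  + exact: nxt_cn.
  + exact: d0.
  by rewrite -cE /thr; case: (odd n).
have /and5P[e0 _ _ _ _] := cn_props i (m.+2 + n).
have /and5P[f0 _ _ _ _] := cn_props (parS i n) m.
rewrite D_Hi (@mliftT _ _ _ _ _ (Hi (parS i n) m) (cn (parS i n) m) (if odd n && odd m then 2 else 0)%N) //.
- congr (T _ _ _); rewrite /thr /= negbK oddD.
  by case: (odd n); case: (odd m).
- by rewrite (@lift_Hi i n _ m.+2).
by rewrite par_end !addSn cn2 addnC.
Qed.

Lemma lift_bd w w' m : lvl w' = (m.+1 + lvl w)%N ->
  D (lift w w') = mlift (B := B) (lift w) (lbd w').
Proof.
case: w => [v|[a|[i n]]]; rewrite [lvl _ in RHS]/=.
- by rewrite addn0; apply: lift_bd_ver.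
- by rewrite addn1; apply: lift_bd_arr.
exact: lift_bd_hi.
Qed.

Lemma T_coef w w2 s l v : (T w s l)@_(w2, idI v) =
  [&& w == w2, l == 0%N & s == v.+1]%:R.
Proof.
rewrite /T; case: insubP => [k _ kE|sl] /=.
  rewrite mcoeffU xpair_eqE; congr (_%:R); congr (_ && _).
  by rewrite -val_eqE kE /= xpair_eqE andbC.
rewrite mcoeff0; case: eqP => //= _; case: eqP => //= l0; case: eqP => // sv.
by case/negP: sl; rewrite l0 sv; apply: (valP (idI v)).
Qed.

(** An idempotent coefficient occurs exactly where the path in the lift has length 0; in particular
    the paths of length 2 make products of two odd classes vanish. *)
Lemma lift_id w w' w2 : lvl w' = (lvl w2 + lvl w)%N ->
  (lift w w')@_(w2, idI (vtx w2)) = (mul w2 w == Some w')%:R.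
Proof.
have T1 (u u2 : W) l : (T u (vtx u).+1 l)@_(u2, idI (vtx u2)) = ((u == u2) && (l == 0%N))%:R.
  rewrite T_coef; case: eqP => //= <-; by rewrite eqxx andbT.
have T_pos (u u2 : W) s l : l != 0%N -> (T u s l)@_(u2, idI (vtx u2)) = 0.
  by move=> /negPf l0; rewrite T_coef l0 andbF.
case: w => [v|[a|[i n]]].
- rewrite emul_idr /lift => _; case: eqP => [<-|wv].
    rewrite T1 andbT; have [<-|w'2] := eqVneq w' w2; first by rewrite !eqxx.
    case: ifP => // _; case: eqP => // -[w2E].
    by rewrite w2E eqxx in w'2.
  rewrite mcoeff0; case: ifP => // /eqP w2v; case: eqP => // -[w2E].
  by case: wv; rewrite -w2E.
- case: w' => [u|[b|[j [|p]]]] w'E.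
  + by rewrite addn1 in w'E.
  + case: w2 w'E => [v2|w2] w'E; last by move: w'E; rewrite addn1; case: w2.
    rewrite emul_ver /lift.
    have [<-|ab] := eqVneq a b.
      rewrite (T1 (Ver (atgt a))) andbT -[Ver _ == _]/(atgt a == v2).
      by rewrite -[vtx _]/(atgt a); case: ifP => // _; rewrite eqxx.
    rewrite mcoeff0; case: ifP => // _; case: eqP => // -[abE].
    by rewrite abE eqxx in ab.
  + case: w2 w'E => [v2|[a2|[k q]]] w'E; try by move: w'E; rewrite addn1.
    have -> : mul (Arr a2) (Arr a) = None by [].
    rewrite /lift mcoeffB.
    by do 2![case: ifP => _]; rewrite ?mcoeff0 ?T_pos ?subr0.
  rewrite [lift _ _]/(0) mcoeff0.
  by case: w2 w'E => [v2|[a2|[k q]]] w'E; try by move: w'E; rewrite addn1.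
case: w' => [u|[b|[j p]]] w'E; try by move: w'E; rewrite !addnS.
have pE : p = (lvl w2 + n)%N by move: w'E; rewrite !addnS => -[].
have [ij|ij] := eqVneq i j; last first.
  rewrite [lift _ _](_ : _ = 0) ?mcoeff0; last by rewrite /= ij.
  case: eqP => // /emul_src[/= /sv_inj ji _].
  by rewrite ji eqxx in ij.
rewrite -ij pE (@lift_Hi i n _ (lvl w2)) //.
case: w2 {pE w'E} => [v2|[a2|[k q]]].
- rewrite emul_ver -vtx_Hi (T1 (Ver (vtx (Hi i n)))) andbT.
  rewrite -[Ver _ == _]/(vtx (Hi i n) == v2).
  by case: ifP => // _; rewrite add0n eqxx.
- have -> : lvl (Arr a2) = 1%N by [].
  rewrite T_pos //.
  by rewrite /thr; case: (odd n).
have -> : lvl (Hi k q) = q.+2 by [].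
rewrite -vtx_Hi T1.
have -> : mul (Hi k q) (Hi i n) = if (k == parS i n) && ~~ (odd q && odd n)
  then Some (Hi i (q + n).+2) else None by [].
have -> : (Hi (parS i n) q == Hi k q) = (k == parS i n).
  by rewrite -[LHS]/((parS i n == k) && (q == q)) eqxx andbT eq_sym.
rewrite [odd q && _]andbC; case: (k == _) => //=.
by case: (odd n && odd q) => //=; rewrite !addSn eqxx.
Qed.

Definition lv (n : nat) : seq W :=
  match n with
  | 0%N => [seq Ver v | v <- enum 'I_17]
  | 1%N => [seq Arr a | a <- enum 'I_18]
  | m.+2 => [seq Hi i m | i <- enum 'I_8]
  end.

Lemma lv_uniq n : uniq (lv n).
Proof.
by case: n => [|[|n]]; rewrite /lv map_inj_uniq ?enum_uniq // => u v [].
Qed.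

Lemma lvP n w : (w \in lv n) = (lvl w == n).
Proof.
have mem_map_enum m (f : 'I_m -> W) : (w \in [seq f i | i <- enum 'I_m]) = [exists i, w == f i].
  apply/mapP/existsP => [[i _ ->]|[i /eqP ->]]; first by exists i.
  by exists i; rewrite ?mem_enum.
case: n => [|[|n]]; rewrite mem_map_enum; apply/existsP/eqP => [[i /eqP -> //]|];
  case: w {mem_map_enum} => [v|[a|[i m]]] //=.
- by exists v.
- by exists a.
by case=> ->; exists i.
Qed.

End Lifts.

(** * Stackedness of Lambda and Koszulness for an arbitrary resolution *)

Theorem theorem6p4 (K : fieldType) :
  stacked (@Lambda_length K) 6 2 /\
  forall P : resolution (deg0 (@Lambda_length K)),
    koszul (hat (@Ext_deg K (Lambda K) (deg0 (@Lambda_length K)) P)).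
Proof.
split; first exact: lambda_stacked.
move=> P; pose C := lambda_cellular K.
(* Comparison maps in both directions carry the coordinates from the explicit resolution to [P]. *)
have [phi [phi_aug phi_diff]] := comparison P (cres C (@Lambda_lengthP K)).
have [psi [psi_aug psi_diff]] := comparison (cres C (@Lambda_lengthP K)) P.
have okT (w : cW C) : cok w by [].
have mul_lvl := @emul_lvl _ _ _ asrc atgt sv es os.
have mul_vtx := emul_vtx (asrc := asrc) (atgt := atgt) (sv := sv) es_es es_os os_es.
have mul_ver := @emul_ver _ _ _ asrc atgt sv es os.
apply: (@ext_koszul _ _ _ asrc atgt sv es os sv_inj es_es es_os os_es K (Ext P)
  (ecoord (C := C) lv phi_diff psi_diff)
  (eelt (C := C) (@lift_supp K) (@lift_bd K) phi_diff psi_diff)).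
- apply: (ecoordK (C := C) okT lv_uniq lvP mul_lvl mul_vtx mul_ver
    (@lift_supp K) (@lift_bd K) (@lift_id K) phi_diff psi_diff phi_aug psi_aug).
- apply: (eeltK (C := C) okT lv_uniq lvP mul_lvl mul_vtx mul_ver
    (@lift_supp K) (@lift_bd K) (@lift_id K) phi_diff psi_diff phi_aug psi_aug).
- exact: (ecoordP (C := C) lv_uniq lvP phi_diff psi_diff).
- exact: (ecoordM (C := C) okT lv_uniq lvP mul_lvl mul_vtx mul_ver
    (@lift_supp K) (@lift_bd K) (@lift_id K) phi_diff psi_diff phi_aug psi_aug).
- exact: (ecoord1 (C := C) okT lv_uniq lvP phi_diff psi_diff phi_aug psi_aug).
move=> n x.
exact: (hat_ExtP (C := C) okT lv_uniq lvP mul_lvl mul_vtx mul_ver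
    (@lift_supp K) (@lift_bd K) (@lift_id K) phi_diff psi_diff phi_aug psi_aug n x).
Qed.
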